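(* Let $A\subseteq B$ be an aperiodic $C^*$-inclusion with $A\neq 0$ and let $E\colon B\to A$ be a conditional expectation. Let $\mathcal{N}_E$ be the largest two-sided ideal of $B$ contained in $\ker E$. Let $A^+=\{a\in A: a\ge 0\}$ and let $\precsim$ denote the Cuntz preorder on $B^+$. Then (1) for every $b\in B^+$ with $b\notin\mathcal{N}_E$, there is $a\in A^+\setminus\{0\}$ with $a\precsim b$; (2) $A$ supports $B/\mathcal{N}_E$; (3) $A$ detects ideals in $B/\mathcal{N}_E$, and $B/\mathcal{N}_E$ is the only quotient of $B$ with this property; (4) $B$ is simple if and only if $\mathcal{N}_E=0$ and $\overline{BIB}=B$ for every non-zero closed two-sided ideal $I$ of $A$; (5) if $B$ is simple, then $B$ is purely infinite if and only if every element of $A^+\setminus\{0\}$ is infinite in $B$.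
   Context: All ideals are closed and two-sided. A $C^*$-inclusion $A\subseteq B$ is a $C^*$-algebra $B$ with a $C^*$-subalgebra $A$ (an injective $*$-homomorphism $A\hookrightarrow B$ is also treated as an inclusion). A normed $A$-bimodule $X$ is aperiodic if for every $x\in X$, every non-zero hereditary $C^*$-subalgebra $D\subseteq A$ and every $\varepsilon>0$ there is $a\in D$ with $a\ge0$, $\|a\|=1$ and $\|axa\|<\varepsilon$. The inclusion $A\subseteq B$ is aperiodic if the Banach $A$-bimodule $B/A$ with the quotient norm is aperiodic. A conditional expectation $E\colon B\to A$ is a completely positive contraction with $E|_A=\mathrm{id}_A$. Cuntz preorder: for $a,b\in B^+$, $a\precsim b$ means that for every $\varepsilon>0$ there is $x\in B$ with $\|a-x^*bx\|<\varepsilon$. One says that $A$ (or $A^+$) supports $B$ if for every $b\in B^+\setminus\{0\}$ there is $a\in A^+\setminus\{0\}$ with $a\precsim b$ in $B$. $A$ detects ideals in $B$ if $J\cap A\ne0$ for every non-zero ideal $J$ of $B$. A quotient $B/J$ ''has the property that $A$ detects ideals in it'' if the composite $A\to B\to B/J$ is injective and its image detects ideals in $B/J$. $\overline{BIB}$ is the closed linear span of $\{b i b' : b,b'\in B, i\in I\}$. An element $a\in B^+\setminus\{0\}$ is infinite in $B$ if there is $b\in B^+\setminus\{0\}$ such that for all $\varepsilon>0$ there are $x,y\in aB$ with $\|x^*x-a\|<\varepsilon$, $\|y^*y-b\|<\varepsilon$ and $\|x^*y\|<\varepsilon$. ''Purely infinite'' has its standard meaning for simple $C^*$-algebras. *)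

(* Defs.v *)
(* The scalars of all algebras are R[i], for an arbitrary R : realType. *)
From HB Require Import structures.
From mathcomp Require Import all_boot all_order all_algebra complex.
From mathcomp Require Import all_classical all_reals all_analysis.

Set Implicit Arguments.
Unset Strict Implicit.
Unset Printing Implicit Defensive.

Import Order.TTheory GRing.Theory Num.Theory.
Import numFieldNormedType.Exports.

Local Open Scope classical_set_scope.
Local Open Scope ring_scope.
Local Open Scope complex_scope.

Reserved Notation "x ** y" (at level 40, left associativity).

(* C*-algebras are not assumed unital, hence the multiplication is not that of
   a MathComp ring. *)
HB.mixin Record isCStarAlgebra (R : realType) B
    & CompleteNormedModule R[i] B := {
  cmul : B -> B -> B;
  cstar : B -> B;
  cmulA : forall x y z, cmul x (cmul y z) = cmul (cmul x y) z;
  cmulDl : forall x y z, cmul (x + y) z = cmul x z + cmul y z;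
  cmulDr : forall x y z, cmul x (y + z) = cmul x y + cmul x z;
  cmulZl : forall (l : R[i]) x y, cmul (l *: x) y = l *: cmul x y;
  cmulZr : forall (l : R[i]) x y, cmul x (l *: y) = l *: cmul x y;
  cstarD : forall x y, cstar (x + y) = cstar x + cstar y;
  cstarZ : forall (l : R[i]) x, cstar (l *: x) = conjc l *: cstar x;
  cstarM : forall x y, cstar (cmul x y) = cmul (cstar y) (cstar x);
  cstarK : forall x, cstar (cstar x) = x;
  cnormM : forall x y, `|cmul x y| <= `|x| * `|y| ;
  cstar_norm : forall x, `|cmul (cstar x) x| = `|x| ^+ 2
}.

#[short(type="cstarAlgType")]
HB.structure Definition CStarAlgebra (R : realType) :=
  { B of isCStarAlgebra R B & CompleteNormedModule R[i] B }.

Notation "x ** y" := (cmul x y) : ring_scope.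

Section Basics.
Context {R : realType} {B : cstarAlgType R}.
Implicit Types (a b d p x y : B) (S A D I J : set B).

(* The norm of a normed module over R[i] takes its (real) values in R[i]. *)
Definition cnorm x : R := complex.Re `|x|.

Definition nonzero S := exists2 x, S x & x != 0.

Definition subspace S :=
  [/\ S 0, forall x y, S x -> S y -> S (x + y) &
      forall (l : R[i]) x, S x -> S (l *: x)].

Definition cstar_subalgebra A :=
  [/\ subspace A, closed A, forall x y, A x -> A y -> A (x ** y) &
      forall x, A x -> A (cstar x)].

(* I is a closed two-sided ideal of the algebra A; ideals of B are those of
   setT. *)
Definition ideal A I :=
  [/\ I `<=` A, subspace I, closed I &
      forall a x, A a -> I x -> I (a ** x) /\ I (x ** a)].

Definition linear_span S : set B :=
  [set v | exists n (l : 'I_n -> R[i]) (s : 'I_n -> B),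
     (forall k, S (s k)) /\ v = \sum_(k < n) l k *: s k].

(* The norm of the class of x in B / S. *)
Definition quotient_norm S x : R := inf [set cnorm (x - y) | y in S].

End Basics.

(* v is self-adjoint with spectrum in [0, +oo[. The spectrum is computed in the
   unitization: for l != 0 and u = l^-1 v, the element l - v is invertible there
   iff 1 - u has an inverse, which is then of the form 1 - w with w in the
   algebra, i.e. u + w = u w = w u. In R[i], 0 <= l means that l is a
   nonnegative real. The operations are arguments so that the same definition
   applies to B and to the matrix algebras over B. *)
Definition spectrally_positive (R : realType) (V : zmodType)
    (scale : R[i] -> V -> V) (mul : V -> V -> V) (star : V -> V) (v : V) :=
  star v = v /\
  forall l : R[i], ~~ (0 <= l) ->
    let u := scale l^-1 v in
    exists w, u + w = mul u w /\ u + w = mul w u.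

Section Positivity.
Context {R : realType} {B : cstarAlgType R}.
Implicit Types (a b d p x y : B) (A D I J : set B).

Definition positive b := spectrally_positive (R := R) *:%R cmul cstar b.

Definition cle a b := positive (b - a).

Definition mx_scale n (l : R[i]) (M : 'M[B]_n) : 'M[B]_n :=
  map_mx (fun x => l *: x) M.
Definition mx_cmul n (M N : 'M[B]_n) : 'M[B]_n :=
  \matrix_(i, j) \sum_k M i k ** N k j.
Definition mx_cstar n (M : 'M[B]_n) : 'M[B]_n :=
  \matrix_(i, j) cstar (M j i).

Definition mx_positive n (M : 'M[B]_n) :=
  spectrally_positive (@mx_scale n) (@mx_cmul n) (@mx_cstar n) M.

(* E is a map into a C*-subalgebra A of B; matrices over A are positive over A
   iff they are positive over B. *)
Definition completely_positive (E : B -> B) :=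
  forall n (M : 'M[B]_n), mx_positive M -> mx_positive (map_mx E M).

Definition conditional_expectation A (E : {linear B -> B}) :=
  [/\ forall b, A (E b), forall a, A a -> E a = a,
      forall b, cnorm (E b) <= cnorm b & completely_positive E].

Definition hereditary A D :=
  [/\ cstar_subalgebra D, D `<=` A &
      forall d a, D d -> A a -> positive a -> cle a d -> D a].

(* An element of the Banach A-bimodule B / A is given by a representative x in
   B; the norm of its image under the action of a on both sides is the quotient
   norm of a x a. *)
Definition aperiodic A :=
  forall x D (e : R), hereditary A D -> nonzero D -> 0 < e ->
    exists a, [/\ D a, positive a, cnorm a = 1 &
                  quotient_norm A (a ** x ** a) < e].

Definition cuntz_le a b :=
  forall e : R, 0 < e -> exists x, cnorm (a - cstar x ** b ** x) < e.

Definition supports A :=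
  forall b, positive b -> b != 0 ->
    exists a, [/\ A a, positive a, a != 0 & cuntz_le a b].

Definition detects_ideals A :=
  forall J, ideal setT J -> nonzero J -> nonzero (J `&` A).

(* The union of all ideals of B contained in ker E; it is the largest one by
   max_kernel_ideal_largest below. *)
Definition max_kernel_ideal (E : B -> B) : set B :=
  [set b | exists J, [/\ ideal setT J, forall x, J x -> E x = 0 & J b]].

Definition infinite a :=
  [/\ positive a, a != 0 &
   exists b, [/\ positive b, b != 0 & forall e : R, 0 < e ->
     exists x y,
       [/\ exists c, x = a ** c, exists c, y = a ** c,
           cnorm (cstar x ** x - a) < e, cnorm (cstar y ** y - b) < e &
           cnorm (cstar x ** y) < e]]].

Definition projection p := cstar p = p /\ p ** p = p.

(* p is Murray-von Neumann equivalent to a proper subprojection of itself. *)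
Definition infinite_projection p :=
  projection p /\ exists v,
    [/\ cstar v ** v = p, cle (v ** cstar v) p & v ** cstar v != p].

End Positivity.

Definition simple {R : realType} (B : cstarAlgType R) :=
  nonzero [set: B] /\
  forall J : set B, ideal setT J -> J = [set 0] \/ J = setT.

(* Cuntz's definition, for simple B. *)
Definition purely_infinite {R : realType} (B : cstarAlgType R) :=
  forall D : set B, hereditary setT D -> nonzero D ->
    exists2 p, D p & infinite_projection p.

(* pi exhibits Q as the quotient C*-algebra B / J: it is a surjective
   *-homomorphism with kernel J, and Q carries the quotient norm; this
   determines Q up to isometric *-isomorphism. *)
Definition is_quotient {R : realType} (B Q : cstarAlgType R) (J : set B)
    (pi : {linear B -> Q}) :=
  [/\ forall x y, pi (x ** y) = pi x ** pi y,
      forall x, pi (cstar x) = cstar (pi x),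
      forall y, exists x, pi x = y,
      forall x, pi x = 0 <-> J x &
      forall x, cnorm (pi x) = quotient_norm J x].

Definition detects_ideals_in_quotient {R : realType} (B Q : cstarAlgType R)
    (A : set B) (pi : {linear B -> Q}) :=
  (forall x y, A x -> A y -> pi x = pi y -> x = y) /\
  detects_ideals (pi @` A).

Section MaxKernelIdeal.
Context {R : realType} {B : cstarAlgType R}.
Implicit Types (x y : B) (L J : set B).

Let closure_image (f : B -> B) L L' : continuous f ->
  (forall x, L x -> L' (f x)) -> forall x, closure L x -> closure L' (f x).
Proof.
move=> cf LL' x Lx V /cf Vfx.
by have [z [Lz Vz]] := Lx _ Vfx; exists (f z); split => //; exact: LL'.
Qed.

Let bounded_cont (f : B -> B) (k : R[i]) :
  (forall x y, f (x - y) = f x - f y) -> 0 <= k ->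
  (forall x, `|f x| <= k * `|x|) -> continuous f.
Proof.
move=> fB k0 fk x; apply/cvgrPdist_lt => e e0.
have k1 : 0 < k + 1 by rewrite ltr_wpDl.
near=> y; rewrite -fB; apply: le_lt_trans (fk _) _.
have H : `|x - y| < e / (k + 1).
  by near: y; apply: cvgr_dist_lt => //; rewrite divr_gt0.
apply: le_lt_trans (_ : (k + 1) * `|x - y| < _).
  by rewrite ler_wpM2r// lerDl.
by rewrite mulrC -ltr_pdivlMr.
Unshelve. all: by end_near. Qed.

Let closure_ideal (E : {linear B -> B}) L :
  (forall b, cnorm (E b) <= cnorm b) -> subspace L ->
  (forall a x, L x -> L (a ** x) /\ L (x ** a)) ->
  (forall x, L x -> E x = 0) ->
  ideal setT (closure L) /\ forall x, closure L x -> E x = 0.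
Proof.
move=> Ec [L0 LD LZ] LM LE.
have cmulB1 a x y : a ** (x - y) = a ** x - a ** y.
  by rewrite cmulDr -scaleN1r cmulZr scaleN1r.
have cmulB2 a x y : (x - y) ** a = x ** a - y ** a.
  by rewrite cmulDl -scaleN1r cmulZl scaleN1r.
split; last first.
  move=> x Lx.
  have cE : continuous E.
    apply: (@bounded_cont _ 1) => // [u v|u]; first by rewrite linearB.
    have := Ec u; rewrite mul1r /cnorm.
    move: (normr_ge0 (E u)) (normr_ge0 u).
    case: (`|E u|) => p q; case: (`|u|) => r s.
    by rewrite !lecE /= => /andP[/eqP -> _] /andP[/eqP -> _] ->; rewrite eqxx.
  have := closure_image (L' := [set 0]) cE LE Lx.
  rewrite -(closure_id _).1 //.
  exact/accessible_closed_set1/hausdorff_accessible/norm_hausdorff.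
split=> //.
- split; first exact: subset_closure.
  + have LDc x y : L x -> closure L y -> closure L (x + y).
      move=> Lx; apply: (closure_image (f := fun y => x + y)).
        by move=> z; apply: cvgD; [exact: cvg_cst|exact: cvg_id].
      by move=> z; exact: LD.
    move=> x y Lx Ly.
    rewrite (closure_id (closure L)).1; last exact: closed_closure.
    apply: (closure_image (f := fun x => x + y)) Lx.
      by move=> z; apply: cvgD; [exact: cvg_id|exact: cvg_cst].
    by move=> z Lz; exact: LDc.
  + move=> l; apply: closure_image; last exact: LZ.
    exact: scaler_continuous.
- exact: closed_closure.
- move=> a x _ Lx; split.
    apply: (closure_image (f := fun x => a ** x)) Lx.
      apply: (@bounded_cont _ `|a|) => // z; exact: cnormM.
    by move=> z /(LM a)[].
  apply: (closure_image (f := fun x => x ** a)) Lx.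
    apply: (@bounded_cont _ `|a|) => // z; rewrite mulrC; exact: cnormM.
  by move=> z /(LM a)[].
Qed.

Lemma max_kernel_ideal_largest (A : set B) (E : {linear B -> B}) :
  conditional_expectation A E ->
  [/\ ideal setT (max_kernel_ideal E),
      forall x, max_kernel_ideal E x -> E x = 0 &
      forall J, ideal setT J -> (forall x, J x -> E x = 0) ->
        J `<=` max_kernel_ideal E].
Proof.
case=> _ _ Ec _; set N := max_kernel_ideal E.
have NE x : N x -> E x = 0 by move=> [J [_ + ?]]; exact.
have Nmax J : ideal setT J -> (forall x, J x -> E x = 0) -> J `<=` N.
  by move=> iJ JE x Jx; exists J.
split=> //.
have NM a x : N x -> N (a ** x) /\ N (x ** a).
  move=> [J [iJ JE Jx]]; have [_ _ _ JM] := iJ.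
  by have [] := JM a x I Jx; split; exists J.
have N0 : N 0.
  pose L := [set 0 : B].
  have mul0 a : a ** 0 = 0 by apply: (addrI (a ** 0)); rewrite -cmulDr !addr0.
  have mul0' a : 0 ** a = 0 by apply: (addrI (0 ** a)); rewrite -cmulDl !addr0.
  have [|a x ->|x ->|iL LE] := @closure_ideal E L Ec; first split=> //.
  + by move=> x y -> ->; rewrite addr0.
  + by move=> l x ->; rewrite scaler0.
  + by rewrite mul0 mul0'.
  + by rewrite linear0.
  + by exists (closure L); split=> //; exact: subset_closure.
have ND x y : N x -> N y -> N (x + y).
  move=> [J [iJ JE Jx]] [K [iK KE Ky]].
  have [_ [J0 JD JZ] _ JM] := iJ; have [_ [K0 KD KZ] _ KM] := iK.
  pose L := [set z | exists u v, [/\ J u, K v & z = u + v]].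
  have [||z|iL LE] := @closure_ideal E L Ec.
  - split; first by exists 0, 0; rewrite addr0.
    + move=> _ _ [u [v [Ju Kv ->]]] [u' [v' [Ju' Kv' ->]]].
      by exists (u + u'), (v + v'); rewrite addrACA; split; auto.
    + by move=> l _ [u [v [Ju Kv ->]]]; exists (l *: u), (l *: v);
        rewrite scalerDr; split; auto.
  - move=> a _ [u [v [Ju Kv ->]]].
    have [au ua] := JM a u I Ju; have [av va] := KM a v I Kv.
    by rewrite cmulDl cmulDr; split; [exists (a ** u), (a ** v)|
      exists (u ** a), (v ** a)].
  - by move=> [u [v [Ju Kv ->]]]; rewrite linearD JE// KE// addr0.
  - by exists (closure L); split=> //; apply: subset_closure; exists x, y.
have NZ (l : R[i]) x : N x -> N (l *: x).
  move=> [J [iJ JE Jx]]; have [_ [_ _ JZ] _ _] := iJ.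
  by exists J; split=> //; exact: JZ.
have [//|//|//|iN cNE] := @closure_ideal E N Ec.
suff <- : closure N = N by [].
by apply/seteqP; split; [exact: Nmax|exact: subset_closure].
Qed.

End MaxKernelIdeal.

(* Main.v *)
From HB Require Import structures.
From Stdlib Require Ncring Ncring_tac.
Require Import Defs.
From mathcomp Require Import all_boot all_order all_algebra complex.
From mathcomp Require Import all_classical all_reals all_analysis.
From mathcomp Require Import ring lra.
Import Order.TTheory GRing.Theory Num.Theory.
Import numFieldNormedType.Exports.
Local Open Scope classical_set_scope.
Local Open Scope ring_scope.
Local Open Scope complex_scope.

(** Everything rests on part (1). Let b >= 0 lie outside N = N_E. Some c in the
    unitization of B satisfies E(c^* b c) != 0, for otherwise polarization gives
    E(y b z) = 0 for all y and z, and the set of all b with this property is a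
    closed ideal inside ker E (max_kernel_of_compressions). Scale c so that
    a0 = E(c^* b c) has norm 1. Aperiodicity, applied to the hereditary
    subalgebra of A on which a0 is at least 3/4, gives d >= 0 of norm 1 there
    such that w = d c^* b c d is very close to A. Since E is contractive and
    A-bilinear (condexp_mul), w is close to E(w) = d a0 d, which is an element x
    of A with norm at least 3/4. So ((x - 1/2)_+)^2 is a nonzero element of A
    that is dominated by a multiple of a compression of b, and therefore lies
    below b in the Cuntz preorder (support_off_kernel).

    Parts (2) to (4) follow formally: lift positive elements along the quotient
    map, and use that a closed ideal is hereditary for the Cuntz preorder
    (ideal_cuntz), so that an ideal of B not contained in N meets A.

    Part (5). Let B be simple. If a is infinite, then inside a B one finds, up to
    small errors, orthogonal elements x and y with x^* x and y^* y equal to any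
    two given positive elements (approx_pair_all): the possible values of y^* y
    come from a closed ideal of B. In particular every positive element lies
    below a. If all nonzero elements of A^+ are infinite, part (1) now makes all
    nonzero positive elements of B Cuntz equivalent. In this situation every
    nonzero hereditary subalgebra D contains a nonzero projection
    (hereditary_projection): functional calculus and the Cuntz preorder produce
    x in D with x^* x x = x, and x is turned into an isometry of D + C whose range
    projection has its complement in D; if that complement is 0, then x^* x is a
    projection. The projection dominates an infinite element of A, hence is
    infinite. Conversely, in a purely infinite B the
    hereditary subalgebra generated by a in A^+ contains an infinite projection p,
    and as p is in the closure of a B, the freedom provided by approx_pair_all
    for p passes to a (approx_pair_closure).

    The bulk of the text builds the C*-algebra theory used on the way, inside
    the unitization of B, with inB : B -> unitization B the inclusion and u.1 the
    scalar part of u. Functional calculus is reduced to three operations that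
    stay in every closed subalgebra: square roots, positive parts and resolvents.
    A self-adjoint v counts as positive when its distance to some t >= 0 is at
    most t (upos); this notion is compared with the spectrum in both directions
    (upos_spec, upos_of_spec), because the definitions of positivity and of
    complete positivity are spectral. *)

(** * Unital C*-algebras *)

Definition cabs {R : realType} (l : R[i]) : R := complex.Re `|l|.

(** Unital C*-algebras, a structure that will be given to unitizations.
    Completeness is asked for sequences whose increments are at most those of a
    bounded real sequence: the limits taken below are of iterations that come
    with such a majorant, and this form passes to unitizations coordinate by
    coordinate. *)
HB.mixin Record isUnitalCStar (R : realType) U & GRing.Algebra R[i] U := {
  star : U -> U;
  nrm : U -> R;
  starD : forall x y, star (x + y) = star x + star y;
  starZ : forall (l : R[i]) x, star (l *: x) = conjc l *: star x;
  starM : forall x y, star (x * y) = star y * star x;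
  starK : forall x, star (star x) = x;
  nrmD : forall x y, nrm (x + y) <= nrm x + nrm y;
  nrmZ : forall (l : R[i]) x, nrm (l *: x) = cabs l * nrm x;
  nrm_eq0 : forall x, nrm x = 0 -> x = 0;
  nrmM : forall x y, nrm (x * y) <= nrm x * nrm y;
  nrm_starM : forall x, nrm (star x * x) = nrm x ^+ 2;
  nrm_complete : forall (u : nat -> U) (t : nat -> R) (M : R),
    (forall n, nrm (u n.+1 - u n) <= t n.+1 - t n) -> (forall n, t n <= M) ->
    exists l : U, forall e : R, 0 < e ->
      exists N, forall n, (N <= n)%N -> nrm (u n - l) < e
}.

#[short(type="ucstarType")]
HB.structure Definition UnitalCStar (R : realType) :=
  { U of isUnitalCStar R U & GRing.Algebra R[i] U }.

(** Identities between products of operators, in which scalars commute only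
    through the lemma rsc_comm: the tactic ring does not apply, and Ncring
    normalizes noncommutative polynomials with integer coefficients. *)
Section Ncring.
Variable U : nzRingType.

#[local] Instance nc_ops : @Ncring.Ring_ops U 0 1 +%R *%R (fun x y => x - y) -%R eq := {}.

#[local] Instance nc_ring : Ncring.Ring (Ro := nc_ops).
Proof.
split; rewrite /Algebra_syntax.equality /Ncring.eq_notation /Algebra_syntax.addition /Ncring.add_notation /Algebra_syntax.multiplication /Ncring.mul_notation /Algebra_syntax.subtraction /Ncring.sub_notation /Algebra_syntax.opposite /Ncring.opp_notation /Algebra_syntax.zero /Ncring.zero_notation /Algebra_syntax.one /Ncring.one_notation.
- exact: RelationClasses.eq_equivalence.
- by move=> x y -> z t ->.
- by move=> x y -> z t ->.
- by move=> x y -> z t ->.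
- by move=> x y ->.
- exact: add0r.
- exact: addrC.
- exact: addrA.
- exact: mul1r.
- exact: mulr1.
- exact: mulrA.
- exact: mulrDl.
- by move=> x y z; rewrite mulrDr.
- by [].
- exact: subrr.
Defined.
End Ncring.
#[global] Existing Instance nc_ops.
#[global] Existing Instance nc_ring.
(** Applying this first makes unification find the ring structure of the
    carrier. *)
Lemma nc_eq (U : nzRingType) (x y : U) : x = y -> x = y. Proof. by []. Qed.
Ltac ncring := refine (@nc_eq _ _ _ _); Ncring_tac.non_commutative_ring.

Set Implicit Arguments. Unset Strict Implicit. Unset Printing Implicit Defensive.

(** * The norm of a unital C*-algebra *)

Section Scalars.
Context {R : realType}.
Implicit Types (l m : R[i]) (t : R).

Lemma normcE l : `|l| = (cabs l)%:C.
Proof. rewrite /cabs normc_def /=. by []. Qed.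

Lemma cabs_ge0 l : 0 <= cabs l.
Proof. by rewrite -lecR -normcE normr_ge0. Qed.

Lemma cabs_real t : cabs t%:C = `|t|.
Proof. by rewrite /cabs normc_def /= expr0n addr0 sqrtr_sqr. Qed.

Lemma cabs_i : cabs ('i : R[i]) = 1.
Proof. by rewrite /cabs normc_def /= expr0n expr1n add0r sqrtr1. Qed.

Lemma cabsM l m : cabs (l * m) = cabs l * cabs m.
Proof. by apply: (@complexI R); rewrite rmorphM -!normcE normrM. Qed.

Lemma cabsD l m : cabs (l + m) <= cabs l + cabs m.
Proof. by rewrite -lecR rmorphD -!normcE ler_normD. Qed.

Lemma cabs_eq0 l : cabs l = 0 -> l = 0.
Proof. by move=> l0; apply/eqP; rewrite -normr_eq0 normcE l0. Qed.

Lemma conjcR t : conjc t%:C = t%:C.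
Proof. by rewrite /= oppr0. Qed.

End Scalars.

Lemma conjc_i (R : realType) : conjc ('i : R[i]) = - 'i.
Proof. by rewrite /= -complexiE; congr (_ +i* _)%C; rewrite oppr0. Qed.

Section Norm.
Context {R : realType} {U : ucstarType R}.
Implicit Types (x y z : U) (t : R).

Lemma nrm0 : nrm (0 : U) = 0.
Proof. by rewrite -[X in nrm X](scale0r 0) nrmZ (cabs_real 0) normr0 mul0r. Qed.

Lemma nrmN x : nrm (- x) = nrm x.
Proof. by rewrite -scaleN1r nrmZ (_ : -1 = (-1)%:C) ?cabs_real ?normrN1 ?mul1r// rmorphN1. Qed.

Lemma nrm_ge0 x : 0 <= nrm x.
Proof. by have := nrmD x (- x); rewrite subrr nrm0 nrmN; lra. Qed.
Hint Resolve nrm_ge0 : core.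

Lemma nrmB x y : nrm (x - y) <= nrm x + nrm y.
Proof. by rewrite -(nrmN y) nrmD. Qed.

Lemma nrmBC x y : nrm (x - y) = nrm (y - x).
Proof. by rewrite -nrmN opprB. Qed.

Lemma nrm_tri x y z : nrm (x - z) <= nrm (x - y) + nrm (y - z).
Proof. by have := nrmD (x - y) (y - z); rewrite addrA subrK. Qed.

Lemma star0 : star (0 : U) = 0.
Proof. by apply: (addrI (star 0)); rewrite -starD !addr0. Qed.

Lemma starN x : star (- x) = - star x.
Proof. by apply: (addrI (star x)); rewrite -starD !subrr star0. Qed.

Lemma starB x y : star (x - y) = star x - star y.
Proof. by rewrite starD starN. Qed.

Lemma star1 : star (1 : U) = 1.
Proof. by have := starM (star (1 : U)) 1; rewrite mulr1 !starK mulr1. Qed.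

Lemma nrm_star x : nrm (star x) = nrm x.
Proof.
have le y : nrm y <= nrm (star y).
  have := nrm_starM y; have := nrmM (star y) y.
  have [->|y0] := eqVneq (nrm y) 0; first by rewrite nrm_ge0.
  by have y1 : 0 < nrm y; [rewrite lt_neqAle eq_sym y0 nrm_ge0|nra].
by apply/le_anti; rewrite le -{2}(starK x) le.
Qed.

Lemma nrmsq x : star x = x -> nrm (x * x) = nrm x ^+ 2.
Proof. by move=> {1}<-; rewrite nrm_starM. Qed.

Lemma nrm1_le : nrm (1 : U) <= 1.
Proof. by have := nrmsq star1; rewrite mulr1; nra. Qed.

(** Real scalars as elements of the algebra, so that noncommutative polynomials
    can mention them. *)
Definition rsc t : U := t%:C *: 1.

Lemma rscE t x : rsc t * x = t%:C *: x. Proof. exact: mulr_algl. Qed.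
Lemma rsc_comm t x : x * rsc t = rsc t * x.
Proof. by rewrite /rsc mulr_algl mulr_algr. Qed.
Lemma rsc1 : rsc 1 = 1. Proof. exact: scale1r. Qed.
Lemma rsc0 : rsc 0 = 0. Proof. exact: scale0r. Qed.
Lemma rscD t u : rsc (t + u) = rsc t + rsc u.
Proof. by rewrite /rsc rmorphD scalerDl. Qed.
Lemma rscN t : rsc (- t) = - rsc t.
Proof. by rewrite /rsc rmorphN scaleNr. Qed.
Lemma rscB t u : rsc (t - u) = rsc t - rsc u.
Proof. by rewrite rscD rscN. Qed.
Lemma rscM t u : rsc (t * u) = rsc t * rsc u.
Proof. by rewrite rscE /rsc rmorphM scalerA. Qed.
Lemma rscMV t : t != 0 -> rsc t * rsc t^-1 = 1.
Proof. by move=> t0; rewrite -rscM mulfV// rsc1. Qed.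
Lemma star_rsc t : star (rsc t) = rsc t.
Proof. by rewrite starZ conjcR star1. Qed.
Lemma nrm_rscM t x : nrm (rsc t * x) = `|t| * nrm x.
Proof. by rewrite rscE nrmZ cabs_real. Qed.
Lemma nrm_rsc t : nrm (rsc t) <= `|t|.
Proof.
by rewrite -[rsc t]mulr1 nrm_rscM; have := nrm1_le; have := normr_ge0 t; nra.
Qed.

(** Equalities between limits are obtained in this form. *)
Lemma nrm_small x (C : R) : (forall e : R, 0 < e -> nrm x <= C * e) -> x = 0.
Proof.
move=> H; apply: nrm_eq0; apply/eqP; rewrite eq_le nrm_ge0 andbT.
apply/ler_addgt0Pl => z z0; rewrite addr0.
have C1 : 0 < `|C| + 1 by have := normr_ge0 C; lra.
have e0 : 0 < z / (`|C| + 1) by rewrite divr_gt0.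
apply: le_trans (H _ e0) _.
rewrite mulrA ler_pdivrMr//; have := ler_norm C; nra.
Qed.

(** Closed unital subalgebras, not necessarily self-adjoint. The limits that
    define square roots, inverses and positive parts stay in every such set. *)
Definition ucs (S : set U) := [/\ S 1, forall x y, S x -> S y -> S (x + y),
  forall x y, S x -> S y -> S (x * y), forall (l : R[i]) x, S x -> S (l *: x) &
  forall x, (forall e : R, 0 < e -> exists2 y, S y & nrm (x - y) < e) -> S x].

Lemma ucs_rsc S t : ucs S -> S (rsc t).
Proof. by case=> ? _ _ SZ _; exact: SZ. Qed.

Lemma ucsN S x : ucs S -> S x -> S (- x).
Proof. by case=> ? _ _ SZ _ Sx; rewrite -scaleN1r; exact: SZ. Qed.

Lemma ucsB S x y : ucs S -> S x -> S y -> S (x - y).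
Proof. by move=> hS Sx Sy; have [_ SD _ _ _] := hS; apply: SD => //; exact: ucsN. Qed.

Lemma ucs0 S : ucs S -> S 0.
Proof. by move=> hS; rewrite -rsc0; exact: ucs_rsc. Qed.

Lemma ucs_comm z : ucs [set x | x * z = z * x].
Proof.
split => /=.
- by rewrite mul1r mulr1.
- by move=> x y xz yz; rewrite mulrDl mulrDr xz yz.
- by move=> x y xz yz; rewrite -mulrA yz mulrA xz mulrA.
- by move=> l x xz; rewrite -scalerAl xz scalerAr.
- move=> x H; apply: subr0_eq.
  apply: (@nrm_small _ (2 * nrm z)) => e e0.
  have [y yz xy] := H _ e0.
  have -> : x * z - z * x = (x - y) * z - z * (x - y).
    rewrite mulrBl mulrBr yz; ncring.
  apply: le_trans (nrmB _ _) _.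
  have := nrmM (x - y) z; have := nrmM z (x - y).
  have := nrm_ge0 z; nra.
Qed.

(** * Square roots by iteration *)

(** Visser's iteration y -> (x + y^2) / 2. At a fixed point, (1 - y)^2 = 1 - x;
    so square roots only need ring operations and one limit. The scalar
    iteration visserR is the case x = 1, which majorizes the others. *)
Fixpoint visser x n : U :=
  if n is n'.+1 then rsc 2^-1 * (x + visser x n' * visser x n') else 0.

Fixpoint visserR n : R := if n is n'.+1 then (1 + visserR n' ^+ 2) / 2 else 0.

Lemma visserR_bound n : 0 <= visserR n <= 1.
Proof. by elim: n => [|n IH] /=; lra || nra. Qed.

Lemma visser_sa x n : star x = x -> star (visser x n) = visser x n.
Proof.
move=> sx; elim: n => [|n IH] /=; first by rewrite star0.
by rewrite starM starD starM !IH sx star_rsc rsc_comm.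
Qed.

Lemma visser_in S x n : ucs S -> S x -> S (visser x n).
Proof.
move=> hS Sx; have [S1 SD SM SZ _] := hS.
elim: n => [|n IH] /=; first exact: ucs0.
by apply: (SM); [exact: ucs_rsc|apply: SD => //; exact: SM].
Qed.

Lemma visser_nrm x n : nrm x <= 1 -> nrm (visser x n) <= visserR n.
Proof.
move=> x1; elim: n => [|n IH] /=; first by rewrite nrm0.
rewrite nrm_rscM ger0_norm ?invr_ge0// mulrC ler_wpM2r ?invr_ge0//.
apply: le_trans (nrmD _ _) _.
have := nrmM (visser x n) (visser x n); have := nrm_ge0 (visser x n); nra.
Qed.

(** The difference of consecutive terms is (a^2 - b^2) / 2. Writing it as a
    symmetrized product of a - b and a + b avoids any commutation argument. *)
Lemma visser_step x n : nrm x <= 1 ->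
  nrm (visser x n.+1 - visser x n) <= visserR n.+1 - visserR n.
Proof.
move=> x1; elim: n => [|n IH].
  rewrite /= subr0 mulr0 addr0 nrm_rscM ger0_norm ?invr_ge0//.
  by rewrite expr0n/= addr0 subr0; nra.
set a := visser x n.+1 in IH *; set b := visser x n in IH *.
set ra := visserR n.+1 in IH *; set rb := visserR n in IH *.
have -> : visser x n.+2 - a =
   rsc (2^-1) * (rsc (2^-1) * ((a - b) * (a + b) + (a + b) * (a - b))).
  rewrite (_ : visser x n.+2 = rsc 2^-1 * (x + a * a))//.
  have aE : a = rsc 2^-1 * (x + b * b) by [].
  rewrite [X in _ - X = _]aE -mulrBr; congr (_ * _).
  have -> : x + a * a - (x + b * b) = a * a - b * b by ncring.
  have -> : (a - b) * (a + b) + (a + b) * (a - b) = (1 + 1) * (a * a - b * b) by ncring.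
  by rewrite -rsc1 -rscD mulrA -rscM mulVf// rsc1 mul1r.
have -> : visserR n.+2 - ra = (ra - rb) * (ra + rb) / 2.
  rewrite (_ : visserR n.+2 = (1 + ra ^+ 2) / 2)//.
  have raE : ra = (1 + rb ^+ 2) / 2 by [].
  by rewrite [X in _ - X = _]raE; field.
rewrite !nrm_rscM ger0_norm ?invr_ge0//.
have H1 := nrmD ((a - b) * (a + b)) ((a + b) * (a - b)).
have H2 := nrmM (a - b) (a + b); have H3 := nrmM (a + b) (a - b).
have H4 := nrmD a b; have H5 := visser_nrm n.+1 x1; have H6 := visser_nrm n x1.
rewrite -/a -/ra in H5; rewrite -/b -/rb in H6.
have H7 := nrm_ge0 (a - b).
have H8 := nrm_ge0 (a + b).
have H9 : nrm (a - b) * nrm (a + b) <= (ra - rb) * (ra + rb).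
  by apply: ler_pM => //; lra.
nra.
Qed.

Lemma visser_lim x : star x = x -> nrm x <= 1 ->
  exists y, [/\ star y = y, nrm y <= 1, (1 - y) * (1 - y) = 1 - x &
    forall S, ucs S -> S x -> S y].
Proof.
move=> sx x1.
have [y Hy] := nrm_complete _ _ _ (fun n => visser_step n x1) (fun n => proj2 (andP (visserR_bound n))).
have Hy' (e : R) : 0 < e -> exists n, nrm (visser x n - y) < e /\ nrm (visser x n.+1 - y) < e.
  by move=> e0; have [N HN] := Hy e e0; exists N; split; apply: HN.
have y1 : nrm y <= 1.
  apply/ler_addgt0Pl => e e0; have [n [Hn _]] := Hy' e e0.
  have := nrmB (visser x n) (visser x n - y); rewrite subKr.
  have := visser_nrm n x1; have /andP[_] := visserR_bound n; lra.
exists y; split => //.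
- apply: subr0_eq; apply: (@nrm_small _ 2) => e e0; have [n [Hn _]] := Hy' e e0.
  have -> : star y - y = (visser x n - y) - star (visser x n - y).
    rewrite starB visser_sa//; ncring.
  by apply: le_trans (nrmB _ _) _; rewrite nrm_star; lra.
- apply: subr0_eq; apply: (@nrm_small _ 4) => e e0; have [n [Hn Hn1]] := Hy' e e0.
  set a := visser x n in Hn *; set b := visser x n.+1 in Hn1 *.
  have bE : b + b = x + a * a.
    have h : 2^-1 + 2^-1 = 1 :> R by field.
    by rewrite /b /= -/a -mulrDl -rscD h rsc1 mul1r.
  have -> : (1 - y) * (1 - y) - (1 - x) =
     (b - y) + (b - y) - ((a - y) * a + y * (a - y)).
    have -> : (b - y) + (b - y) = (x + a * a) - y - y by rewrite -bE; ncring.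
    ncring.
  apply: le_trans (nrmB _ _) _.
  have H1 := nrmD (b - y) (b - y); have H2 := nrmD ((a - y) * a) (y * (a - y)).
  have H3 := nrmM (a - y) a; have H4 := nrmM y (a - y).
  have H5 : nrm a <= 1 by apply: le_trans (visser_nrm n x1) _; have /andP[] := visserR_bound n.
  have H6 := nrm_ge0 (a - y); have H7 := nrm_ge0 a; have H8 := nrm_ge0 y; nra.
- move=> S hS Sx; have [_ _ _ _] := hS; apply => e e0.
  have [n [Hn _]] := Hy' e e0; exists (visser x n); first exact: visser_in.
  by rewrite nrmBC.
Qed.

End Norm.
#[global] Hint Resolve nrm_ge0 : core.

(** * Positive elements *)

Section Positive.
Context {R : realType} {U : ucstarType R}.
Implicit Types (h k v x y z : U) (s t : R) (S : set U).

(** For a self-adjoint v the condition says that the spectrum lies in [0, 2t].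
    Sums are positive by the triangle inequality, and 1 - v / t has norm at
    most 1, as the iteration for square roots requires. *)
Definition upos v := star v = v /\ exists2 t, 0 <= t & nrm (rsc t - v) <= t.

(** The closed unital algebra generated by h plays the part of its functional
    calculus: elements of gen h commute with all that commutes with h, and
    belong to every closed subalgebra that contains h. *)
Definition gen h : set U := [set x | forall S, ucs S -> S h -> S x].

Lemma ucs_gen h : ucs (gen h).
Proof.
split.
- by move=> S [].
- by move=> x y gx gy S hS Sh; have [_ SD _ _ _] := hS; apply: (SD); [exact: gx|exact: gy].
- by move=> x y gx gy S hS Sh; have [_ _ SM _ _] := hS; apply: (SM); [exact: gx|exact: gy].
- by move=> l x gx S hS Sh; have [_ _ _ SZ _] := hS; apply: (SZ); exact: gx.
- move=> x Hx S hS Sh; have [_ _ _ _ SC] := hS; apply: (SC) => e e0.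
  by have [y gy xy] := Hx e e0; exists y => //; exact: gy.
Qed.

Lemma gen_id h : gen h h. Proof. by []. Qed.

Lemma gen_comm_of h x z : gen h x -> h * z = z * h -> x * z = z * x.
Proof. by move=> gx hz; exact: (gx _ (ucs_comm z)). Qed.

Lemma gen_comm h x y : gen h x -> gen h y -> x * y = y * x.
Proof.
move=> gx gy; apply: (gen_comm_of gx); apply/esym.
exact: (gen_comm_of gy).
Qed.

Lemma gen_trans h x y : gen h x -> gen x y -> gen h y.
Proof. by move=> gx gy S hS Sh; apply: gy => //; exact: gx. Qed.

Lemma upos_sa v : upos v -> star v = v. Proof. by case. Qed.

Lemma upos_rsc t : 0 <= t -> upos (rsc t).
Proof.
by move=> t0; split; [exact: star_rsc|exists t => //; rewrite subrr nrm0].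
Qed.

Lemma upos0 : upos 0. Proof. by rewrite -rsc0; exact: upos_rsc. Qed.
Lemma uposD v h : upos v -> upos h -> upos (v + h).
Proof.
move=> [sv [s s0 Hs]] [sh [t t0 Ht]]; split; first by rewrite starD sv sh.
exists (s + t); first exact: addr_ge0.
have -> : rsc (s + t) - (v + h) = (rsc s - v) + (rsc t - h).
  by rewrite rscD; ncring.
by apply: le_trans (nrmD _ _) _; lra.
Qed.

Lemma uposZ t v : 0 <= t -> upos v -> upos (rsc t * v).
Proof.
move=> t0 [sv [s s0 Hs]]; split; first by rewrite starM sv star_rsc rsc_comm.
exists (t * s); first exact: mulr_ge0.
by rewrite rscM -mulrBr nrm_rscM ger0_norm//; nra.
Qed.

Lemma upos_rscB h t : star h = h -> nrm h <= t -> upos (rsc t - h).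
Proof.
move=> sh ht; split; first by rewrite starB star_rsc sh.
by exists t; [have := nrm_ge0 h; lra|rewrite subKr].
Qed.

Lemma upos_rscD h t : star h = h -> nrm h <= t -> upos (rsc t + h).
Proof. by move=> sh ht; rewrite -[h]opprK; apply: upos_rscB; rewrite ?starN ?nrmN ?sh. Qed.

Lemma rsc_sqrtM t x : 0 <= t ->
  (rsc (Num.sqrt t) * x) * (rsc (Num.sqrt t) * x) = rsc t * (x * x).
Proof.
move=> t0; rewrite -[in RHS](sqr_sqrtr t0) expr2 rscM -!mulrA; congr (_ * _).
by rewrite !mulrA rsc_comm.
Qed.

(** With x = 1 - v / t, the root is sqrt t (1 - y) where (1 - y)^2 = 1 - x. *)
Lemma upos_sqrt v : upos v -> exists k, [/\ upos k, k * k = v & gen v k].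
Proof.
move=> [sv [t]]; rewrite le_eqVlt => /predU1P[<-|t0] Ht.
  have -> : v = 0.
    by apply: (@nrm_small _ _ _ 0) => e _; rewrite mul0r -nrmN -sub0r -rsc0.
  exists 0; split; [|by rewrite mulr0|]; first exact: upos0.
  by move=> S hS _; exact: ucs0.
have tn0 : t != 0 by rewrite gt_eqF.
pose x := rsc t^-1 * (rsc t - v).
have gx : gen v x.
  have [_ _ gM _ _] := ucs_gen v; apply: gM; first exact: ucs_rsc (ucs_gen v).
  by apply: ucsB (ucs_gen v) _ _ => //; exact: ucs_rsc (ucs_gen v).
have sx : star x = x by rewrite starM starB !star_rsc sv rsc_comm.
have x1 : nrm x <= 1.
  by rewrite nrm_rscM gtr0_norm ?invr_gt0// mulrC ler_pdivrMr// mul1r.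
have [y [sy y1 yE gy]] := visser_lim sx x1.
exists (rsc (Num.sqrt t) * (1 - y)); split.
- apply: uposZ; first exact: sqrtr_ge0.
  by rewrite -rsc1; exact: upos_rscB.
- transitivity (rsc t * ((1 - y) * (1 - y))).
    by rewrite rsc_sqrtM// ltW.
  by rewrite yE mulrBr mulr1 /x !mulrA rscMV// mul1r subKr.
- move=> S hS Sv; have [_ _ SM _ _] := hS; apply: SM; first exact: ucs_rsc.
  by apply: ucsB => //; [rewrite -rsc1; exact: ucs_rsc|apply: gy => //; exact: gx].
Qed.

(** The element u = h + i k satisfies u^* u = h^2 + k^2, and its real part h
    has norm at most that of u. *)
Lemma nrm_sqD h k : star h = h -> star k = k -> h * k = k * h ->
  nrm (h * h) <= nrm (h * h + k * k).
Proof.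
move=> sh sk hk; pose u := h + 'i *: k.
have ci := conjc_i R.
have ii : 'i * 'i = -1 :> R[i] by rewrite -expr2 sqr_i.
have su : star u = h - 'i *: k by rewrite starD starZ sh sk ci scaleNr.
have uu : star u * u = h * h + k * k.
  rewrite su /u mulrDr !mulrBl -!scalerAl -!scalerAr hk scalerA ii scaleN1r.
  ncring.
rewrite -uu nrm_starM (nrmsq sh).
have : nrm h + nrm h <= nrm u + nrm u.
  rewrite -{2}(nrm_star u); apply: le_trans (nrmD _ _).
  have -> : u + star u = rsc 2 * h.
    rewrite su /u (_ : 2 = 1 + 1 :> R)// rscD rsc1; ncring.
  rewrite nrm_rscM ger0_norm//; lra.
have := nrm_ge0 h; have := nrm_ge0 u; nra.
Qed.

Lemma sq_eq0 x : star x = x -> x * x = 0 -> x = 0.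
Proof.
move=> sx xx; apply: nrm_eq0; apply/eqP; rewrite -sqrf_eq0; apply/eqP.
by rewrite -nrmsq// xx nrm0.
Qed.

(** For t > norm (k^2), t - k^2 is the square of a self-adjoint m commuting
    with k, and by nrm_sqD the norm of m^2 is at most that of m^2 + k^2 = t. *)
Lemma upos_square k : star k = k -> upos (k * k).
Proof.
move=> sk; have N0 := nrm_ge0 k; pose t := nrm k ^+ 2 + 1.
have t0 : 0 < t by rewrite /t; nra.
have tn0 : t != 0 by rewrite gt_eqF.
have skk : star (k * k) = k * k by rewrite starM sk.
pose x := rsc t^-1 * (k * k).
have sx : star x = x by rewrite starM skk star_rsc rsc_comm.
have x1 : nrm x <= 1.
  rewrite nrm_rscM gtr0_norm ?invr_gt0// mulrC ler_pdivrMr// mul1r nrmsq//.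
  by rewrite /t; nra.
have [y [sy y1 yE gy]] := visser_lim sx x1.
have ky : k * y = y * k.
  by apply/esym/(gy _ (ucs_comm k)) => /=; rewrite /x -!mulrA [RHS]mulrA rsc_comm -mulrA.
pose m := rsc (Num.sqrt t) * (1 - y).
have sm : star m = m by rewrite starM starB star1 sy star_rsc rsc_comm.
have km : k * m = m * k.
  by rewrite /m mulrA rsc_comm -!mulrA mulrBr mulrBl ky mulr1 mul1r.
have mE : m * m = rsc t - k * k.
  transitivity (rsc t * ((1 - y) * (1 - y))).
    by rewrite rsc_sqrtM// ltW.
  by rewrite yE mulrBr mulr1 /x !mulrA rscMV// mul1r.
split => //; exists t; first exact: ltW.
rewrite -mE; apply: le_trans (nrm_sqD sm sk (esym km)) _.
by rewrite mE subrK; apply: le_trans (nrm_rsc _) _; rewrite gtr0_norm.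
Qed.

(** The product of the two square roots is self-adjoint, and h k is its square.
    *)
Lemma uposM h k : upos h -> upos k -> h * k = k * h -> upos (h * k).
Proof.
move=> ph pk hk.
have [a [pa aE ga]] := upos_sqrt ph; have [b [pb bE gb]] := upos_sqrt pk.
have ak : a * k = k * a by exact: gen_comm_of ga hk.
have ba : b * a = a * b by exact: gen_comm_of gb (esym ak).
have -> : h * k = (a * b) * (a * b).
  by rewrite -aE -bE -!mulrA; congr (_ * _); rewrite !mulrA ba.
by apply: upos_square; rewrite starM !upos_sa.
Qed.

(** Both h and t - h are squares of commuting self-adjoint elements, and their
    sum is t: apply nrm_sqD. *)
Lemma upos_le_nrm h t : 0 <= t -> upos h -> upos (rsc t - h) -> nrm h <= t.
Proof.
move=> t0 ph pth.
have [a [pa aE ga]] := upos_sqrt ph; have [b [pb bE gb]] := upos_sqrt pth.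
have ba : b * a = a * b.
  apply: (gen_comm_of gb); rewrite -aE mulrBl mulrBr mulrA rsc_comm //.
rewrite -aE; apply: le_trans (nrm_sqD (upos_sa pa) (upos_sa pb) (esym ba)) _.
rewrite aE bE addrC subrK; apply: le_trans (nrm_rsc _) _.
by rewrite ger0_norm.
Qed.

Lemma upos_mono h k : upos h -> upos (k - h) -> nrm h <= nrm k.
Proof.
move=> ph pkh; have pk : upos k by rewrite -(subrK h k); exact: uposD.
apply: upos_le_nrm => //.
have -> : rsc (nrm k) - h = (rsc (nrm k) - k) + (k - h) by ncring.
by apply: uposD => //; apply: upos_rscB => //; exact: upos_sa.
Qed.

Lemma upos_anti h : upos h -> upos (- h) -> h = 0.
Proof.
move=> ph pnh; apply: nrm_eq0; apply/le_anti; rewrite nrm_ge0 andbT.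
by apply: upos_le_nrm => //; rewrite rsc0 sub0r.
Qed.

(** With d = h - k, the sum of the positive elements d h d and d k d is d (h^2
    - k^2) = 0. So both vanish, and d^3 = d h d - d k d = 0. *)
Lemma upos_sqrt_uniq h k : upos h -> upos k -> h * k = k * h ->
  h * h = k * k -> h = k.
Proof.
move=> ph pk hk hhkk; pose d := h - k.
have sd : star d = d by rewrite starB !upos_sa.
have hd : h * d = d * h by rewrite /d mulrBl mulrBr hk.
have kd : k * d = d * k by rewrite /d mulrBl mulrBr hk.
have ph' : upos (d * h * d).
  rewrite -mulrA hd mulrA; apply: uposM => //; first exact: upos_square.
  by rewrite -mulrA -hd mulrA -hd -mulrA.
have pk' : upos (d * k * d).
  rewrite -mulrA kd mulrA; apply: uposM => //; first exact: upos_square.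
  by rewrite -mulrA -kd mulrA -kd -mulrA.
have E : d * h * d + d * k * d = 0.
  rewrite -mulrDl -mulrDr {1}/d.
  have -> : (h - k) * (h + k) = h * h - k * k + (h * k - k * h) by ncring.
  by rewrite hhkk hk !subrr addr0 mul0r.
have h0 : d * h * d = 0.
  by apply: upos_anti => //; rewrite (addr0_eq E).
have k0 : d * k * d = 0 by move: E; rewrite h0 add0r.
have d3 : d * d * d = 0.
  have : d * h * d - d * k * d = 0 by rewrite h0 k0 subrr.
  by rewrite -mulrBl -mulrBr.
apply: subr0_eq; apply: sq_eq0 => //; apply: sq_eq0; first by rewrite starM sd.
by rewrite mulrA d3 mul0r.
Qed.

(** With a = sqrt (h^2), the elements p = (a + h) / 2 and q = (a - h) / 2 have
    product 0, but their positivity is not obvious. The roots p' of p^2 and q'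
    of q^2 are orthogonal to each other, and p' + q' is a positive root of h^2,
    so it equals a = p + q; orthogonality then gives p' = p and q' = q. *)
Lemma upos_parts h : star h = h -> exists p q,
  [/\ upos p, upos q, h = p - q, p * q = 0 /\ q * p = 0 & gen h p /\ gen h q].
Proof.
move=> sh; have [a [pa aE ga]] := upos_sqrt (upos_square sh).
have [_ gD gM _ _] := ucs_gen h.
have gh := @gen_id h.
have {}ga : gen h a by apply: gen_trans ga; exact: gM.
pose c : U := rsc 2^-1.
have gc : gen h c by exact: ucs_rsc (ucs_gen h).
pose p := c * (a + h); pose q := c * (a - h).
have gp : gen h p by apply: gM => //; exact: gD.
have gq : gen h q by apply: gM => //; exact: ucsB (ucs_gen h) _ _.
have cc : c + c = 1 by rewrite -rscD (_ : 2^-1 + 2^-1 = 1 :> R) ?rsc1//; field.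
have hE : h = p - q.
  rewrite /p /q -mulrBr (_ : a + h - (a - h) = h + h); last by ncring.
  by rewrite mulrDr -mulrDl cc mul1r.
have aE' : a = p + q.
  rewrite /p /q -mulrDr (_ : a + h + (a - h) = a + a); last by ncring.
  by rewrite mulrDr -mulrDl cc mul1r.
have ah := gen_comm ga gh.
have pq0 : p * q = 0.
  rewrite /p /q -mulrA [(a + h) * _]mulrA rsc_comm -mulrA.
  rewrite (_ : (a + h) * (a - h) = a * a - h * h + (h * a - a * h)); last by ncring.
  by rewrite aE ah !subrr addr0 !mulr0.
have qp0 : q * p = 0 by rewrite -(gen_comm gp gq).
have sa := upos_sa pa.
have sp : star p = p by rewrite starM star_rsc starD sa sh rsc_comm.
have sq : star q = q by rewrite starM star_rsc starB sa sh rsc_comm.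
have [p' [pp' p'E gp']] := upos_sqrt (upos_square sp).
have [q' [pq' q'E gq']] := upos_sqrt (upos_square sq).
have {}gp' : gen h p' by apply: gen_trans gp'; exact: gM.
have {}gq' : gen h q' by apply: gen_trans gq'; exact: gM.
have prod0 x y : gen h x -> gen h y -> star x = x -> star y = y ->
    (x * x) * (y * y) = 0 -> x * y = 0.
  move=> gx gy sx sy E; have xy := gen_comm gx gy.
  apply: sq_eq0; first by rewrite starM sx sy.
  by rewrite -mulrA [y * _]mulrA -xy -mulrA mulrA.
have p'q' : p' * q' = 0.
  apply: prod0 => //; try exact: upos_sa.
  by rewrite p'E q'E -mulrA [p * (q * q)]mulrA pq0 mul0r mulr0.
have p'q : p' * q = 0.
  apply: prod0 => //; first exact: upos_sa.
  by rewrite p'E -mulrA [p * (q * q)]mulrA pq0 mul0r mulr0.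
have pq'0 : p * q' = 0.
  apply: prod0 => //; first exact: upos_sa.
  by rewrite q'E -mulrA [p * (q * q)]mulrA pq0 mul0r mulr0.
have q'p' : q' * p' = 0 by rewrite -(gen_comm gp' gq').
have sum : p' + q' = p + q.
  rewrite -aE'; apply: upos_sqrt_uniq => //; first exact: uposD.
    by apply: (gen_comm _ ga); exact: gD.
  rewrite mulrDl !mulrDr p'q' q'p' p'E q'E aE' mulrDl !mulrDr pq0 qp0.
  by rewrite !addr0 !add0r.
have d0 : p' - p = 0.
  have dE : p' - p = q - q'.
    by apply/eqP; rewrite subr_eq addrAC eq_sym subr_eq addrC -sum addrC.
  apply: sq_eq0; first by rewrite starB sp upos_sa.
  by rewrite {2}dE mulrBl !mulrBr p'q p'q' pq0 pq'0 !subrr.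
have p'p : p' = p by exact: subr0_eq.
exists p, q; split => //; first by rewrite -p'p.
by move: sum; rewrite p'p => /addrI <-.
Qed.
End Positive.

(** * Spectra and the positivity of squares *)

Section Spectrum.
Context {R : realType} {U : ucstarType R}.
Implicit Types (f g h k v x y z : U) (s t : R) (S : set U).

Lemma neumann x : nrm x < 1 ->
  exists y, [/\ (1 - x) * y = 1, y * (1 - x) = 1 & gen x y].
Proof.
move=> x1; pose u := fix u n := if n is n'.+1 then 1 + x * u n' else 0 : U.
pose r := nrm x; have r0 : 0 <= r by exact: nrm_ge0.
have r1 : 0 < 1 - r by rewrite subr_gt0.
pose t n := (1 - r ^+ n) / (1 - r).
have step n : nrm (u n.+1 - u n) <= t n.+1 - t n.
  have -> : t n.+1 - t n = r ^+ n by rewrite /t exprS; field; rewrite gt_eqF.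
  elim: n => [|n IH]; first by rewrite /= mulr0 addr0 subr0 expr0 nrm1_le.
  rewrite (_ : u n.+2 - u n.+1 = x * (u n.+1 - u n)); last first.
    rewrite (_ : u n.+2 = 1 + x * u n.+1)// {2}(_ : u n.+1 = 1 + x * u n)//; ncring.
  by apply: le_trans (nrmM _ _) _; rewrite exprS ler_wpM2l.
have bound n : t n <= (1 - r)^-1.
  by rewrite /t ler_pdivrMr// mulVf ?gt_eqF// lerBlDr lerDl exprn_ge0.
have [y Hy] := nrm_complete _ _ _ step bound.
have gu n : gen x (u n).
  have [g1 gD gM _ _] := ucs_gen x.
  by elim: n => [|n IH] /=; [exact: ucs0 (ucs_gen x)|apply: (gD) => //; exact: gM].
have gy : gen x y.
  have [_ _ _ _ gC] := ucs_gen x; apply: gC => e e0; have [N HN] := Hy e e0.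
  by exists (u N) => //; rewrite nrmBC; exact: HN.
have E : (1 - x) * y = 1.
  apply: subr0_eq; apply: (@nrm_small _ _ _ (1 + r)) => e e0; have [N HN] := Hy e e0.
  have H1 := HN N (leqnn N); have H2 := HN N.+1 (leqnSn N).
  have -> : (1 - x) * y - 1 = x * (u N - y) - (u N.+1 - y).
    rewrite (_ : u N.+1 = 1 + x * u N)//; ncring.
  apply: le_trans (nrmB _ _) _; have := nrmM x (u N - y); rewrite -/r; nra.
exists y; split => //; rewrite -[RHS]E.
by rewrite mulrBl mulrBr mul1r mulr1 (gen_comm gy (@gen_id _ _ x)).
Qed.

Lemma upos_inv h s : upos h -> 0 < s -> exists r,
  [/\ upos r, r * (rsc s + h) = 1, (rsc s + h) * r = 1 & gen h r].
Proof.
move=> ph s0; have [sh [t t0 Ht]] := ph.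
have ts0 : 0 < t + s by exact: ltr_wpDl.
have tsn : t + s != 0 by rewrite gt_eqF.
pose x := rsc (t + s)^-1 * (rsc t - h).
have x1 : nrm x < 1.
  rewrite nrm_rscM gtr0_norm ?invr_gt0// mulrC ltr_pdivrMr// mul1r.
  by apply: le_lt_trans Ht _; rewrite ltrDl.
have gx : gen h x.
  have [_ _ gM _ _] := ucs_gen h; apply: gM; first exact: ucs_rsc (ucs_gen h).
  by apply: ucsB (ucs_gen h) _ _ => //; exact: ucs_rsc (ucs_gen h).
have [y [xy yx gy]] := neumann x1.
have E : rsc s + h = rsc (t + s) * (1 - x).
  by rewrite mulrBr mulr1 /x mulrA rscMV// mul1r rscD; ncring.
pose r := rsc (t + s)^-1 * y.
have gr : gen h r.
  have [_ _ gM _ _] := ucs_gen h; apply: gM; first exact: ucs_rsc (ucs_gen h).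
  exact: gen_trans gy.
have rE : (rsc s + h) * r = 1.
  by rewrite E /r -mulrA [_ * (_ * y)]mulrA rsc_comm -mulrA xy mulr1 rscMV.
have gh : gen h (rsc s + h).
  have [_ gD _ _ _] := ucs_gen h; apply: gD => //; exact: ucs_rsc (ucs_gen h).
have rE' : r * (rsc s + h) = 1 by rewrite (gen_comm gr gh).
have sr : star r = r.
  have : star r * (rsc s + h) = 1.
    by have := congr1 star rE; rewrite starM starD star_rsc sh star1.
  by move=> H; rewrite -[star r]mulr1 -rE mulrA H mul1r.
exists r; split => //.
have -> : r = (r * r) * (rsc s + h) by rewrite -mulrA rE' mulr1.
apply: uposM; first exact: upos_square.
  by apply: uposD => //; apply: upos_rsc; exact: ltW.
by rewrite -mulrA rE' mulrA rE mulr1 mul1r.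
Qed.

Definition uspec v := star v = v /\ forall l : R[i], ~~ (0 <= l) ->
  exists z, (l *: 1 - v) * z = 1 /\ z * (l *: 1 - v) = 1.

(** For l = a + i b with b nonzero and w = a - v, the product of l - v and w -
    i b is b^2 + w^2, which upos_inv inverts. *)
Lemma upos_spec v : upos v -> uspec v.
Proof.
move=> pv; have sv := upos_sa pv; split => // l l0.
have [a [b lE]] : exists a b : R, l = a%:C + 'i * b%:C.
  by exists (complex.Re l), (complex.Im l); exact: complexE.
have [b0|b0] := eqVneq b 0.
  have a0 : 0 < - a.
    rewrite oppr_gt0 ltNge; apply: contra l0.
    by rewrite lE b0 rmorph0 mulr0 addr0 -lecR.
  have [r [_ r1 r2 _]] := upos_inv pv a0.
  have E : l *: 1 - v = - (rsc (- a) + v).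
    by rewrite lE b0 rmorph0 mulr0 addr0 -/(rsc a) rscN; ncring.
  by exists (- r); rewrite E mulrNN mulrNN r1 r2.
have bb : 0 < b ^+ 2 by rewrite exprn_even_gt0.
pose w := rsc a - v; have sw : star w = w by rewrite starB star_rsc sv.
have [r [_ r1 r2 gr]] := upos_inv (upos_square sw) bb.
have rw : r * w = w * r by apply: (gen_comm_of gr); rewrite mulrA.
pose e : U := ('i * b%:C) *: 1.
have ec x : x * e = e * x by rewrite /e mulr_algl mulr_algr.
have ee : e * e = - rsc (b ^+ 2).
  rewrite /e mulr_algl scalerA mulrACA -expr2 sqr_i mulN1r scaleNr -rmorphM.
  by rewrite /rsc expr2.
have E : l *: 1 - v = w + e.
  by rewrite lE scalerDl -/(rsc a) -/e /w; ncring.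
have F : (w + e) * (w - e) = rsc (b ^+ 2) + w * w.
  rewrite (_ : _ * _ = w * w - e * e + (e * w - w * e)); last by ncring.
  by rewrite ee ec subrr addr0 opprK addrC.
have F' : (w - e) * (w + e) = rsc (b ^+ 2) + w * w.
  rewrite (_ : _ * _ = w * w - e * e + (w * e - e * w)); last by ncring.
  by rewrite ee ec subrr addr0 opprK addrC.
exists ((w - e) * r); rewrite E mulrA F r2; split => //.
have -> : (w - e) * r = r * (w - e) by rewrite mulrBl mulrBr rw ec.
by rewrite -mulrA F'.
Qed.

(** An inverse bounds y from below: M y - 1 = y (M - z) is a product of
    commuting positive elements. *)
Lemma upos_invertible y z : upos y -> y * z = 1 -> z * y = 1 ->
  upos z /\ forall M : R, nrm z <= M -> upos (rsc M * y - 1).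
Proof.
move=> py yz zy; have sy := upos_sa py.
have sz : star z = z.
  have H : star z * y = 1 by rewrite -[RHS]star1 -[in RHS]yz starM sy.
  by rewrite -[star z]mulr1 -yz mulrA H mul1r.
have pz : upos z.
  have -> : z = (z * z) * y by rewrite -mulrA zy mulr1.
  apply: uposM => //; first exact: upos_square.
  by rewrite -mulrA zy mulrA yz mulr1 mul1r.
split => // M zM.
have pMz : upos (rsc M - z) by exact: upos_rscB.
have -> : rsc M * y - 1 = y * (rsc M - z) by rewrite mulrBr yz rsc_comm.
by apply: uposM => //; rewrite mulrBl mulrBr yz zy rsc_comm.
Qed.

(** Suppose that the negative part q of v has norm a > 0. Then y = a + v is
    positive and invertible, so M y >= 1 for M = norm (y^-1) + 1 / a.
    Multiplied by q^2, this says that M q^3 <= (M a - 1) q^2, and taking norms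
    gives M a^3 <= (M a - 1) a^2, which is absurd. *)
Lemma upos_of_spec v : uspec v -> upos v.
Proof.
move=> [sv Hv]; have [p [q [pp pq vE [pq0 qp0] [gp gq]]]] := upos_parts sv.
have sq := upos_sa pq.
have [q0|q0] := eqVneq (nrm q) 0.
  by rewrite vE (nrm_eq0 q q0) subr0.
pose a := nrm q; have a0 : 0 < a by rewrite lt_neqAle eq_sym q0 nrm_ge0.
have la : ~~ (0 <= (- a)%:C :> R[i]) by rewrite lecR -ltNge oppr_lt0.
have [z0 [z01 z02]] := Hv _ la.
pose y := rsc a + v; pose z := - z0.
have yE : (- a)%:C *: 1 - v = - y by rewrite -/(rsc (- a)) rscN /y opprD.
have yz : y * z = 1 by rewrite -[y]opprK -yE mulrNN.
have zy : z * y = 1 by rewrite -[y]opprK -yE mulrNN.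
have py : upos y.
  have -> : y = p + (rsc a - q) by rewrite /y vE; ncring.
  by apply: uposD => //; exact: upos_rscB.
have [pz HM] := upos_invertible py yz zy.
pose M := nrm z + a^-1.
have Ma : M * a = nrm z * a + 1 by rewrite /M mulrDl mulVf ?gt_eqF.
have M0 : 0 < M by apply: ltr_wpDl; [exact: nrm_ge0|rewrite invr_gt0].
have pMy : upos (rsc M * y - 1) by apply: HM; rewrite lerDl invr_ge0 ltW.
have gy : gen v y.
  have [_ gD _ _ _] := ucs_gen v; apply: gD => //; exact: ucs_rsc (ucs_gen v).
have [g1 _ gM _ _] := ucs_gen v.
have gMy : gen v (rsc M * y - 1).
  apply: ucsB (ucs_gen v) _ g1; apply: gM gy; exact: ucs_rsc (ucs_gen v).
have qqMy := gen_comm (gM _ _ gq gq) gMy.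
have P := uposM (upos_square sq) pMy qqMy.
have E : q * q * (rsc M * y - 1) = rsc (nrm z * a) * (q * q) - rsc M * (q * q * q).
  have qqv : q * q * v = - (q * q * q) by rewrite vE mulrBr -(mulrA q q p) qp0 mulr0 sub0r.
  rewrite mulrBr mulr1 (mulrA (q * q)) rsc_comm -mulrA /y mulrDr qqv rsc_comm.
  rewrite mulrDr (mulrA (rsc M)) -rscM Ma.
  by rewrite rscD rsc1; ncring.
rewrite E in P.
have pq3 : upos (q * q * q) by apply: uposM => //; [exact: upos_square|rewrite mulrA].
have := upos_mono (uposZ (ltW M0) pq3) P.
have nza : 0 <= nrm z * a by rewrite mulr_ge0 ?nrm_ge0 ?(ltW a0).
rewrite !nrm_rscM nrmsq// -/a (ger0_norm nza) (gtr0_norm M0) => H.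
have H4 : a ^+ 2 ^+ 2 <= nrm (q * q * q) * a.
  rewrite -nrmsq// -nrmsq ?starM ?sq// mulrA; exact: nrmM.
have H3 : a ^+ 3 <= nrm (q * q * q).
  by rewrite -(ler_pM2r a0) -exprSr (_ : a ^+ 4 = a ^+ 2 ^+ 2)// -exprM.
have : M * a ^+ 3 <= nrm z * a * a ^+ 2.
  by apply: le_trans H; rewrite ler_wpM2l// ltW.
have -> : M * a ^+ 3 = (M * a) * a ^+ 2 by ring.
rewrite Ma; nra.
Qed.

(** Resolvents of y^* y and y y^* determine each other: the inverse of l - y^*
    y is l^-1 (1 + y^* z y), where z is the inverse of l - y y^*. *)
Lemma uspec_swap y : uspec (y * star y) -> uspec (star y * y).
Proof.
move=> [_ H]; split; first by rewrite starM starK.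
move=> l l0; have [z [z1 z2]] := H l l0.
pose L : U := l *: 1; have Lc x : x * L = L * x by rewrite /L mulr_algl mulr_algr.
have ln : l != 0 by apply: contraNneq l0 => ->.
exists (l^-1 *: (1 + star y * z * y)); split.
  rewrite -scalerAr; apply: (scalerI ln); rewrite scalerA mulfV// scale1r.
  have -> : (l *: 1 - star y * y) * (1 + star y * z * y) =
     l *: 1 - star y * y + star y * ((l *: 1 - y * star y) * z) * y.
    apply: subr0_eq; rewrite (_ : _ - _ = (L * star y - star y * L) * z * y).
      by rewrite Lc subrr !mul0r.
    by rewrite -/L; ncring.
  by rewrite z1 mulr1 subrK.
rewrite -scalerAl; apply: (scalerI ln); rewrite scalerA mulfV// scale1r.
have -> : (1 + star y * z * y) * (l *: 1 - star y * y) =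
   l *: 1 - star y * y + star y * (z * (l *: 1 - y * star y)) * y.
  apply: subr0_eq; rewrite (_ : _ - _ = star y * z * (y * L - L * y)).
    by rewrite Lc subrr !mulr0.
  by rewrite -/L; ncring.
by rewrite z2 mulr1 subrK.
Qed.

(** Let q be the negative part of x^* x and y = x q, so that y^* y = - q^3. The
    sum y y^* + y^* y is a sum of squares of self-adjoint elements, so y y^* is
    positive; by uspec_swap so is y^* y, and therefore q = 0. *)
Lemma upos_starM x : upos (star x * x).
Proof.
set h := star x * x; have sh : star h = h by rewrite starM starK.
have [p [q [pp pq hE [pq0 qp0] _]]] := upos_parts sh.
have sq := upos_sa pq.
pose y := x * q; pose c := q * q * q.
have pc : upos c by apply: uposM => //; [exact: upos_square|rewrite mulrA].
have yy : star y * y = - c.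
  rewrite starM sq -mulrA [star x * _]mulrA -/h hE mulrBl pq0 sub0r mulrN.
  by rewrite /c mulrA.
have s1 : star (y + star y) = y + star y by rewrite starD starK addrC.
have s2 : star ('i *: (y - star y)) = 'i *: (y - star y).
  have ci := conjc_i R.
  by rewrite starZ starB starK ci scaleNr -scalerN opprB.
have ii : 'i * 'i = -1 :> R[i] by rewrite -expr2 sqr_i.
have := uposD (upos_square s1) (upos_square s2).
rewrite -scalerAl -scalerAr scalerA ii scaleN1r.
have -> : (y + star y) * (y + star y) - (y - star y) * (y - star y) =
   (1 + 1) * (y * star y) + (1 + 1) * (star y * y) by ncring.
rewrite yy -rsc1 -rscD => P.
have {}P : upos (y * star y).
  have h0 : 0 <= (1 + 1)^-1 :> R by rewrite invr_ge0.
  have := uposD (uposZ h0 P) pc.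
  rewrite mulrDr !mulrA -!rscM mulVf// rsc1 !mul1r addrNK //.
have nc : upos (- c) by rewrite -yy; apply/upos_of_spec/uspec_swap/upos_spec.
have c0 := upos_anti pc nc.
have q0 : q = 0.
  apply: sq_eq0 => //; apply: sq_eq0; first by rewrite starM sq.
  by rewrite mulrA -/c c0 mul0r.
by rewrite hE q0 subr0.
Qed.

Lemma upos_conj h x : upos h -> upos (star x * h * x).
Proof.
move=> ph; have [k [pk kE _]] := upos_sqrt ph.
have := upos_starM (k * x); rewrite starM (upos_sa pk) -mulrA.
by rewrite -kE !mulrA.
Qed.

Lemma upos_conj_sa h x : star x = x -> upos h -> upos (x * h * x).
Proof. by move=> sx /upos_conj-/(_ x); rewrite sx. Qed.

(** Compress the inequality by a. *)
Lemma nrm_mul_le f g a : upos (star g * g - star f * f) -> nrm (f * a) <= nrm (g * a).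
Proof.
move=> P; have := upos_conj a P.
rewrite mulrBr mulrBl !mulrA -!starM -!mulrA => /(upos_mono (upos_starM (f * a))).
by rewrite !nrm_starM; have := nrm_ge0 (f * a); have := nrm_ge0 (g * a); nra.
Qed.
End Spectrum.

(** * Approximate division *)

Section Factor.
Context {R : realType} {U : ucstarType R}.
Implicit Types (d f g h k l m v x y z : U) (s t e : R) (S : set U).

Lemma upos_resolvent h s : upos h -> 0 < s -> exists r,
  [/\ upos r, gen h r, 1 - r * h = rsc s * r, nrm (rsc s * r) <= 1 &
      nrm (r * h) <= 1].
Proof.
move=> ph s0; have [r [pr r1 r2 gr]] := upos_inv ph s0.
have rh : r * h = h * r by exact: gen_comm gr (@gen_id _ _ h).
have E : 1 - r * h = rsc s * r by rewrite -r1 mulrDr rsc_comm; ncring.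
have E' : 1 - rsc s * r = r * h by rewrite -E subKr.
have p1 : upos (rsc s * r) by apply: uposZ => //; exact: ltW.
have p2 : upos (r * h) by exact: uposM.
exists r; split => //; apply: upos_le_nrm => //.
  by rewrite rsc1 E'.
by rewrite rsc1 E.
Qed.

(** If x^* x <= d, then x (s + d)^-1 d tends to x as s tends to 0: the
    difference is s x (s + d)^-1, and its norm is at most that of s sqrt d (s +
    d)^-1, hence at most sqrt s. With d = x^* x this gives approximate units,
    and in general it puts x in the closed left ideal generated by d. *)
Lemma upos_approx d x e : upos d -> upos (d - star x * x) -> 0 < e ->
  exists r, [/\ upos r, gen d r, nrm (r * d) <= 1 & nrm (x - x * r * d) < e].
Proof.
move=> pd pdx e0; pose s := e ^+ 2 / 2.
have s0 : 0 < s by rewrite divr_gt0 ?exprn_gt0.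
have [r [pr gr rE n1 n2]] := upos_resolvent pd s0.
have [k [pk kE _]] := upos_sqrt pd.
exists r; split => //.
have -> : x - x * r * d = x * (rsc s * r) by rewrite -rE; ncring.
have H : nrm (x * (rsc s * r)) <= nrm (k * (rsc s * r)).
  by apply: nrm_mul_le; rewrite (upos_sa pk) kE.
apply: le_lt_trans H _.
have H2 : nrm (k * (rsc s * r)) ^+ 2 <= s.
  have E : nrm (k * r) ^+ 2 = nrm (r * (r * d)).
    rewrite -nrm_starM starM (upos_sa pr) (upos_sa pk) -mulrA (mulrA k k) kE.
    by rewrite (gen_comm gr (@gen_id _ _ d)).
  have -> : k * (rsc s * r) = rsc s * (k * r) by rewrite mulrA rsc_comm mulrA.
  rewrite nrm_rscM in n1; rewrite nrm_rscM exprMn E.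
  rewrite (gtr0_norm s0) in n1 *.
  have := nrmM r (r * d); have := nrm_ge0 r; have := nrm_ge0 (r * d).
  move=> A1 A2 A3; have A4 : nrm (r * (r * d)) <= nrm r by nra.
  nra.
have := nrm_ge0 (k * (rsc s * r)); rewrite /s in H2; nra.
Qed.

Lemma nrm_sqB x y : nrm (star x * x - star y * y) <=
  nrm (x - y) * (nrm x + nrm y).
Proof.
have -> : star x * x - star y * y = star (x - y) * x + star y * (x - y).
  by rewrite starB; ncring.
apply: le_trans (nrmD _ _) _.
have := nrmM (star (x - y)) x; have := nrmM (star y) (x - y).
by rewrite !nrm_star; lra.
Qed.

(** If m <= g^* g then m = x^* x for some x in the closure of g U. This
    replaces the polar decomposition of g, which need not exist in U: with l =
    sqrt (g^* g), x is the limit of g (s + l)^-1 sqrt m for s = 2^-n. *)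
Lemma upos_factor m g : upos m -> upos (star g * g - m) -> exists k x,
  [/\ upos k, k * k = m, gen m k, star x * x = m &
      forall e, 0 < e -> exists w, nrm (x - g * (w * k)) < e].
Proof.
move=> pm pgm; have [k [pk kE gk]] := upos_sqrt pm; have sk := upos_sa pk.
have [l [pl lE _]] := upos_sqrt (upos_starM g); have sl := upos_sa pl.
have s0 n : 0 < (1 / 2) ^+ n :> R by rewrite exprn_gt0.
have /choice[r Hr] := fun n => upos_resolvent pl (s0 n).
have kl a : nrm (k * a) <= nrm (l * a).
  by apply: nrm_mul_le; rewrite sl sk lE kE.
have lk a : nrm (a * k) <= nrm (a * l).
  by rewrite -nrm_star -(nrm_star (a * l)) !starM sk sl.
have gl a : nrm (g * a) <= nrm (l * a).
  by apply: nrm_mul_le; rewrite sl lE subrr; exact: upos0.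
have lrk n : nrm (l * r n * k - k) <= (1 / 2) ^+ n.
  have [pr gr rE n1 n2] := Hr n.
  have -> : l * r n * k - k = - (rsc ((1 / 2) ^+ n) * r n) * k.
    by rewrite -rE (gen_comm gr (@gen_id _ _ l)); ncring.
  rewrite mulNr nrmN -mulrA nrm_rscM gtr0_norm// ger_pMr//.
  by apply: le_trans (lk _) _.
pose xn n := g * (r n * k).
have Hlr n : l - l * r n * l = rsc ((1 / 2) ^+ n) * (r n * l).
  have [pr gr rE n1 n2] := Hr n.
  have -> : l - l * r n * l = (1 - r n * l) * l.
    by rewrite -(gen_comm gr (@gen_id _ _ l)); ncring.
  by rewrite rE -mulrA.
have step n : nrm (xn n.+1 - xn n) <= 3 * (1 - (1 / 2) ^+ n.+1) - 3 * (1 - (1 / 2) ^+ n).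
  have -> : xn n.+1 - xn n = g * ((r n.+1 - r n) * k) by rewrite /xn; ncring.
  apply: le_trans (gl _) _; rewrite mulrA; apply: le_trans (lk _) _.
  have -> : l * (r n.+1 - r n) * l = (l - l * r n * l) - (l - l * r n.+1 * l) by ncring.
  rewrite !Hlr; apply: le_trans (nrmB _ _) _; rewrite !nrm_rscM !gtr0_norm//.
  have [_ _ _ _ n1] := Hr n; have [_ _ _ _ n2] := Hr n.+1.
  rewrite exprS; have := s0 n; nra.
have bound n : 3 * (1 - (1 / 2) ^+ n) <= 3 :> R by have := s0 n; lra.
have [x Hx] := nrm_complete _ _ _ step bound.
exists k, x; split => //; last first.
  by move=> e /Hx[N HN]; exists (r N); rewrite nrmBC; exact: HN.
apply: subr0_eq; apply: (@nrm_small _ _ _ (2 * nrm x + 2 * nrm k + 4)) => e' e'0.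
(* The estimate is quadratic in e; capping e at 1 makes it linear. *)
pose e := Num.min e' 1.
have e0 : 0 < e by rewrite lt_min e'0/=.
have ee' : e <= e' by rewrite ge_min lexx.
have e1 : e <= 1 by rewrite ge_min lexx orbT.
apply: le_trans (_ : (2 * nrm x + 2 * nrm k + 4) * e <= _); last first.
  by rewrite ler_wpM2l//; have := nrm_ge0 x; have := nrm_ge0 k; lra.
have [N1 HN1] := Hx e e0.
have [N2 HN2] : exists N, forall n, (N <= n)%N -> (1 / 2) ^+ n < e :> R.
  have /cvgrPdist_lt/(_ e e0)[N _ HN] : (fun n => (1 / 2) ^+ n : R) @ \oo --> 0.
    by apply: cvg_expr; rewrite gtr0_norm//; lra.
  by exists N => n /HN /=; rewrite sub0r normrN gtr0_norm.
pose n := maxn N1 N2.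
have H1 := HN1 n (leq_maxl _ _); have H2 := HN2 n (leq_maxr _ _).
have H3 := lrk n.
have E : star (xn n) * xn n = star (l * r n * k) * (l * r n * k).
  rewrite /xn !starM sl -!mulrA; do 2!congr (_ * _).
  by rewrite (mulrA (star g)) -lE -!mulrA.
have -> : star x * x - m = (star x * x - star (xn n) * xn n) +
    (star (l * r n * k) * (l * r n * k) - star k * k).
  by rewrite E sk kE; ncring.
apply: le_trans (nrmD _ _) _.
have A1 := nrm_sqB x (xn n); have A2 := nrm_sqB (l * r n * k) k.
have B1 : nrm (xn n) <= nrm x + e.
  by have := nrmD x (xn n - x); rewrite addrC subrK; lra.
have B2 : nrm (l * r n * k) <= nrm k + e.
  by have := nrmD k (l * r n * k - k); rewrite addrC subrK; lra.
rewrite nrmBC in A1.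
have := nrm_ge0 (xn n - x); have := nrm_ge0 (l * r n * k - k).
have := nrm_ge0 (xn n); have := nrm_ge0 (l * r n * k).
have := nrm_ge0 x; have := nrm_ge0 k.
move=> k0 x0 u0 v0 a0 b0.
have C1 : nrm (xn n - x) * (nrm x + nrm (xn n)) <= e * (nrm x + (nrm x + e)).
  by apply: ler_pM => //; lra.
have C2 : nrm (l * r n * k - k) * (nrm (l * r n * k) + nrm k) <= e * (nrm k + e + nrm k).
  by apply: ler_pM => //; lra.
nra.
Qed.

End Factor.

(** * Norm and completeness in a possibly non-unital algebra *)

Section CNorm.
Context {R : realType} {B : cstarAlgType R}.
Implicit Types (x y : B) (l : R[i]).

Lemma cnormE x : `|x| = (cnorm x)%:C.
Proof.
rewrite /cnorm; have := normr_ge0 x; case: (`|x|) => a b.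
by rewrite lecE /= => /andP[/eqP -> _].
Qed.

Lemma cnorm_ge0 x : 0 <= cnorm x.
Proof. by rewrite -lecR -cnormE normr_ge0. Qed.

Lemma cnormD x y : cnorm (x + y) <= cnorm x + cnorm y.
Proof. by rewrite -lecR rmorphD /= -!cnormE; exact: ler_normD. Qed.

Lemma cnormZ l x : cnorm (l *: x) = cabs l * cnorm x.
Proof. by apply: (@complexI R); rewrite rmorphM /= -!cnormE -normcE; exact: normrZ. Qed.

Lemma cnorm0 : cnorm (0 : B) = 0.
Proof. by rewrite /cnorm normr0. Qed.

Lemma cnormN x : cnorm (- x) = cnorm x.
Proof. by rewrite /cnorm normrN. Qed.

Lemma cnorm_eq0 x : cnorm x = 0 -> x = 0.
Proof. by move=> x0; apply/eqP; rewrite -normr_eq0 cnormE x0. Qed.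

Lemma cnorm_cmul x y : cnorm (x ** y) <= cnorm x * cnorm y.
Proof. by rewrite -lecR rmorphM /= -!cnormE; exact: cnormM. Qed.

Lemma cnorm_starM x : cnorm (cstar x ** x) = cnorm x ^+ 2.
Proof. by apply: (@complexI R); rewrite rmorphXn /= -!cnormE; exact: cstar_norm. Qed.

Lemma cmul0 x : x ** 0 = 0.
Proof. by apply: (addrI (x ** 0)); rewrite -cmulDr !addr0. Qed.

Lemma c0mul x : 0 ** x = 0.
Proof. by apply: (addrI (0 ** x)); rewrite -cmulDl !addr0. Qed.

Lemma cstar0 : cstar (0 : B) = 0.
Proof. by apply: (addrI (cstar 0)); rewrite -cstarD !addr0. Qed.

Lemma cstarN x : cstar (- x) = - cstar x.
Proof. by apply: (addrI (cstar x)); rewrite -cstarD !subrr cstar0. Qed.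

Lemma cnorm_star x : cnorm (cstar x) = cnorm x.
Proof.
have le y : cnorm y <= cnorm (cstar y).
  have := cnorm_starM y; have := cnorm_cmul (cstar y) y.
  have [->|y0] := eqVneq (cnorm y) 0; first by rewrite cnorm_ge0.
  by have y1 : 0 < cnorm y; [rewrite lt_neqAle eq_sym y0 cnorm_ge0|nra].
by apply/le_anti; rewrite le -{2}(cstarK x) le.
Qed.

End CNorm.

Section Completeness.
Context {R : realType}.

Lemma bounded_nondecreasing_cauchy (t : nat -> R) (M : R) :
  (forall n, t n <= t n.+1) -> (forall n, t n <= M) ->
  forall e : R, 0 < e -> exists N, forall n, (N <= n)%N -> t n - t N < e.
Proof.
move=> tS tM e e0.
have nd : nondecreasing_seq t by apply/nondecreasing_seqP.
have cv : cvgn t.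
  by apply: nondecreasing_is_cvgn => //; exists M => _ [n _ <-].
have e2 : 0 < e / 2 by rewrite divr_gt0.
have /cvgrPdist_lt/(_ _ e2)[N _ HN] := cv.
exists N => n Nn; have := HN n Nn; have := HN N (leqnn N) => /=.
rewrite !ltr_norml => /andP[_ H1] /andP[H2 _]; lra.
Qed.

Lemma cstar_complete (B : cstarAlgType R) (u : nat -> B) (t : nat -> R) (M : R) :
  (forall n, cnorm (u n.+1 - u n) <= t n.+1 - t n) -> (forall n, t n <= M) ->
  exists l : B, forall e : R, 0 < e ->
    exists N, forall n, (N <= n)%N -> cnorm (u n - l) < e.
Proof.
move=> ut tM.
have tS n : t n <= t n.+1 by rewrite -subr_ge0; apply: le_trans (ut n); exact: cnorm_ge0.
have tele N n : cnorm (u (N + n)%N - u N) <= t (N + n)%N - t N.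
  elim: n => [|n IH]; first by rewrite addn0 !subrr cnorm0.
  rewrite addnS; have := ut (N + n)%N.
  have := cnormD (u (N + n).+1 - u (N + n)%N) (u (N + n)%N - u N).
  by rewrite addrA subrK; lra.
have cu : cvgn u.
  apply: cauchy_cvg; apply: cauchy_exP => e; rewrite ltcE /= => /andP[/eqP e1 e0].
  have [N HN] := bounded_nondecreasing_cauchy tS tM e0.
  exists (u N); exists N => // n /= Nn; rewrite -ball_normE /=.
  rewrite distrC cnormE ltcE /= -e1 eqxx/=.
  by rewrite -(subnKC Nn); apply: le_lt_trans (tele _ _) _; rewrite subnKC// HN.
exists (limn u) => e e0.
have ec : 0 < e%:C :> R[i] by rewrite ltcR.
have /cvgrPdist_lt/(_ _ ec)[N _ HN] := cu.
by exists N => n /HN /=; rewrite cnormE ltcR -cnormN opprB.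
Qed.

Lemma real_complete (u : nat -> R) (t : nat -> R) (M : R) :
  (forall n, `|u n.+1 - u n| <= t n.+1 - t n) -> (forall n, t n <= M) ->
  exists l : R, forall e : R, 0 < e ->
    exists N, forall n, (N <= n)%N -> `|u n - l| < e.
Proof.
move=> ut tM.
have tS n : t n <= t n.+1 by rewrite -subr_ge0; apply: le_trans (ut n).
have nd : nondecreasing_seq (fun n => u n + t n).
  by apply/nondecreasing_seqP => n; have := ut n; rewrite ler_norml => /andP[]; lra.
have tn0 n : t 0%N <= t n by elim: n => // n IH; apply: le_trans (tS n).
have un n : u n <= u 0%N + (t n - t 0%N).
  elim: n => [|n IH]; first by rewrite subrr addr0.
  have := ut n; rewrite ler_norml => /andP[]; lra.
have cut : cvgn (fun n => u n + t n).
  apply: nondecreasing_is_cvgn => //; exists (u 0%N + M - t 0%N + M) => _ [n _ <-].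
  by have := un n; have := tM n; lra.
have ct : cvgn t.
  apply: nondecreasing_is_cvgn; first exact/nondecreasing_seqP.
  by exists M => _ [n _ <-].
have cu : cvgn u.
  have -> : u = (fun n => u n + t n) - t by apply/funext => n; rewrite !fctE addrK.
  exact: is_cvgB.
exists (limn u) => e e0; have /cvgrPdist_lt/(_ _ e0)[N _ HN] := cu.
by exists N => n /HN /=; rewrite distrC.
Qed.

Lemma cabs_ReIm (l : R[i]) : [/\ `|complex.Re l| <= cabs l, `|complex.Im l| <= cabs l &
  cabs l <= `|complex.Re l| + `|complex.Im l|].
Proof.
case: l => a b; rewrite /cabs normc_def /=; split.
- by rewrite -sqrtr_sqr ler_wsqrtr// lerDl sqr_ge0.
- by rewrite -sqrtr_sqr ler_wsqrtr// lerDr sqr_ge0.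
- rewrite -(@ler_pXn2r _ 2) ?nnegrE ?sqrtr_ge0 ?addr_ge0// sqr_sqrtr ?addr_ge0 ?sqr_ge0//.
  rewrite sqrrD !real_normK ?num_real//.
  by rewrite addrAC lerDl mulrn_wge0// mulr_ge0.
Qed.

Lemma complex_complete (u : nat -> R[i]) (t : nat -> R) (M : R) :
  (forall n, cabs (u n.+1 - u n) <= t n.+1 - t n) -> (forall n, t n <= M) ->
  exists l : R[i], forall e : R, 0 < e ->
    exists N, forall n, (N <= n)%N -> cabs (u n - l) < e.
Proof.
move=> ut tM.
have ReB (x y : R[i]) : complex.Re (x - y) = complex.Re x - complex.Re y by case: x; case: y.
have ImB (x y : R[i]) : complex.Im (x - y) = complex.Im x - complex.Im y by case: x; case: y.
have [a Ha] : exists l : R, forall e : R, 0 < e ->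
    exists N, forall n, (N <= n)%N -> `|complex.Re (u n) - l| < e.
  apply: (@real_complete _ t M) => // n; rewrite -ReB; apply: le_trans (ut n).
  by have [] := cabs_ReIm (u n.+1 - u n).
have [b Hb] : exists l : R, forall e : R, 0 < e ->
    exists N, forall n, (N <= n)%N -> `|complex.Im (u n) - l| < e.
  apply: (@real_complete _ t M) => // n; rewrite -ImB; apply: le_trans (ut n).
  by have [] := cabs_ReIm (u n.+1 - u n).
exists (a +i* b)%C => e e0; have e2 : 0 < e / 2 by rewrite divr_gt0.
have [N1 H1] := Ha _ e2; have [N2 H2] := Hb _ e2.
exists (maxn N1 N2) => n; rewrite geq_max => /andP[/H1 h1 /H2 h2].
have [_ _] := cabs_ReIm (u n - (a +i* b)%C); rewrite ReB ImB /=; lra.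
Qed.

End Completeness.

(** * The unitization *)

Section Unitization.
Context {R : realType}.
Variable B : cstarAlgType R.

(** A unit is adjoined even if B has one, so that u -> u.1 is always a
    character whose kernel is B. *)
Definition unitization : Type := (R[i]^o * B)%type.
HB.instance Definition _ := GRing.Lmodule.on unitization.

Implicit Types (u v w : unitization) (x y : B).

Definition uone : unitization := (1, 0).
Definition umul u v : unitization :=
  (u.1 * v.1, u.1 *: v.2 + v.1 *: u.2 + u.2 ** v.2).
Definition ustar u : unitization := (conjc u.1, cstar u.2).

Lemma unitizationE u v : u.1 = v.1 -> u.2 = v.2 -> u = v.
Proof. by case: u v => [a x] [b y] /= -> ->. Qed.

Let umulA : associative umul.
Proof.
move=> u v w; apply: unitizationE; rewrite /= ?mulrA//.
rewrite !cmulDl !cmulDr !scalerDr !cmulZl !cmulZr cmulA !scalerA -!addrA.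
rewrite (mulrC w.1 u.1) (mulrC w.1 v.1); do 2!congr (_ + _).
rewrite addrCA; congr (_ + _).
by rewrite [X in _ + X = _]addrCA [LHS]addrCA.
Qed.

Let umul1 : left_id uone umul.
Proof.
by move=> u; apply: unitizationE; rewrite /= ?mul1r// c0mul scale1r scaler0 !addr0.
Qed.

Let umulr1 : right_id uone umul.
Proof.
by move=> u; apply: unitizationE; rewrite /= ?mulr1// cmul0 scale1r scaler0 add0r addr0.
Qed.

Let umulDl : left_distributive umul +%R.
Proof.
move=> u v w; apply: unitizationE; rewrite /= ?mulrDl//.
by rewrite scalerDl scalerDr cmulDl (addrACA (u.1 *: _)) [LHS]addrACA.
Qed.

Let umulDr : right_distributive umul +%R.
Proof.
move=> u v w; apply: unitizationE; rewrite /= ?mulrDr//.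
by rewrite scalerDl scalerDr cmulDr (addrACA (u.1 *: _)) [LHS]addrACA.
Qed.

Let uone_neq0 : uone != 0.
Proof. by apply/eqP => -[] /eqP; rewrite oner_eq0. Qed.

HB.instance Definition _ := GRing.Zmodule_isNzRing.Build unitization
  umulA umul1 umulr1 umulDl umulDr uone_neq0.

Let uscalerAl (l : R[i]) u v : l *: (u * v) = (l *: u) * v.
Proof.
apply: unitizationE; rewrite /=; first exact: mulrA.
rewrite !scalerDr !scalerA cmulZl (mulrC v.1 l)//.
Qed.

HB.instance Definition _ := GRing.Lmodule_isLalgebra.Build R[i] unitization uscalerAl.

Let uscalerAr (l : R[i]) u v : l *: (u * v) = u * (l *: v).
Proof.
apply: unitizationE; rewrite /=; first exact: mulrCA.
rewrite !scalerDr !scalerA cmulZr (mulrC u.1 l)//.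
Qed.

HB.instance Definition _ := GRing.Lalgebra_isAlgebra.Build R[i] unitization uscalerAr.

(** Left multiplication by u on B; its operator norm satisfies the C*-identity.
    *)
Definition act u x := u.1 *: x + u.2 ** x.

Lemma actM u v x : act (u * v) x = act u (act v x).
Proof.
rewrite /act /= !cmulDl !cmulZl !cmulDr !cmulZr !scalerDr scalerA cmulA -!addrA.
by congr (_ + _); congr (_ + _); rewrite addrCA.
Qed.

Lemma actD u v x : act (u + v) x = act u x + act v x.
Proof. by rewrite /act /= cmulDl scalerDl addrACA. Qed.

Lemma actZ (l : R[i]) u x : act (l *: u) x = l *: act u x.
Proof. by rewrite /act /= cmulZl scalerDr scalerA. Qed.

Lemma actZr (l : R[i]) u x : act u (l *: x) = l *: act u x.
Proof. by rewrite /act /= cmulZr scalerDr !scalerA mulrC. Qed.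

Lemma act_bound u x : cnorm (act u x) <= (cabs u.1 + cnorm u.2) * cnorm x.
Proof.
by rewrite mulrDl; apply: le_trans (cnormD _ _) _; rewrite cnormZ lerD2l cnorm_cmul.
Qed.

Definition opnorm u : R := sup [set cnorm (act u x) | x in [set x | cnorm x <= 1]].

Lemma opnorm_has_sup u : has_sup [set cnorm (act u x) | x in [set x | cnorm x <= 1]].
Proof.
split; first by exists (cnorm (act u 0)), 0 => //=; rewrite cnorm0.
exists (cabs u.1 + cnorm u.2) => _ [x /= x1 <-].
apply: le_trans (act_bound _ _) _.
by have := cabs_ge0 u.1; have := cnorm_ge0 u.2; have := cnorm_ge0 x; nra.
Qed.

Lemma opnorm_ge u x : cnorm (act u x) <= opnorm u * cnorm x.
Proof.
have [x0|x0] := eqVneq (cnorm x) 0.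
  by rewrite (cnorm_eq0 x0) /act scaler0 cmul0 addr0 cnorm0 mulr0.
have x1 : 0 < cnorm x by rewrite lt_neqAle eq_sym x0 cnorm_ge0.
rewrite -ler_pdivrMr//.
pose y := (cnorm x)^-1%:C *: x.
have yn : cnorm y = 1 by rewrite cnormZ cabs_real gtr0_norm ?invr_gt0// mulVf.
have -> : cnorm (act u x) / cnorm x = cnorm (act u y).
  by rewrite actZr cnormZ cabs_real gtr0_norm ?invr_gt0// mulrC.
apply: sup_upper_bound; first exact: opnorm_has_sup.
by exists y => //=; rewrite yn.
Qed.

Lemma opnorm_le u (M : R) : 0 <= M ->
  (forall x, cnorm (act u x) <= M * cnorm x) -> opnorm u <= M.
Proof.
move=> M0 H; apply: ge_sup; first by have [] := opnorm_has_sup u.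
by move=> _ [x /= x1 <-]; apply: le_trans (H _) _; nra.
Qed.

End Unitization.

Section UnitizationNorm.
Context {R : realType} {B : cstarAlgType R}.
Implicit Types (u v w : unitization B) (x y : B).

Lemma opnorm_ge0 u : 0 <= opnorm u.
Proof.
apply: sup_upper_bound; first exact: opnorm_has_sup.
by exists 0; rewrite /= ?cnorm0// /act scaler0 cmul0 addr0 cnorm0.
Qed.

Lemma opnormD u v : opnorm (u + v) <= opnorm u + opnorm v.
Proof.
apply: opnorm_le => [|x]; first by rewrite addr_ge0 ?opnorm_ge0.
rewrite actD mulrDl; apply: le_trans (cnormD _ _) _.
by apply: lerD; exact: opnorm_ge.
Qed.

Lemma opnormZ (l : R[i]) u : opnorm (l *: u) <= cabs l * opnorm u.
Proof.
apply: opnorm_le => [|x]; first by rewrite mulr_ge0 ?opnorm_ge0 ?cabs_ge0.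
by rewrite actZ cnormZ -mulrA ler_wpM2l ?cabs_ge0// opnorm_ge.
Qed.

Lemma opnormM u v : opnorm (u * v) <= opnorm u * opnorm v.
Proof.
apply: opnorm_le => [|x]; first by rewrite mulr_ge0 ?opnorm_ge0.
rewrite actM; apply: le_trans (opnorm_ge _ _) _.
by rewrite -mulrA ler_wpM2l ?opnorm_ge0// opnorm_ge.
Qed.

Lemma act_adjoint u x y : cstar (act u x) ** y = cstar x ** act (ustar u) y.
Proof.
by rewrite /act cstarD cstarZ cstarM cmulDl cmulDr cmulZl cmulZr cmulA.
Qed.

(** For x in the unit ball, the square of the norm of u x is the norm of x^*
    (u^* u) x. *)
Lemma opnorm_sq_le u : opnorm u ^+ 2 <= opnorm (ustar u * u).
Proof.
rewrite -(sqr_sqrtr (opnorm_ge0 (ustar u * u))) ler_pXn2r ?nnegrE ?opnorm_ge0 ?sqrtr_ge0//.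
apply: opnorm_le => [|x]; first exact: sqrtr_ge0.
rewrite -(ler_pXn2r (n := 2)) ?nnegrE ?cnorm_ge0 ?mulr_ge0 ?sqrtr_ge0 ?cnorm_ge0//.
rewrite exprMn sqr_sqrtr ?opnorm_ge0// -cnorm_starM act_adjoint -actM.
apply: le_trans (cnorm_cmul _ _) _; rewrite cnorm_star.
have := opnorm_ge (ustar u * u) x; have := cnorm_ge0 x; nra.
Qed.

Lemma ustarK u : ustar (ustar u) = u.
Proof.
by apply: unitizationE; rewrite /= ?cstarK//; case: (u.1) => a b /=; rewrite opprK.
Qed.

Lemma opnorm_star u : opnorm (ustar u) = opnorm u.
Proof.
have le v : opnorm v <= opnorm (ustar v).
  have := opnorm_sq_le v; have := opnormM (ustar v) v.
  have [->|v0] := eqVneq (opnorm v) 0; first by rewrite opnorm_ge0.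
  by have v1 : 0 < opnorm v; [rewrite lt_neqAle eq_sym v0 opnorm_ge0|nra].
by apply/le_anti; rewrite le -{2}(ustarK u) le.
Qed.

Lemma opnorm_starM u : opnorm (ustar u * u) = opnorm u ^+ 2.
Proof.
by apply/le_anti; rewrite opnorm_sq_le andbT; have := opnormM (ustar u) u; rewrite opnorm_star.
Qed.

Lemma cabsJ (l : R[i]) : cabs (conjc l) = cabs l.
Proof. by case: l => a b; rewrite /cabs !normc_def /= sqrrN. Qed.

(** Test the operator of u on the adjoint of u.2. *)
Lemma vector_part_bound u : cnorm u.2 <= opnorm u + cabs u.1.
Proof.
have [u0|u0] := eqVneq (cnorm u.2) 0.
  by rewrite u0 addr_ge0 ?opnorm_ge0 ?cabs_ge0.
have u1 : 0 < cnorm u.2 by rewrite lt_neqAle eq_sym u0 cnorm_ge0.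
have := opnorm_ge u (cstar u.2); rewrite /act cnorm_star.
have : cnorm (u.2 ** cstar u.2) = cnorm u.2 ^+ 2.
  by rewrite -{1}(cstarK u.2) cnorm_starM cnorm_star.
have := cnormD (u.1 *: cstar u.2 + u.2 ** cstar u.2) (- (u.1 *: cstar u.2)).
rewrite addrAC subrr add0r cnormN cnormZ cnorm_star => A E C; rewrite E in A.
nra.
Qed.

(** If B has a unit, opnorm vanishes on the difference of the two units; the
    maximum with the modulus of the character u.1 is a C*-norm in all cases. *)
Definition unrm u : R := Num.max (cabs u.1) (opnorm u).

Lemma unrm_ge u : cabs u.1 <= unrm u /\ opnorm u <= unrm u.
Proof. by rewrite /unrm !le_max !lexx orbT. Qed.

Let unrm_ge0 u : 0 <= unrm u.
Proof. by apply: le_trans (unrm_ge u).1; exact: cabs_ge0. Qed.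

Let unrmD u v : unrm (u + v) <= unrm u + unrm v.
Proof.
have [u1 u2] := unrm_ge u; have [v1 v2] := unrm_ge v.
rewrite {1}/unrm ge_max; apply/andP; split.
  by apply: le_trans (cabsD _ _) _; exact: lerD.
by apply: le_trans (opnormD _ _) _; exact: lerD.
Qed.

Let unrmZ_le (l : R[i]) u : unrm (l *: u) <= cabs l * unrm u.
Proof.
have [u1 u2] := unrm_ge u; rewrite {1}/unrm ge_max; apply/andP; split.
  by rewrite [X in cabs X](_ : _ = l * u.1)// cabsM ler_wpM2l ?cabs_ge0.
by apply: le_trans (opnormZ _ _) _; rewrite ler_wpM2l ?cabs_ge0.
Qed.

Let unrmZ (l : R[i]) u : unrm (l *: u) = cabs l * unrm u.
Proof.
apply/le_anti; rewrite unrmZ_le /=.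
have [->|l0] := eqVneq l 0.
  by rewrite (cabs_real 0) normr0 mul0r unrm_ge0.
have := unrmZ_le l^-1 (l *: u); rewrite scalerA mulVf// scale1r.
have : cabs l * cabs l^-1 = 1 by rewrite -cabsM mulfV// (cabs_real 1) normr1.
have := cabs_ge0 l; have := cabs_ge0 l^-1; have := unrm_ge0 u; have := unrm_ge0 (l *: u).
move=> a b c d e /(ler_wpM2l d); rewrite mulrA e mul1r; exact.
Qed.

Let unrm_eq0 u : unrm u = 0 -> u = 0.
Proof.
move=> u0; have [] := unrm_ge u; rewrite u0 => a1 a2.
have c0 : cabs u.1 = 0 by apply/le_anti; rewrite a1 cabs_ge0.
apply: unitizationE; first exact: cabs_eq0.
apply: cnorm_eq0; apply/le_anti; rewrite cnorm_ge0 andbT.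
by apply: le_trans (vector_part_bound u) _; rewrite c0 addr0.
Qed.

Let unrmM u v : unrm (u * v) <= unrm u * unrm v.
Proof.
have [u1 u2] := unrm_ge u; have [v1 v2] := unrm_ge v.
rewrite {1}/unrm ge_max; apply/andP; split.
  by rewrite cabsM; apply: ler_pM; rewrite ?cabs_ge0.
by apply: le_trans (opnormM _ _) _; apply: ler_pM; rewrite ?opnorm_ge0.
Qed.

Let unrm_starM u : unrm (ustar u * u) = unrm u ^+ 2.
Proof.
rewrite /unrm opnorm_starM [X in cabs X](_ : _ = conjc u.1 * u.1)// cabsM cabsJ -expr2.
have c0 := cabs_ge0 u.1; have o0 := opnorm_ge0 u.
have [h|h] := leP (cabs u.1) (opnorm u).
  by rewrite max_r// ler_pXn2r.
by rewrite max_l// ler_pXn2r// ltW.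
Qed.

Let unrm_complete (u : nat -> unitization B) (t : nat -> R) (M : R) :
  (forall n, unrm (u n.+1 - u n) <= t n.+1 - t n) -> (forall n, t n <= M) ->
  exists l : unitization B, forall e : R, 0 < e ->
    exists N, forall n, (N <= n)%N -> unrm (u n - l) < e.
Proof.
move=> ut tM.
have [l Hl] : exists l : R[i], forall e : R, 0 < e ->
    exists N, forall n, (N <= n)%N -> cabs ((u n).1 - l) < e.
  apply: (@complex_complete _ _ t M) => // n; apply: le_trans (ut n).
  exact: (unrm_ge (u n.+1 - u n)).1.
have [b Hb] : exists b : B, forall e : R, 0 < e ->
    exists N, forall n, (N <= n)%N -> cnorm ((u n).2 - b) < e.
  apply: (@cstar_complete _ _ _ (fun n => 2 * t n) (2 * M)) => [n|n]; last first.
    by rewrite ler_wpM2l.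
  have := vector_part_bound (u n.+1 - u n); have [] := unrm_ge (u n.+1 - u n).
  by have := ut n; rewrite /=; lra.
exists ((l, b) : unitization B) => e e0; have e2 : 0 < e / 2 by rewrite divr_gt0.
have [N1 H1] := Hl _ e2; have [N2 H2] := Hb _ e2.
exists (maxn N1 N2) => n; rewrite geq_max => /andP[/H1 h1 /H2 h2].
rewrite /unrm gt_max; apply/andP; split; first by apply: lt_trans h1 _; lra.
apply: (@le_lt_trans _ _ (cabs ((u n).1 - l) + cnorm ((u n).2 - b))); last by lra.
apply: opnorm_le; first by rewrite addr_ge0 ?cabs_ge0 ?cnorm_ge0.
by move=> x; exact: act_bound.
Qed.

Let ustarD u v : ustar (u + v) = ustar u + ustar v.
Proof.
apply: unitizationE; rewrite /= ?cstarD//.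
by case: (u.1) => a b; case: (v.1) => c d /=; congr (_ +i* _)%C; rewrite opprD.
Qed.

Let ustarZ (l : R[i]) u : ustar (l *: u) = conjc l *: ustar u.
Proof.
apply: unitizationE; rewrite /= ?cstarZ//.
by rewrite [in LHS](_ : l *: u.1 = l * u.1)//; exact: rmorphM.
Qed.

Let ustarM u v : ustar (u * v) = ustar v * ustar u.
Proof.
apply: unitizationE.
  by rewrite /= [RHS]mulrC; exact: rmorphM.
by rewrite /= !cstarD !cstarZ cstarM; congr (_ + _); rewrite addrC.
Qed.

HB.instance Definition _ := isUnitalCStar.Build R (unitization B)
  (fun u => ustar u) (fun u => unrm u) ustarD ustarZ ustarM ustarK unrmD unrmZ unrm_eq0 unrmM unrm_starM unrm_complete.

Definition inB x : unitization B := (0, x).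

Lemma inBD x y : inB (x + y) = inB x + inB y.
Proof. by apply: unitizationE; rewrite /= ?addr0. Qed.
Lemma inBN x : inB (- x) = - inB x.
Proof. by apply: unitizationE; rewrite /= ?oppr0. Qed.
Lemma inBB x y : inB (x - y) = inB x - inB y.
Proof. by rewrite inBD inBN. Qed.
Lemma inBZ (l : R[i]) x : inB (l *: x) = l *: inB x.
Proof. by apply: unitizationE => //=; rewrite scaler0. Qed.
Lemma inBM x y : inB (x ** y) = inB x * inB y.
Proof. by apply: unitizationE; rewrite /= ?mulr0// !scale0r !add0r. Qed.
Lemma inB_star x : star (inB x) = inB (cstar x).
Proof. by apply: unitizationE; rewrite //= oppr0. Qed.
Lemma inB0 : inB 0 = 0. Proof. by []. Qed.
Lemma inB_inj x y : inB x = inB y -> x = y. Proof. by case. Qed.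

Lemma nrm_inB x : nrm (inB x) = cnorm x.
Proof.
have c0 : cabs (0 : R[i]) = 0 by rewrite (cabs_real 0) normr0.
have -> : nrm (inB x) = unrm (inB x) by [].
rewrite /unrm /= c0 max_r ?opnorm_ge0//; apply/le_anti/andP; split.
  apply: opnorm_le => [|y]; first exact: cnorm_ge0.
  by have := act_bound (inB x) y; rewrite /= c0 add0r.
by have := vector_part_bound (inB x); rewrite /= c0 addr0.
Qed.

Lemma inBK u : u.1 = 0 -> inB u.2 = u.
Proof. by move=> u0; apply: unitizationE. Qed.

Lemma scM u v : (u * v).1 = u.1 * v.1. Proof. by []. Qed.
Lemma sc_rsc (t : R) : (rsc t : unitization B).1 = t%:C. Proof. exact: mulr1. Qed.

End UnitizationNorm.

(** * Positivity and the Cuntz preorder in B *)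

Section Algebra.
Context {R : realType} {B : cstarAlgType R}.
Implicit Types (a b m x y : B) (u v w c g : unitization B) (S J : set B).

(** An inverse of 1 - u in the unitization has scalar part 1, so it has the
    form 1 - w with w in B that the spectral definition uses. *)
Lemma positiveP b : positive b <-> upos (inB b).
Proof.
split.
  move=> [sb Hb]; apply: upos_of_spec; split; first by rewrite inB_star sb.
  move=> l l0; have [w [w1 w2]] := Hb l l0.
  have ln : l != 0 by apply: contraNneq l0 => ->.
  pose v := l^-1 *: inB b.
  have vE : l *: 1 - inB b = l *: (1 - v) by rewrite scalerBr scalerA mulfV// scale1r.
  have v1 : v + inB w = v * inB w by rewrite /v -inBZ -inBD w1 inBM.
  have v2 : v + inB w = inB w * v by rewrite /v -inBZ -inBD w2 inBM.
  exists (l^-1 *: (1 - inB w)); rewrite vE; split.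
    rewrite -scalerAl -scalerAr scalerA mulfV// scale1r.
    have -> : (1 - v) * (1 - inB w) = 1 + (v * inB w - (v + inB w)) by ncring.
    by rewrite v1 subrr addr0.
  rewrite -scalerAl -scalerAr scalerA mulVf// scale1r.
  have -> : (1 - inB w) * (1 - v) = 1 + (inB w * v - (v + inB w)) by ncring.
  by rewrite v2 subrr addr0.
move=> pb; have [sb Hb] := upos_spec pb; split.
  by apply: inB_inj; rewrite -inB_star.
move=> l l0; have [z [z1 z2]] := Hb l l0 => v.
have ln : l != 0 by apply: contraNneq l0 => ->.
pose y := l *: z.
have vE : 1 - inB v = l^-1 *: (l *: 1 - inB b) by rewrite scalerBr scalerA mulVf// scale1r inBZ.
have y1 : (1 - inB v) * y = 1 by rewrite vE -scalerAl -scalerAr scalerA mulVf// scale1r.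
have y2 : y * (1 - inB v) = 1 by rewrite vE -scalerAl -scalerAr scalerA mulfV// scale1r.
have ysc : y.1 = 1 by have := congr1 fst y1; rewrite scM /= subr0 mul1r.
have yE : y = 1 - inB (- y.2) by apply: unitizationE; rewrite /= ?subr0// opprK add0r.
exists (- y.2); split; apply: inB_inj; rewrite inBD inBM; apply/esym/eqP; rewrite -subr_eq0; apply/eqP.
  have <- : (1 - inB v) * y - 1 = inB v * inB (- y.2) - (inB v + inB (- y.2)).
    by rewrite {1}yE; ncring.
  by rewrite y1 subrr.
have <- : y * (1 - inB v) - 1 = inB (- y.2) * inB v - (inB v + inB (- y.2)).
  by rewrite {1}yE; ncring.
by rewrite y2 subrr.
Qed.

Lemma closureP S x : closure S x <->
  forall e : R, 0 < e -> exists2 y, S y & cnorm (x - y) < e.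
Proof.
split=> [Sx e e0|H V /nbhs_ballP[e]].
  have ec : 0 < e%:C :> R[i] by rewrite ltcR.
  have [y [Sy]] := Sx _ (nbhsx_ballx x _ ec).
  rewrite -ball_normE /= cnormE ltcR => xy; exists y => //.
rewrite /= ltcE /= => /andP[/eqP e1 e0] eV.
have [y Sy xy] := H _ e0; exists y; split => //; apply: eV.
by rewrite -ball_normE /= cnormE ltcE /= -e1 eqxx.
Qed.

Lemma closedP S : closed S <-> forall x,
  (forall e : R, 0 < e -> exists2 y, S y & cnorm (x - y) < e) -> S x.
Proof.
split=> [cS x H|H]; first by apply: cS; apply/closureP.
by move=> x /closureP; exact: H.
Qed.

(** Functional calculus of elements of S + C therefore stays in S + C. *)
Lemma ucs_unitization S : Defs.subspace S -> closed S ->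
  (forall x y, S x -> S y -> S (x ** y)) -> ucs [set u : unitization B | S u.2].
Proof.
move=> [S0 SD SZ] /closedP Sc SM; split => //=.
- by move=> u v Su Sv; exact: SD.
- by move=> u v Su Sv; apply: (SD); [apply: SD; exact: SZ|exact: SM].
- by move=> l u Su; exact: SZ.
- move=> u H; apply: Sc => e e0; have e2 : 0 < e / 2 by rewrite divr_gt0.
  have [v Sv uv] := H _ e2; exists v.2 => //.
  have := vector_part_bound (u - v); have [] := unrm_ge (u - v).
  have -> : unrm (u - v) = nrm (u - v) by [].
  rewrite /=; lra.
Qed.

(** A character preserves positivity: u is a square. *)
Lemma upos_sc u : upos u -> exists2 t : R, 0 <= t & u.1 = t%:C.
Proof.
move=> pu; have [k [pk kE _]] := upos_sqrt pu.
have := upos_sa pk => /(congr1 fst) /=; rewrite -kE scM.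
case: (k.1) => a b [] nb; have b0 : b = 0 by lra.
exists (a * a); first by rewrite -expr2 sqr_ge0.
by rewrite b0; apply/eqP; rewrite eq_complex /= !mulr0 mul0r subr0 addr0 !eqxx.
Qed.

Lemma sc_star_mul u : (star u * u).1 = 0 -> u.1 = 0.
Proof.
rewrite scM => /(congr1 cabs); rewrite cabsM (cabs_real 0) normr0 cabsJ => /eqP.
by rewrite -expr2 sqrf_eq0 => /eqP/cabs_eq0.
Qed.

Lemma sc_sqrt u : star u = u -> (u * u).1 = 0 -> u.1 = 0.
Proof. by move=> su; rewrite -{1}su; exact: sc_star_mul. Qed.

(** The scalar parts of p and q are nonnegative, with product 0 and difference
    t. Thus the positive part of h - s lies in B for every h in B and s >= 0.
    *)
Lemma sc_pos_part p q (t : R) : upos p -> upos q -> p * q = 0 ->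
  (p - q : unitization B).1 = t%:C -> t <= 0 -> p.1 = 0.
Proof.
move=> /upos_sc[s s0 ps] /upos_sc[r r0 qr] /(congr1 fst).
rewrite scM ps qr -rmorphM => /= -[/eqP]; rewrite mulf_eq0 => /orP[/eqP->//|/eqP r00].
rewrite /= ps qr r00 subr0 => -[] st t0; congr (_ %:C); lra.
Qed.

Lemma positive_sqrt b : positive b -> exists k, positive k /\ k ** k = b.
Proof.
move=> /positiveP pb; have [k [pk kE _]] := upos_sqrt pb.
have k0 : k.1 = 0 by apply: sc_sqrt; [exact: upos_sa|rewrite kE].
exists k.2; split; first by apply/positiveP; rewrite inBK.
by apply: inB_inj; rewrite inBM inBK.
Qed.

(** Choice of a tolerance d, given the constant K by which an estimate will
    multiply it. *)
Lemma exists_small_factor (e K : R) : 0 < e -> 0 <= K -> exists d : R, [/\ 0 < d, d <= 1 & d * K < e].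
Proof.
move=> e0 K0; exists (Num.min 1 (e / (K + 1))).
have K1 : 0 < K + 1 by lra.
split; first by rewrite lt_min ltr01 divr_gt0.
  by rewrite ge_min lexx.
apply: (@le_lt_trans _ _ (e / (K + 1) * K)).
  by rewrite ler_wpM2r// ge_min lexx orbT.
by rewrite mulrAC ltr_pdivrMr//; nra.
Qed.

Lemma positive_factor m g : positive m -> upos (star g * g - inB m) -> exists x,
  cstar x ** x = m /\ forall e : R, 0 < e -> exists w : B, nrm (inB x - g * inB w) < e.
Proof.
move=> /positiveP pm pg; have [k [x [pk kE gk xE Hx]]] := upos_factor pm pg.
have k0 : k.1 = 0 by apply: sc_sqrt; [exact: upos_sa|rewrite kE].
have x0 : x.1 = 0 by apply: sc_star_mul; rewrite xE.
exists x.2; split.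
  by apply: inB_inj; rewrite inBM -inB_star inBK.
move=> e /Hx[w Hw]; exists (w * k).2; rewrite !inBK// scM k0 mulr0 //.
Qed.

(** By positive_factor, a = x^* x with x a limit of elements sqrt b c w for w
    in B; so a is a limit of (c w)^* b (c w), where c w lies in B even when c
    only lies in the unitization. *)
Lemma cuntz_le_of_upos a b c : positive a -> positive b ->
  upos (star c * inB b * c - inB a) -> cuntz_le a b.
Proof.
move=> pa pb H; have /positiveP pb' := pb.
have [k [pk kE _]] := upos_sqrt pb'.
have [x [xE Hx]] : exists x, cstar x ** x = a /\
    forall e : R, 0 < e -> exists w : B, nrm (inB x - (k * c) * inB w) < e.
  apply: positive_factor => //; rewrite starM (upos_sa pk) -mulrA (mulrA k) kE mulrA //.
move=> e e0.
have K0 : 0 <= 2 * nrm (inB x) + 1 by have := nrm_ge0 (inB x); lra.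
have [d [d0 d1 dK]] := exists_small_factor e0 K0.
have [w Hw] := Hx d d0; pose z := k * c * inB w.
exists (c * inB w).2.
have cw : inB (c * inB w).2 = c * inB w by apply: inBK; rewrite scM mulr0.
rewrite -nrm_inB inBB !inBM -inB_star cw -xE inBM -inB_star.
have -> : star (c * inB w) * inB b * (c * inB w) = star z * z.
  by rewrite /z !starM (upos_sa pk) -kE !mulrA.
apply: le_lt_trans (nrm_sqB _ _) _; apply: le_lt_trans dK.
have zb : nrm z <= nrm (inB x) + d.
  have := nrmD (inB x) (z - inB x); rewrite addrC subrK nrmBC; rewrite -/z in Hw; lra.
rewrite -/z in Hw; apply: ler_pM; [exact: nrm_ge0|by rewrite addr_ge0 ?nrm_ge0|exact: ltW|lra].
Qed.

Lemma ideal_absorb J u x v : ideal setT J -> J x -> J (u * inB x * v).2.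
Proof.
move=> [_ [J0 JD JZ] _ JM] Jx /=.
rewrite !mulr0 !scale0r addr0 add0r.
have JM1 a : J (a ** x) by have [] := JM a x I Jx.
have JM2 y a : J y -> J (y ** a) by move=> Jy; have [] := JM a y I Jy.
have Jy : J (u.1 *: x + u.2 ** x) by apply: (JD) => //; exact: JZ.
by apply: (JD); [exact: JZ|exact: JM2].
Qed.

(** By upos_approx, x is a limit of elements x r x^* x. *)
Lemma ideal_star_mul J x : ideal setT J -> J (cstar x ** x) -> J x.
Proof.
move=> iJ Jxx; have [_ _ /closedP Jc _] := iJ; apply: Jc => e e0.
pose d := inB (cstar x ** x).
have dE : d = star (inB x) * inB x by rewrite /d inBM inB_star.
have pd : upos d by rewrite dE; exact: upos_starM.
have [r [_ _ _ Hr]] : exists r, [/\ upos r, gen d r, nrm (r * d) <= 1 &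
    nrm (inB x - inB x * r * d) < e].
  by apply: upos_approx => //; rewrite -dE subrr; exact: upos0.
exists (inB x * r * d * 1).2; first exact: ideal_absorb.
by rewrite mulr1 -nrm_inB inBB inBK // scM mulr0.
Qed.

Lemma ideal_cuntz J a b : ideal setT J -> J b -> cuntz_le a b -> J a.
Proof.
move=> iJ Jb ab; have [_ _ /closedP Jc JM] := iJ; apply: Jc => e /ab[x Hx].
by exists (cstar x ** b ** x) => //; apply: (JM _ _ I _).2; apply: (JM _ _ I Jb).1.
Qed.

Lemma positive_starM x : positive (cstar x ** x).
Proof. by apply/positiveP; rewrite inBM -inB_star; exact: upos_starM. Qed.

Lemma starM_neq0 x : x != 0 -> cstar x ** x != 0.
Proof.
apply: contra_neq => xx; apply: cnorm_eq0; apply/eqP; rewrite -sqrf_eq0.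
by rewrite -cnorm_starM xx cnorm0.
Qed.

Lemma positive_sa b : positive b -> cstar b = b. Proof. by case. Qed.

Lemma positive_square b : cstar b = b -> positive (b ** b).
Proof. by move=> {1}<-; exact: positive_starM. Qed.

End Algebra.

Section Expectation.
Context {R : realType} {B : cstarAlgType R}.

(** Complete positivity on matrices of size 1 is positivity. *)
Lemma mx1_positive (b : B) : positive b <-> mx_positive (const_mx b : 'M[B]_1).
Proof.
split=> -[sb Hb]; split.
- by apply/matrixP => i j; rewrite !mxE.
- move=> l /Hb[w [w1 w2]]; exists (const_mx w).
  by split; apply/matrixP => i j; rewrite !mxE big_ord1 !mxE.
- by have /matrixP/(_ 0 0) := sb; rewrite !mxE.
- move=> l /Hb[w [/matrixP/(_ 0 0) w1 /matrixP/(_ 0 0) w2]]; exists (w 0 0).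
  by move: w1 w2; rewrite !mxE !big_ord1 !mxE.
Qed.

Lemma cp_positive (E : B -> B) b : completely_positive E -> positive b -> positive (E b).
Proof.
move=> cE /mx1_positive /cE H; apply/mx1_positive.
by rewrite (_ : const_mx _ = map_mx E (const_mx b))//; apply/matrixP => i j; rewrite !mxE.
Qed.

End Expectation.

(** * Schur complements *)

Section Schur.
Context {R : realType} {U : ucstarType R}.
Implicit Types (u v x y z h : U) (s t e : R).

Lemma upos_lim u : (forall e, 0 < e -> exists2 v, upos v & nrm (u - v) < e) -> upos u.
Proof.
move=> H.
have su : star u = u.
  apply: subr0_eq; apply: (@nrm_small _ _ _ 2) => e e0; have [v pv uv] := H _ e0.
  have -> : star u - u = star (u - v) - (u - v) by rewrite starB (upos_sa pv); ncring.
  by apply: le_trans (nrmB _ _) _; rewrite nrm_star; lra.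
split => //; exists (nrm u + 1); first by have := nrm_ge0 u; lra.
apply/ler_addgt0Pl => e e0.
have e1 : 0 < Num.min e 1 by rewrite lt_min e0 ltr01.
have [v pv uv] := H _ e1.
have [ue u1] : nrm (u - v) < e /\ nrm (u - v) < 1.
  by move: uv; rewrite lt_min => /andP[].
have vt : nrm v <= nrm u + 1 by have := nrm_tri v u 0; rewrite !subr0 nrmBC; lra.
have v0 := nrm_ge0 v.
have tv : nrm (rsc (nrm u + 1) - v) <= nrm u + 1.
  apply: upos_le_nrm; first by lra.
    by apply: upos_rscB => //; exact: upos_sa.
  by rewrite subKr.
have -> : rsc (nrm u + 1) - u = (rsc (nrm u + 1) - v) - (u - v) by ncring.
by apply: le_trans (nrmB _ _) _; lra.
Qed.

Lemma nrm_sa_le h e : star h = h -> 0 <= e -> upos (rsc e - h) -> upos (rsc e + h) ->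
  nrm h <= e.
Proof.
move=> sh e0 p1 p2.
have c : (rsc e - h) * (rsc e + h) = (rsc e + h) * (rsc e - h).
  apply: subr0_eq; transitivity ((rsc e * h - h * rsc e) + (rsc e * h - h * rsc e)).
    by ncring.
  by rewrite rsc_comm subrr addr0.
have := uposM p1 p2 c.
have -> : (rsc e - h) * (rsc e + h) = rsc (e ^+ 2) - h * h.
  rewrite expr2 rscM.
  have -> : (rsc e - h) * (rsc e + h) = rsc e * rsc e - h * h + (rsc e * h - h * rsc e) by ncring.
  by rewrite rsc_comm subrr addr0.
move=> P; have := upos_le_nrm (sqr_ge0 e) (upos_square sh) P.
by rewrite nrmsq//; have := nrm_ge0 h; nra.
Qed.

(** Divide by t and let t tend to +oo and to -oo: both h and - h are positive
    up to arbitrarily small errors. *)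
Lemma upos_bounded_zero h (K : U) : star h = h ->
  (forall t, upos (rsc t * h + K)) -> h = 0.
Proof.
move=> sh H; have sK : star K = K.
  by have := upos_sa (H 0); rewrite rsc0 mul0r add0r.
apply: (@nrm_small _ _ _ 1) => e e0; rewrite mul1r.
pose M := nrm K + 1; have M0 : 0 < M by have := nrm_ge0 K; rewrite /M; lra.
have KM : upos (rsc M - K) by apply: upos_rscB => //; rewrite lerDl.
have eM : 0 <= e / M by rewrite divr_ge0// ltW.
have tM : e / M * (M / e) = 1 by field; rewrite !gt_eqF.
have key t : upos (rsc (e / M) * (rsc t * h + K) + rsc (e / M) * (rsc M - K)).
  by apply: uposD; apply: uposZ.
apply: nrm_sa_le => //; first exact: ltW.
  have := key (- (M / e)).
  rewrite -mulrDr -addrA [K + _]addrC subrK mulrDr mulrA -!rscM mulrN tM mulfVK ?gt_eqF//.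
  by rewrite rscN rsc1 mulN1r addrC.
have := key (M / e).
rewrite -mulrDr -addrA [K + _]addrC subrK mulrDr mulrA -!rscM tM mulfVK ?gt_eqF//.
by rewrite rsc1 mul1r addrC.
Qed.

(** If a matrix with entries p is invertible, so is the Schur complement of
    p11, and the upper left entry of the inverse matrix is its inverse. Only
    the first column and the first row of the inverse matrix are needed. *)
Lemma schur_inv (p00 p01 p10 p11 z00 z10 z01 r : U) :
  r * p11 = 1 -> p11 * r = 1 ->
  p00 * z00 + p01 * z10 = 1 -> p10 * z00 + p11 * z10 = 0 ->
  z00 * p00 + z01 * p10 = 1 -> z00 * p01 + z01 * p11 = 0 ->
  (p00 - p01 * r * p10) * z00 = 1 /\ z00 * (p00 - p01 * r * p10) = 1.
Proof.
move=> rp pr e1 e2 e3 e4.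
have z10E : z10 = - (r * (p10 * z00)).
  have := congr1 (fun x => r * x) e2; rewrite mulr0 mulrDr (mulrA r p11) rp mul1r.
  by move=> /addr0_eq ->.
have z01E : z01 = - (z00 * p01 * r).
  have := congr1 (fun x => x * r) e4; rewrite mul0r mulrDl -(mulrA z01) pr mulr1.
  by move=> /addr0_eq ->.
split; first by rewrite -e1 z10E; ncring.
by rewrite -e3 z01E; ncring.
Qed.

(** A continuity argument along [s0, +oo[. At the infimum T of the parameters
    where f is positive, f T is positive as a limit; being invertible, it is
    bounded below by upos_invertible, so f stays positive slightly below T. *)
Lemma upos_path (f : R -> U) (C s0 s1 : R) : 0 < C -> s0 <= s1 ->
  (forall s, s0 <= s -> exists z, f s * z = 1 /\ z * f s = 1) ->
  (forall s, s0 <= s -> star (f s) = f s) ->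
  (forall s t, s0 <= s -> s0 <= t -> nrm (f s - f t) <= C * `|s - t|) ->
  upos (f s1) -> upos (f s0).
Proof.
move=> C0 s01 finv fsa fL fs1.
pose G := [set s | s0 <= s /\ upos (f s)].
have G0 : G !=set0 by exists s1.
have Glb : lbound G s0 by move=> s [].
have hG : has_inf G by split => //; exists s0.
pose T := inf G.
have sT : s0 <= T by exact: lb_le_inf.
have fT : upos (f T).
  apply: upos_lim => e e0; have eC : 0 < e / C by rewrite divr_gt0.
  have [s [ss ps] sTe] := inf_adherent eC hG.
  exists (f s) => //; rewrite nrmBC; apply: le_lt_trans (fL _ _ ss sT) _.
  have Ts : T <= s by apply: ge_inf => //; exists s0.
  by rewrite ger0_norm ?subr_ge0// mulrC -ltr_pdivlMr// ltrBlDl.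
have [->//|sTn] := eqVneq s0 T.
have sT' : s0 < T by rewrite lt_neqAle sTn.
have [z [z1 z2]] := finv _ sT.
have [_ HM] := upos_invertible fT z1 z2.
pose M := nrm z + 1; have M0 : 0 < M by have := nrm_ge0 z; rewrite /M; lra.
have Mn : M != 0 by rewrite gt_eqF.
have {}HM : upos (rsc M * f T - 1) by apply: HM; rewrite lerDl.
pose d := Num.min (T - s0) (M^-1 / C).
have d0 : 0 < d by rewrite lt_min subr_gt0 sT' divr_gt0 ?invr_gt0.
have dT : d <= T - s0 by rewrite ge_min lexx.
have dM : C * d <= M^-1 by rewrite mulrC -ler_pdivlMr// ge_min lexx orbT.
pose s := T - d; have ss : s0 <= s by rewrite /s; lra.
have : G s.
  split => //.
  have -> : f s = rsc M^-1 * (rsc M * f T - 1) + (rsc M^-1 - (f T - f s)).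
    by rewrite mulrBr mulrA -rscM mulVf// rsc1 mul1r mulr1; ncring.
  apply: uposD; first by apply: uposZ => //; rewrite invr_ge0 ltW.
  apply: upos_rscB; first by rewrite starB !fsa.
  apply: le_trans (fL _ _ sT ss) _; rewrite /s opprB addrC subrK gtr0_norm//.
move=> /(ge_inf (ex_intro _ s0 Glb)); rewrite -/T /s; lra.
Qed.

(** The hypothesis says that - s is not in the spectrum of the matrix [a, b^*;
    b, g], for any s > 0. So the Schur complement s + a - b^* (s + g)^-1 b is
    invertible; it is positive for large s, hence for all s > 0 by upos_path.
    Since g <= 1, the inverse of s + g is at least 1 / (1 + s), and the limit s
    -> 0 gives a >= b^* b. This draws an inequality in the algebra from a
    statement on spectra of matrices without making the matrices a C*-algebra.
    *)
Lemma schur_positive (a b g : U) : upos g -> upos (1 - g) -> star a = a ->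
  (forall s, 0 < s -> exists z00 z10 z01,
     [/\ (rsc s + a) * z00 + star b * z10 = 1, b * z00 + (rsc s + g) * z10 = 0,
         z00 * (rsc s + a) + z01 * b = 1 & z00 * star b + z01 * (rsc s + g) = 0]) ->
  upos (a - star b * b).
Proof.
move=> pg pg1 sa H.
have [r Hr] : exists r : R -> U, forall s, 0 < s ->
    [/\ upos (r s), r s * (rsc s + g) = 1, (rsc s + g) * r s = 1 & gen g (r s)].
  have /choice[r Hr] : forall s, exists r, 0 < s ->
    [/\ upos r, r * (rsc s + g) = 1, (rsc s + g) * r = 1 & gen g r].
    move=> s; have [s0|s0] := ltP 0 s; last by exists 0.
    by have [r Hr] := upos_inv pg s0; exists r.
  by exists r.
have rle s : 0 < s -> nrm (r s) <= s^-1.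
  move=> s0; have [pr r1 r2 gr] := Hr s s0.
  have E : 1 - rsc s * r s = r s * g by rewrite -r1 mulrDr rsc_comm; ncring.
  have : nrm (rsc s * r s) <= 1.
    apply: upos_le_nrm => //; first by apply: uposZ => //; exact: ltW.
    rewrite rsc1 E; apply: uposM => //; exact: gen_comm gr (@gen_id _ _ g).
  by rewrite nrm_rscM gtr0_norm// mulrC -ler_pdivlMr// mul1r.
pose f s := rsc s + a - star b * r s * b.
have sf s : 0 < s -> star (f s) = f s.
  move=> s0; have [pr _ _ _] := Hr s s0.
  by rewrite /f starB starD star_rsc sa !starM starK (upos_sa pr) mulrA.
have K0 := nrm_ge0 b.
have nb x : nrm (star b * x * b) <= nrm b ^+ 2 * nrm x.
  apply: le_trans (nrmM _ _) _; have := nrmM (star b) x; rewrite nrm_star.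
  have := nrm_ge0 x; nra.
have fpos s : 0 < s -> upos (f s).
  move=> s0; pose K := nrm a + nrm b ^+ 2.
  pose s1 := Num.max s (K + 1).
  have s1s : s <= s1 by rewrite le_max lexx.
  have s1K : K + 1 <= s1 by rewrite le_max lexx orbT.
  have sV : 0 < s^-1 by rewrite invr_gt0.
  apply: (@upos_path f (1 + nrm b ^+ 2 * (s^-1 * s^-1)) s s1) => //.
  - have : 0 <= nrm b ^+ 2 * (s^-1 * s^-1) by rewrite mulr_ge0 ?sqr_ge0 ?mulr_ge0 ?ltW.
    lra.
  - move=> t st; have t0 : 0 < t by exact: lt_le_trans st.
    have [z00 [z10 [z01 [e1 e2 e3 e4]]]] := H t t0; have [_ r1 r2 _] := Hr t t0.
    by exists z00; apply: schur_inv r1 r2 e1 e2 e3 e4.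
  - by move=> t st; apply: sf; exact: lt_le_trans st.
  - move=> t t' st st'; have t0 := lt_le_trans s0 st; have t0' := lt_le_trans s0 st'.
    have [_ r1 r2 _] := Hr t t0; have [_ r1' r2' _] := Hr t' t0'.
    have rB : r t - r t' = rsc (t' - t) * (r t * r t').
      transitivity (r t * ((rsc t' + g) - (rsc t + g)) * r t').
        by rewrite mulrBr mulrBl -mulrA r2' r1 mulr1 mul1r.
      by rewrite (_ : _ - _ = rsc (t' - t)) ?rsc_comm ?mulrA// rscB; ncring.
    have -> : f t - f t' = rsc (t - t') - star b * (r t - r t') * b.
      by rewrite /f rscB; ncring.
    apply: le_trans (nrmB _ _) _; rewrite mulrDl mul1r.
    apply: lerD; first exact: nrm_rsc.
    apply: le_trans (nb _) _; rewrite rB nrm_rscM distrC.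
    rewrite -mulrA ler_wpM2l ?sqr_ge0// mulrC ler_wpM2r//.
    apply: le_trans (nrmM _ _) _; apply: ler_pM; rewrite ?nrm_ge0//.
      by apply: le_trans (rle _ t0) _; rewrite lef_pV2.
    by apply: le_trans (rle _ t0') _; rewrite lef_pV2.
  - have s10 : 0 < s1 by exact: lt_le_trans s1s.
    have -> : f s1 = rsc s1 + (a - star b * r s1 * b) by rewrite /f; ncring.
    have [pr _ _ _] := Hr s1 s10.
    apply: upos_rscD; first by rewrite starB sa !starM starK (upos_sa pr) mulrA.
    apply: le_trans (nrmB _ _) _.
    have h1 : nrm (r s1) <= 1.
      apply: le_trans (rle _ s10) _; rewrite invf_le1//; apply: le_trans s1K.
      by rewrite lerDr /K addr_ge0 ?sqr_ge0 ?nrm_ge0.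
    have := nb (r s1); rewrite /K in s1K; have := sqr_ge0 (nrm b); nra.
apply: upos_lim => e e0.
pose K := nrm a + 1; have K1 : 0 < K by have := nrm_ge0 a; rewrite /K; lra.
pose s := Num.min 1 (e / (K + 2)).
have s0 : 0 < s by rewrite lt_min ltr01 divr_gt0//; lra.
have s1 : s <= 1 by rewrite ge_min lexx.
have sK : s * (K + 2) <= e by rewrite -ler_pdivlMr ?ge_min ?lexx ?orbT//; lra.
have [pr r1 r2 gr] := Hr s s0.
have P1 : upos (rsc (1 + s) * (rsc s + a) - star b * b).
  have -> : rsc (1 + s) * (rsc s + a) - star b * b =
    rsc (1 + s) * f s + star b * (rsc (1 + s) * r s - 1) * b.
    apply: subr0_eq; rewrite /f.
    transitivity ((rsc (1 + s) * star b - star b * rsc (1 + s)) * r s * b).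
      by ncring.
    by rewrite rsc_comm subrr !mul0r.
  apply: uposD; first by apply: uposZ; [lra|exact: fpos].
  apply: upos_conj.
  have -> : rsc (1 + s) * r s - 1 = r s * (1 - g).
    apply: subr0_eq; rewrite rscD rsc1.
    transitivity (rsc s * r s - r s * rsc s + (r s * (rsc s + g) - 1)).
      by ncring.
    by rewrite rsc_comm r1 !subrr addr0.
  apply: uposM => //; rewrite mulrBr mulrBl mulr1 mul1r.
  by rewrite (gen_comm gr (@gen_id _ _ g)).
exists (rsc (1 + s) * (rsc s + a) - star b * b) => //.
have -> : a - star b * b - (rsc (1 + s) * (rsc s + a) - star b * b) =
    - (rsc s * (rsc s + a + 1)).
  by rewrite rscD rsc1; ncring.
rewrite nrmN nrm_rscM gtr0_norm//.
apply: lt_le_trans sK; rewrite ltr_pM2l//.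
have := nrmD (rsc s + a) 1; have := nrmD (rsc s) a; have := nrm_rsc (U := U) s.
by have := @nrm1_le _ U; rewrite gtr0_norm// /K; lra.
Qed.

End Schur.

(** * Conditional expectations are bimodule maps *)

Section Bimodule.
Context {R : realType} {B : cstarAlgType R}.
Implicit Types (a x y z e : B) (A : set B).

Lemma cmulBl x y z : (x - y) ** z = x ** z - y ** z.
Proof. by rewrite cmulDl -scaleN1r cmulZl scaleN1r. Qed.

Lemma cmulBr x y z : z ** (x - y) = z ** x - z ** y.
Proof. by rewrite cmulDr -scaleN1r cmulZr scaleN1r. Qed.

Lemma cmulNr x y : x ** (- y) = - (x ** y).
Proof. by rewrite -scaleN1r cmulZr scaleN1r. Qed.

Lemma cmulNl x y : (- x) ** y = - (x ** y).
Proof. by rewrite -scaleN1r cmulZl scaleN1r. Qed.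

Lemma cstarB x y : cstar (x - y) = cstar x - cstar y.
Proof. by rewrite cstarD cstarN. Qed.

Lemma cmul_suml n (F : 'I_n -> B) x : (\sum_i F i) ** x = \sum_i F i ** x.
Proof.
by apply: (big_morph (fun y => y ** x)) => [u v|]; rewrite ?cmulDl ?c0mul.
Qed.

Lemma cmul_sumr n (F : 'I_n -> B) x : x ** (\sum_i F i) = \sum_i x ** F i.
Proof.
by apply: (big_morph (fun y => x ** y)) => [u v|]; rewrite ?cmulDr ?cmul0.
Qed.

Lemma positiveD a x : positive a -> positive x -> positive (a + x).
Proof. by move=> /positiveP pa /positiveP px; apply/positiveP; rewrite inBD; exact: uposD. Qed.

Lemma positive0 : positive (0 : B).
Proof. by apply/positiveP; exact: upos0. Qed.

(** As in uspec_swap, resolvents of the Gram matrix of r come from resolvents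
    of the single element k, the sum of all r_m r_m^*, which is positive. *)
Lemma gram_positive n (r : 'I_n -> B) :
  mx_positive (\matrix_(i, j) (cstar (r i) ** r j) : 'M[B]_n).
Proof.
split; first by apply/matrixP => i j; rewrite !mxE cstarM cstarK.
pose k := \sum_m r m ** cstar (r m).
have [_ Hk] : positive k.
  apply: big_ind => [|u v|m _]; [exact: positive0|exact: positiveD|].
  by rewrite -{1}(cstarK (r m)); exact: positive_starM.
move=> l l0 v; have [w [w1 w2]] := Hk l l0.
pose u := l^-1 *: k; rewrite -/u in w1 w2.
pose W : 'M[B]_n := \matrix_(i, j) (- l^-1 *: (cstar (r i) ** (r j - w ** r j))).
have sumE i j : (v + W) i j = l^-1 *: (cstar (r i) ** w ** r j).
  by rewrite !mxE scaleNr -scalerBr -cmulBr subKr cmulA.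
exists W; split; apply/matrixP => i j; rewrite sumE mxE.
  transitivity (- l^-1 *: (cstar (r i) ** (u ** (r j - w ** r j)))).
    rewrite cmulBr (cmulA u) -w1 cmulDl opprD addrA subrr sub0r cmulNr.
    by rewrite scaleNr scalerN opprK cmulA.
  rewrite /u cmulZl cmul_suml scaler_sumr cmul_sumr scaler_sumr.
  apply: eq_bigr => m _; rewrite !mxE cmulZl !cmulZr !cmulA scalerA.
  by rewrite scalerA mulrC.
transitivity (- l^-1 *: (cstar (r i) ** (u - w ** u) ** r j)).
  by rewrite -w2 opprD addrA subrr sub0r cmulNr cmulNl scaleNr scalerN opprK.
rewrite /u cmulZr -scalerBr cmulZr cmul_sumr -sumrB cmul_sumr cmulZl cmul_suml.
rewrite scaler_sumr scaler_sumr.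
apply: eq_bigr => m _; rewrite !mxE cmulZr !cmulZl scalerA -cmulA.
by rewrite scalerA [in LHS]mulrC !(cmulBl, cmulBr) !cmulA.
Qed.

(** Apply upos_approx to the adjoint of y. *)
Lemma approx_unit y (d : R) : 0 < d ->
  exists e, [/\ positive e, cnorm e <= 1 & cnorm (e ** y - y) < d].
Proof.
move=> d0; pose x := inB (cstar y); pose h := star x * x.
have ph : upos h by exact: upos_starM.
have [r [pr gr rn Hr]] : exists r, [/\ upos r, gen h r, nrm (r * h) <= 1 &
    nrm (x - x * r * h) < d].
  by apply: upos_approx => //; rewrite subrr; exact: upos0.
have rh : r * h = h * r by exact: gen_comm gr (@gen_id _ _ h).
have h0 : h.1 = 0 by rewrite /h scM mulr0.
have E : inB (r * h).2 = r * h by apply: inBK; rewrite scM h0 mulr0.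
exists (r * h).2; split.
- by apply/positiveP; rewrite E; exact: uposM.
- by rewrite -nrm_inB E.
- rewrite -nrm_inB inBB inBM E nrmBC -nrm_star starB starM.
  rewrite (upos_sa (uposM pr ph rh)) inB_star -/x.
  by rewrite -mulrA in Hr.
Qed.

Section CondExp.
Variables (A : set B) (E : {linear B -> B}).
Hypotheses (hA : cstar_subalgebra A) (hE : conditional_expectation A E).
Let EA : forall b, A (E b) := let: And4 h _ _ _ := hE in h.
Let Eid : forall a, A a -> E a = a := let: And4 _ h _ _ := hE in h.
Let Ec : forall b, cnorm (E b) <= cnorm b := let: And4 _ _ h _ := hE in h.
Let Ecp : completely_positive E := let: And4 _ _ _ h := hE in h.

(** The image under E of the Gram matrix of y and e is positive. Its lower
    corner E (e^2) is at most 1, so schur_positive applies. A contraction e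
    stands in for the unit that B may not have. *)
Lemma schwarz_contraction y e : cstar e = e -> cnorm e <= 1 ->
  E (cstar y ** e) = cstar (E (e ** y)) /\
  upos (inB (E (cstar y ** y)) - star (inB (E (e ** y))) * inB (E (e ** y))).
Proof.
move=> se e1; pose r (i : 'I_2) := if i == 0 then y else e.
have [Ms MH] := Ecp (gram_positive r).
have E01 : E (cstar y ** e) = cstar (E (e ** y)).
  by have /matrixP/(_ 0 1) := Ms; rewrite !mxE /r /= se => <-.
split => //.
have ee : cnorm (e ** e) <= 1.
  by rewrite -{1}se cnorm_starM; have := cnorm_ge0 e; nra.
have pee : positive (E (e ** e)) by apply: cp_positive => //; exact: positive_square.
apply: (@schur_positive _ _ _ _ (inB (E (e ** e)))).
- exact/positiveP.
- rewrite -rsc1; apply: upos_rscB; first exact/upos_sa/positiveP.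
  by rewrite nrm_inB; apply: le_trans (Ec _) _.
- by rewrite inB_star positive_sa//; apply: cp_positive => //; exact: positive_starM.
move=> s s0; have l0 : ~~ (0 <= (- s)%:C :> R[i]) by rewrite lecR -ltNge oppr_lt0.
have [W [W1 W2]] := MH _ l0.
have lV : ((- s)%:C)^-1 = - (s^-1)%:C :> R[i].
  by rewrite -fmorphV invrN rmorphN.
have M1 i j := congr1 (fun M : 'M[B]_2 => M i j) W1.
have M2 i j := congr1 (fun M : 'M[B]_2 => M i j) W2.
have o1 : (lift ord0 ord0 : 'I_2) = 1 by apply: val_inj.
have e00 := M1 0 0; have e10 := M1 1 0; have f00 := M2 0 0; have f01 := M2 0 1.
rewrite !mxE !big_ord_recl !big_ord0 !o1 !mxE /r /= !se E01 lV in e00 e10 f00 f01.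
set al := E (cstar y ** y) in e00 e10 f00 f01 *; set be := E (e ** y) in e00 e10 f00 f01 *.
set ga := E (e ** e) in e00 e10 f00 f01 *.
pose w00 := inB (W 0 0); pose w10 := inB (W 1 0); pose w01 := inB (W 0 1).
have sc x : inB (- (s^-1)%:C *: x) = - (rsc s^-1 * inB x).
  by rewrite inBZ scaleNr rscE.
move/(congr1 inB): e00; rewrite !addr0 !inBD !inBM !sc -inB_star -/w00 -/w10 => e00.
move/(congr1 inB): e10; rewrite !addr0 !inBD !inBM !sc -/w00 -/w10 => e10.
move/(congr1 inB): f00; rewrite !addr0 !inBD !inBM !sc -/w00 -/w01 => f00.
move/(congr1 inB): f01; rewrite !addr0 !inBD !inBM !sc -inB_star -/w00 -/w01 => f01.
have ss : rsc s * rsc s^-1 = 1 :> unitization B by rewrite rscMV// gt_eqF.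
have ss' : rsc s^-1 * rsc s = 1 :> unitization B by rewrite -rscM mulVf ?gt_eqF// rsc1.
exists (rsc s^-1 * (1 - w00)), (- (rsc s^-1 * w10)), (- (w01 * rsc s^-1)).
have c (x : unitization B) : x * rsc s^-1 = rsc s^-1 * x by exact: rsc_comm.
split.
- rewrite mulrN !mulrA mulrDl ss !c; apply: subr0_eq.
  transitivity (- (- (rsc s^-1 * inB al) + w00 - (- (rsc s^-1 * inB al) * w00 + - (rsc s^-1 * star (inB be)) * w10))).
    by ncring.
  by rewrite e00 subrr oppr0.
- rewrite mulrN !mulrA mulrDl ss !c; apply: subr0_eq.
  transitivity (- (- (rsc s^-1 * inB be) + w10 - (- (rsc s^-1 * inB be) * w00 + - (rsc s^-1 * inB ga) * w10))).
    by ncring.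
  by rewrite e10 subrr oppr0.
- rewrite -c -mulrA mulrDr ss' mulNr -(mulrA w01); apply: subr0_eq.
  transitivity (- (- (rsc s^-1 * inB al) + w00 - (w00 * - (rsc s^-1 * inB al) + w01 * - (rsc s^-1 * inB be)))).
    by ncring.
  by rewrite f00 subrr oppr0.
- rewrite -c -mulrA mulNr -(mulrA w01) (mulrDr (rsc s^-1)) ss'; apply: subr0_eq.
  transitivity (- (- (rsc s^-1 * star (inB be)) + w01 - (w00 * - (rsc s^-1 * star (inB be)) + w01 * - (rsc s^-1 * inB ga)))).
    by ncring.
  by rewrite f01 subrr oppr0.
Qed.

Lemma condexp_star y : E (cstar y) = cstar (E y).
Proof.
apply: subr0_eq; apply: inB_inj; apply: (@nrm_small _ _ _ 2) => d d0.
have [e [pe e1 ey]] := approx_unit y d0.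
have [E01 _] := schwarz_contraction y (positive_sa pe) e1.
have sey : cstar (e ** y) = cstar y ** e by rewrite cstarM (positive_sa pe).
rewrite nrm_inB.
have -> : E (cstar y) - cstar (E y) =
   E (cstar (y - e ** y)) - cstar (E (y - e ** y)).
  by rewrite cstarB sey !linearB /= cstarB E01 opprB addrA subrK.
apply: le_trans (cnormD _ _) _; rewrite cnormN cnorm_star.
have := Ec (cstar (y - e ** y)); rewrite cnorm_star; have := Ec (y - e ** y).
rewrite -(cnormN (y - _)) opprB; lra.
Qed.

(** Let e run through approximate units in schwarz_contraction. *)
Lemma kadison_schwarz y :
  upos (inB (E (cstar y ** y)) - star (inB (E y)) * inB (E y)).
Proof.
apply: upos_lim => d d0.
have K0 : 0 <= 2 * cnorm y + 1 by have := cnorm_ge0 y; lra.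
have [t [t0 t1 tK]] := exists_small_factor d0 K0.
have [e [pe e1 ey]] := approx_unit y t0.
have [_ P] := schwarz_contraction y (positive_sa pe) e1.
exists (inB (E (cstar y ** y)) - star (inB (E (e ** y))) * inB (E (e ** y))) => //.
set al := inB (E (cstar y ** y)).
have -> : al - star (inB (E y)) * inB (E y) - (al - star (inB (E (e ** y))) * inB (E (e ** y))) =
   - (star (inB (E y)) * inB (E y) - star (inB (E (e ** y))) * inB (E (e ** y))) by ncring.
rewrite nrmN; apply: le_lt_trans (nrm_sqB _ _) _; apply: le_lt_trans tK.
rewrite -inBB !nrm_inB -linearB /=.
have h1 : cnorm (E (y - e ** y)) <= t.
  by apply: le_trans (Ec _) _; rewrite -cnormN opprB ltW.
have h2 := Ec y.
have h3 : cnorm (E (e ** y)) <= cnorm y.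
  apply: le_trans (Ec _) _; apply: le_trans (cnorm_cmul _ _) _.
  by have := cnorm_ge0 y; nra.
have := cnorm_ge0 (E (y - e ** y)); have := cnorm_ge0 (E (e ** y)); have := cnorm_ge0 (E y).
move=> k1 k2 k3; apply: ler_pM => //; lra.
Qed.

(** Let D = E (a^* y) - a^* E y. The Schwarz inequality at t a + y, where E
    fixes a and a^* a, reads t S + K >= 0 with S = D + D^* and K independent of
    the real number t; hence S = 0 by upos_bounded_zero. Replacing y by i y
    gives D = D^*. *)
Lemma condexp_mul a z : A a -> E (a ** z) = a ** E z /\ E (z ** a) = E z ** a.
Proof.
have [[_ _ _] _ AM As] := hA.
have key a' z' : A a' -> E (cstar a' ** z') = cstar a' ** E z'.
  move=> Aa; pose D y := inB (E (cstar a' ** y)) - star (inB a') * inB (E y).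
  have DD y : D y + star (D y) = 0.
    pose K := inB (E (cstar y ** y)) - star (inB (E y)) * inB (E y).
    apply: (@upos_bounded_zero _ _ _ K).
      by rewrite starD starK addrC.
    move=> t; have := kadison_schwarz (t%:C *: a' + y).
    have aa : E (cstar a' ** a') = cstar a' ** a' by apply: Eid; apply: (AM) => //; exact: As.
    have ya : E (cstar y ** a') = cstar (E (cstar a' ** y)).
      by rewrite -condexp_star cstarM cstarK.
    pose T : unitization B := rsc t; have Tc q : q * T = T * q by exact: rsc_comm.
    pose u := inB a'; pose v := inB (E y); pose w := inB (E (cstar a' ** y)).
    pose x := inB (E (cstar y ** y)).
    have -> : inB (E (cstar (t%:C *: a' + y) ** (t%:C *: a' + y))) =
        T * (T * (star u * u)) + T * star w + (T * w + x).
      rewrite cstarD cstarZ conjcR cmulDr !cmulDl !cmulZr !cmulZl !linearD !linearZ /=.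
      by rewrite !linearZ /= aa ya !inBD !inBZ inBM -!inB_star !rscE.
    have -> : inB (E (t%:C *: a' + y)) = T * u + v.
      by rewrite linearD linearZ /= (Eid Aa) inBD inBZ rscE.
    congr (upos _); rewrite (_ : D y = w - star u * v)//.
    rewrite (_ : K = x - star v * v)// starB !starD !starM starK star_rsc -/T Tc.
    apply: subr0_eq.
    transitivity (T * (T * star u - star u * T) * u + (T * star v - star v * T) * u).
      by ncring.
    by rewrite !Tc !subrr mulr0 !mul0r addr0.
  have D0 : D z' = 0.
    have h1 := DD z'; have h2 := DD ('i *: z').
    have Di : D ('i *: z') = 'i *: D z'.
      by rewrite /D cmulZr !linearZ /= !inBZ -scalerAr scalerBr.
    have ci := conjc_i R.
    have i0 : 'i != 0 :> R[i] by rewrite -normr_gt0 normcE cabs_i ltr01.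
    rewrite Di starZ ci scaleNr -scalerBr in h2.
    have h3 : D z' - star (D z') = 0 by apply: (scalerI i0); rewrite scaler0.
    have h4 : rsc 2 * D z' = 0.
      rewrite (_ : 2 = 1 + 1 :> R)// rscD rsc1 mulrDl mul1r -[RHS](addr0 0) -{1}h1 -h3; ncring.
    have := congr1 (fun x : unitization B => rsc 2^-1 * x) h4; rewrite mulr0 mulrA -rscM mulVf// rsc1 mul1r //.
  move: D0 => /subr0_eq; rewrite inB_star -inBM; exact: inB_inj.
move=> Aa; have As' := As _ Aa; split.
  by rewrite -{1}(cstarK a) key// cstarK.
rewrite -[z ** a]cstarK cstarM condexp_star key//.
by rewrite cstarM cstarK -condexp_star cstarK.
Qed.

End CondExp.
End Bimodule.

(** * Elements of A below a given element of B *)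

Section Support.
Context {R : realType} {B : cstarAlgType R}.
Variables (A : set B) (E : {linear B -> B}).
Hypotheses (hA : cstar_subalgebra A) (hE : conditional_expectation A E).
Implicit Types (a b d x : B) (u v y z : unitization B).

Lemma inB_snd_mulm u x v : inB (u * inB x * v).2 = u * inB x * v.
Proof. by apply: inBK; rewrite !scM mulr0 mul0r. Qed.

(** By polarization E (y b z) = 0 for all y and z in the unitization, and the
    set of all such b is a closed ideal inside ker E. *)
Lemma max_kernel_of_compressions b : (forall c : unitization B, E (star c * inB b * c).2 = 0) ->
  max_kernel_ideal E b.
Proof.
have [_ _ Ec _] := hE; move=> H; pose F u := E u.2.
have FD u v : F (u + v) = F u + F v by exact: linearD.
have FZ (l : R[i]) u : F (l *: u) = l *: F u by exact: linearZ.
have HF c : F (star c * inB b * c) = 0 by exact: H.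
have pol y z : F (star y * inB b * z) = 0.
  have sym u v : F (star u * inB b * v) + F (star v * inB b * u) = 0.
    have := HF (u + v); rewrite starD.
    have -> : (star u + star v) * inB b * (u + v) = (star u * inB b * u + star v * inB b * v)
       + (star u * inB b * v + star v * inB b * u) by ncring.
    by rewrite !FD !HF !add0r.
  have h1 := sym y z; have := sym y ('i *: z).
  have ci := conjc_i R.
  have i0 : 'i != 0 :> R[i] by rewrite -normr_gt0 normcE cabs_i ltr01.
  rewrite starZ ci -scalerAr -!scalerAl !FZ scaleNr -scalerBr => h2.
  have {h2} : F (star y * inB b * z) - F (star z * inB b * y) = 0.
    by apply: (scalerI i0); rewrite scaler0.
  move=> /subr0_eq h3; move: h1; rewrite -h3 -mulr2n => /eqP.
  by rewrite -scaler_nat scaler_eq0 pnatr_eq0 /= => /eqP.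
pose M := [set x : B | forall y z, F (y * inB x * z) = 0].
have bM : M b by move=> y z; rewrite -(starK y).
exists M; split => //; last first.
  by move=> x Mx; have := Mx 1 1; rewrite mul1r mulr1.
split => //.
- split.
  + by move=> y z; rewrite inB0 mulr0 mul0r /F linear0.
  + by move=> x x' Mx Mx' y z; rewrite inBD mulrDr mulrDl FD Mx Mx' addr0.
  + by move=> l x Mx y z; rewrite inBZ -scalerAr -scalerAl FZ Mx scaler0.
- apply/closedP => x Hx y z.
  apply: inB_inj; apply: (@nrm_small _ _ _ (nrm y * nrm z)) => e e0.
  have [x' Mx' xx'] := Hx _ e0.
  have -> : F (y * inB x * z) = F (y * inB (x - x') * z).
    by rewrite inBB mulrBr mulrBl FD -scaleN1r FZ Mx' scaler0 addr0.
  rewrite nrm_inB; apply: le_trans (Ec _) _.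
  rewrite -nrm_inB inB_snd_mulm; apply: le_trans (nrmM _ _) _.
  have := nrmM y (inB (x - x')); rewrite nrm_inB.
  have := nrm_ge0 y; have := nrm_ge0 z; have := cnorm_ge0 (x - x').
  move=> p1 p2 p3 p4.
  apply: le_trans (_ : nrm y * cnorm (x - x') * nrm z <= _).
    by rewrite ler_wpM2r.
  by rewrite mulrAC ler_wpM2l ?mulr_ge0// ltW.
- move=> a x _ Mx; split=> y z; rewrite inBM.
    by rewrite mulrA Mx.
  by rewrite mulrA -mulrA Mx.
Qed.

(** If 0 <= a <= d and d q = 0, then q a q = 0, and therefore sqrt a q = 0. *)
Lemma annihilator_hereditary (q : unitization B) : star q = q ->
  hereditary A [set d | [/\ A d, inB d * q = 0 & q * inB d = 0]].
Proof.
move=> sq; have [[A0 AD AZ] /closedP Ac AM As] := hA; split.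
- split.
  + split => /=.
    * by split; rewrite ?inB0 ?mul0r ?mulr0.
    * move=> x y [Ax x1 x2] [Ay y1 y2].
      by split; rewrite ?inBD ?mulrDl ?mulrDr ?x1 ?x2 ?y1 ?y2 ?addr0//; exact: AD.
    * move=> l x [Ax x1 x2].
      by split; rewrite ?inBZ -?scalerAl -?scalerAr ?x1 ?x2 ?scaler0//; exact: AZ.
  + apply/closedP => x Hx; split.
    * by apply: Ac => e /Hx[y [Ay _ _] xy]; exists y.
    * apply: (@nrm_small _ _ _ (nrm q)) => e /Hx[y [_ y1 _] xy].
      have -> : inB x * q = inB (x - y) * q by rewrite inBB mulrBl y1 subr0.
      apply: le_trans (nrmM _ _) _; rewrite nrm_inB mulrC.
      by rewrite ler_wpM2l ?nrm_ge0// ltW.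
    * apply: (@nrm_small _ _ _ (nrm q)) => e /Hx[y [_ _ y1] xy].
      have -> : q * inB x = q * inB (x - y) by rewrite inBB mulrBr y1 subr0.
      apply: le_trans (nrmM _ _) _; rewrite nrm_inB.
      by rewrite ler_wpM2l ?nrm_ge0// ltW.
  + move=> x y [Ax x1 x2] [Ay y1 y2]; split; first exact: AM.
      by rewrite inBM -mulrA y1 mulr0.
    by rewrite inBM mulrA x2 mul0r.
  + move=> x [Ax x1 x2]; split; first exact: As.
      by rewrite -inB_star -{1}sq -starM x2 star0.
    by rewrite -inB_star -{1}sq -starM x1 star0.
- by move=> d [].
- move=> d a [Ad d1 d2] Aa /positiveP pa /positiveP; rewrite inBB => pda.
  have qaq : q * inB a * q = 0.
    apply: upos_anti; first exact: upos_conj_sa.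
    have := upos_conj_sa sq pda; rewrite mulrBr mulrBl d2 mul0r sub0r //.
  have [k [pk kE _]] := upos_sqrt pa; have sk := upos_sa pk.
  have kq : k * q = 0.
    apply: nrm_eq0; apply/eqP; rewrite -sqrf_eq0 -nrm_starM starM sq sk.
    by rewrite -mulrA (mulrA k) kE mulrA qaq nrm0.
  have aq : inB a * q = 0 by rewrite -kE -mulrA kq mulr0.
  split => //; have := congr1 star aq.
  by rewrite starM sq (upos_sa pa) star0.
Qed.

Hypothesis hAB : aperiodic A.

(** Scale c so that a0 = E (c^* b c) has norm 1. In the annihilator D of the
    negative part of a0 - 3/4 one has d a0 d >= (3/4) d^2 for self-adjoint d,
    and D contains the nonzero positive part of a0 - 3/4. Aperiodicity gives d
    of norm 1 in D and y in A such that w = d c^* b c d is at distance less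
    than 1/8 from y. Since E w = x := d a0 d and E y = y, w is within 1/4 of x;
    and norm x >= 3/4. So p2 = (x - 1/2)_+ is nonzero, and p2 w p2 >= p2 (x -
    1/4) p2 >= p2^2 / 4, which puts p2^2 below b. *)
Lemma support_off_kernel b : positive b -> ~ max_kernel_ideal E b ->
  exists a, [/\ A a, positive a, a != 0 & cuntz_le a b].
Proof.
move=> pb Nb; have [EA Eid Ec Ecp] := hE.
have [[A0 AD AZ] Acl AM As] := hA.
have pb' : upos (inB b) by apply/positiveP.
have [c0 Ec0] : exists c : unitization B, E (star c * inB b * c).2 != 0.
  apply: contrapT => H; apply: Nb; apply: max_kernel_of_compressions => c.
  by apply: contrapT => Hc; apply: H; exists c; exact/eqP.
pose t := cnorm (E (star c0 * inB b * c0).2).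
have t0 : 0 < t.
  by rewrite lt_neqAle cnorm_ge0 andbT eq_sym; apply: contra_neq Ec0 => /cnorm_eq0.
have tV : 0 <= t^-1 by rewrite invr_ge0 ltW.
pose c : unitization B := rsc (Num.sqrt t^-1) * c0.
pose b1 := (star c * inB b * c).2; pose a0 := E b1.
have b1E : inB b1 = star c * inB b * c by exact: inB_snd_mulm.
have pb1 : positive b1 by apply/positiveP; rewrite b1E; exact: upos_conj.
have b1t : b1 = (t^-1)%:C *: (star c0 * inB b * c0).2.
  apply: inB_inj; rewrite b1E inBZ inB_snd_mulm /c starM star_rsc -rscE.
  have <- : rsc (Num.sqrt t^-1) * rsc (Num.sqrt t^-1) = rsc t^-1 :> unitization B.
    by rewrite -rscM -expr2 sqr_sqrtr.
  by rewrite rsc_comm -!mulrA; congr (_ * _); rewrite !mulrA rsc_comm !mulrA.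
have a01 : cnorm a0 = 1.
  by rewrite /a0 b1t linearZ /= cnormZ cabs_real ger0_norm// mulVf// gt_eqF.
have Aa0 : A a0 by exact: EA.
have pa0 : upos (inB a0) by apply/positiveP/cp_positive.
pose h : unitization B := inB a0 - rsc (3 / 4).
have sh : star h = h by rewrite starB star_rsc (upos_sa pa0).
have uA := ucs_unitization (And3 A0 AD AZ) Acl AM.
have Ah : A h.2.
  by have := ucsB uA (Aa0 : [set u : unitization B | A u.2] (inB a0)) (ucs_rsc (3 / 4) uA).
have [p [q [pp pq hpq [pq0 qp0] [gp gq]]]] := upos_parts sh.
have sp := upos_sa pp; have sq := upos_sa pq.
have p0 : p.1 = 0.
  apply: (@sc_pos_part _ _ p q (- (3 / 4))) => //.
  by rewrite -hpq -[LHS]/(0 - (rsc (3 / 4) : unitization B).1) sc_rsc sub0r rmorphN.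
have pE : inB p.2 = p by exact: inBK.
have a0E : inB a0 = rsc (3 / 4) + (p - q) by rewrite -hpq /h addrC subrK.
pose D := [set d | [/\ A d, inB d * q = 0 & q * inB d = 0]].
have hD : hereditary A D by exact: annihilator_hereditary.
have nD : nonzero D.
  exists p.2; first by rewrite /D /= pE; split => //; exact: gp uA Ah.
  apply/eqP => p20; have p00 : p = 0 by rewrite -pE p20.
  have : nrm (inB a0) <= 3 / 4.
    apply: upos_le_nrm => //.
    by rewrite a0E p00 sub0r subKr.
  by rewrite nrm_inB a01; lra.
have e8 : 0 < 1 / 8 :> R by rewrite divr_gt0.
have [d [[Ad dq qd] pd d1]] := hAB b1 hD nD e8.
have dd1 : cnorm (d ** d) = 1.
  by rewrite -{1}(positive_sa pd) cnorm_starM d1 expr1n.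
have sd : cstar d = d by exact: positive_sa.
have sid : star (inB d) = inB d by rewrite inB_star sd.
move=> /inf_lt[|_ [y Ay <-] yd].
  by exists (cnorm (d ** b1 ** d - 0)), 0.
pose w := d ** b1 ** d; pose x := d ** a0 ** d.
have Ew : E w = x.
  by rewrite /w (condexp_mul hA hE _ Ad).2 (condexp_mul hA hE _ Ad).1.
have wx : nrm (inB w - inB x) <= 1 / 4.
  have h1 := Ec (w - y); rewrite linearB /= Ew (Eid _ Ay) in h1.
  have := nrm_tri (inB w) (inB y) (inB x); rewrite -!inBB !nrm_inB.
  by rewrite -(cnormN (y - x)) opprB; rewrite -/w in yd; lra.
have Ax : A x by apply: (AM) => //; exact: AM.
have pw : upos (inB w).
  have -> : inB w = star (c * inB d) * inB b * (c * inB d).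
    by rewrite starM sid /w !inBM b1E !mulrA.
  exact: upos_conj.
have px : upos (inB x) by rewrite /x !inBM; exact: upos_conj_sa.
have xn : 3 / 4 <= nrm (inB x).
  have : upos (inB x - rsc (3 / 4) * inB (d ** d)).
    rewrite /x !inBM a0E.
    have -> : inB d * (rsc (3 / 4) + (p - q)) * inB d - rsc (3 / 4) * (inB d * inB d) =
       (inB d * rsc (3 / 4) - rsc (3 / 4) * inB d) * inB d + (inB d * p * inB d) - (inB d * q) * inB d.
      by ncring.
    by rewrite rsc_comm subrr dq mul0r add0r subr0; exact: upos_conj_sa.
  have pdd : upos (rsc (3 / 4) * inB (d ** d)).
    apply: uposZ; first by rewrite divr_ge0.
    by apply/positiveP; exact: positive_square.
  move=> /(upos_mono pdd); rewrite nrm_rscM nrm_inB dd1 mulr1 ger0_norm ?divr_ge0//.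
pose h2 : unitization B := inB x - rsc (1 / 2).
have sh2 : star h2 = h2 by rewrite starB star_rsc (upos_sa px).
have Ah2 : A h2.2.
  by have := ucsB uA (Ax : [set u : unitization B | A u.2] (inB x)) (ucs_rsc (1 / 2) uA).
have [p2 [q2 [pp2 pq2 hpq2 [pq20 qp20] [gp2 gq2]]]] := upos_parts sh2.
have sp2 := upos_sa pp2.
have p20 : p2.1 = 0.
  apply: (@sc_pos_part _ _ p2 q2 (- (1 / 2))) => //.
  by rewrite -hpq2 -[LHS]/(0 - (rsc (1 / 2) : unitization B).1) sc_rsc sub0r rmorphN.
have p2E : inB p2.2 = p2 by exact: inBK.
have xE : inB x = rsc (1 / 2) + (p2 - q2) by rewrite -hpq2 /h2 addrC subrK.
have p2n : p2 != 0.
  apply/eqP => p200; have : nrm (inB x) <= 1 / 2.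
    apply: upos_le_nrm => //.
    by rewrite xE p200 sub0r subKr.
  by lra.
exists (p2.2 ** p2.2); split.
- by apply: (AM); exact: gp2 uA Ah2.
- by apply: positive_square; apply: inB_inj; rewrite -inB_star p2E.
- by apply: contra_neq p2n => H; apply: sq_eq0 => //; rewrite -p2E -inBM H.
apply: (@cuntz_le_of_upos _ _ _ _ (rsc 2 * (c * inB d * p2))) => //.
  by apply: positive_square; apply: inB_inj; rewrite -inB_star p2E.
rewrite inBM p2E.
have -> : star (rsc 2 * (c * inB d * p2)) * inB b * (rsc 2 * (c * inB d * p2)) =
    rsc 4 * (p2 * inB w * p2).
  have sc4 (v z : unitization B) :
      star (rsc 2 * v) * z * (rsc 2 * v) = rsc 4 * (star v * z * v).
    rewrite starM star_rsc (_ : 4 = 2 * 2 :> R); last by ring.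
    rewrite rscM (rsc_comm 2 (star v)) -!mulrA; congr (_ * _).
    by rewrite (mulrA z) (rsc_comm 2 z) -!mulrA [LHS]mulrA (rsc_comm 2 (star v)) -!mulrA.
  rewrite sc4; congr (_ * _); rewrite /w !inBM b1E 2!starM sp2 sid.
  by rewrite !mulrA.
have -> : rsc 4 * (p2 * inB w * p2) - p2 * p2 =
   rsc 4 * (p2 * (rsc (1 / 4) + (inB w - inB x)) * p2 + p2 * p2 * p2).
  have E4 : rsc 4 * rsc (1 / 4) = 1 :> unitization B.
    by rewrite -rscM (_ : 4 * (1 / 4) = 1) ?rsc1//; field.
  have E2 : rsc (1 / 2) = rsc (1 / 4) + rsc (1 / 4) :> unitization B.
    by rewrite -rscD; congr rsc; field.
  have c4 : p2 * rsc (1 / 4) = rsc (1 / 4) * p2 by exact: rsc_comm.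
  rewrite xE E2; apply: subr0_eq.
  transitivity (rsc 4 * (p2 * rsc (1 / 4) - rsc (1 / 4) * p2) * p2 + (rsc 4 * rsc (1 / 4) - 1) * p2 * p2
     - rsc 4 * (p2 * q2) * p2).
    by ncring.
  by rewrite c4 E4 pq20 !subrr !mulr0 !mul0r addr0 subr0.
apply: uposZ => //; apply: uposD; last first.
  by apply: upos_conj_sa.
apply: upos_conj_sa => //; apply: upos_rscD => //.
by rewrite starB (upos_sa pw) (upos_sa px).
Qed.

End Support.

(** * Ideals and quotients *)

Section LinearSpan.
Context {R : realType} {B : cstarAlgType R}.
Implicit Types (S I : set B) (x y : B).

Lemma span_sub S x : S x -> linear_span S x.
Proof.
move=> Sx; exists 1%N, (fun=> 1), (fun=> x); split => //.
by rewrite big_ord1 scale1r.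
Qed.

Lemma span0 S : linear_span S 0.
Proof.
by exists 0%N, (fun=> 0), (fun=> 0); split; [case|rewrite big_ord0].
Qed.

Lemma spanD S x y : linear_span S x -> linear_span S y -> linear_span S (x + y).
Proof.
move=> [n [l [s [Ss ->]]]] [m [k [t [St ->]]]].
exists (n + m)%N, (fun i => match fintype.split i with inl i => l i | inr i => k i end),
  (fun i => match fintype.split i with inl i => s i | inr i => t i end).
split=> [i|]; first by case: fintype.split.
rewrite big_split_ord /=; congr (_ + _); apply: eq_bigr => i _.
  by rewrite (unsplitK (inl i)).
by rewrite (unsplitK (inr i)).
Qed.

Lemma spanZ S (l : R[i]) x : linear_span S x -> linear_span S (l *: x).
Proof.
move=> [n [k [s [Ss ->]]]]; exists n, (fun i => l * k i), s; split => //.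
by rewrite scaler_sumr; apply: eq_bigr => i _; rewrite scalerA.
Qed.

Lemma span_mull S S' a x : (forall y, S y -> S' (a ** y)) ->
  linear_span S x -> linear_span S' (a ** x).
Proof.
move=> H [n [k [s [Ss ->]]]]; exists n, k, (fun i => a ** s i); split=> [i|]; first exact: H.
by rewrite cmul_sumr; apply: eq_bigr => i _; rewrite cmulZr.
Qed.

Lemma span_mulr S S' a x : (forall y, S y -> S' (y ** a)) ->
  linear_span S x -> linear_span S' (x ** a).
Proof.
move=> H [n [k [s [Ss ->]]]]; exists n, k, (fun i => s i ** a); split=> [i|]; first exact: H.
by rewrite cmul_suml; apply: eq_bigr => i _; rewrite cmulZl.
Qed.

Lemma span_in_subspace S I x : Defs.subspace I -> S `<=` I -> linear_span S x -> I x.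
Proof.
move=> [I0 ID IZ] SI [n [l [s [Ss ->]]]].
by apply: big_ind => // i _; apply: IZ; exact: SI.
Qed.

Lemma closure_ideal S : Defs.subspace S ->
  (forall a x, S x -> S (a ** x) /\ S (x ** a)) -> ideal setT (closure S).
Proof.
move=> [S0 SD SZ] SM; split => //.
- split.
  + exact: subset_closure.
  + move=> x y /closureP Sx /closureP Sy; apply/closureP => e e0.
    have e2 : 0 < e / 2 by rewrite divr_gt0.
    have [x' Sx' xx'] := Sx _ e2; have [y' Sy' yy'] := Sy _ e2.
    exists (x' + y'); first exact: SD.
    by rewrite opprD addrACA; apply: le_lt_trans (cnormD _ _) _; lra.
  + move=> l x /closureP Sx; apply/closureP => e e0.
    have [d [d0 _ dK]] := exists_small_factor e0 (cabs_ge0 l).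
    have [x' Sx' xx'] := Sx _ d0.
    exists (l *: x'); first exact: SZ.
    rewrite -scalerBr cnormZ; apply: le_lt_trans dK; rewrite mulrC.
    by rewrite ler_wpM2r ?cabs_ge0// ltW.
- exact: closed_closure.
- move=> a x _ /closureP Sx; split; apply/closureP => e e0;
    have [d [d0 _ dK]] := exists_small_factor e0 (cnorm_ge0 a); have [x' Sx' xx'] := Sx _ d0.
    exists (a ** x'); first by have [] := SM a x' Sx'.
    rewrite -cmulBr; apply: le_lt_trans (cnorm_cmul _ _) _; apply: le_lt_trans dK.
    by rewrite mulrC ler_wpM2r ?cnorm_ge0// ltW.
  exists (x' ** a); first by have [] := SM a x' Sx'.
  rewrite -cmulBl; apply: le_lt_trans (cnorm_cmul _ _) _; apply: le_lt_trans dK.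
  by rewrite ler_wpM2r ?cnorm_ge0// ltW.
Qed.

Definition two_sided I : set B := [set z | exists b i b' : B, I i /\ z = b ** i ** b'].

Lemma closure_span_ideal I : ideal setT (closure (linear_span (two_sided I))).
Proof.
apply: closure_ideal; first by split; [exact: span0|exact: spanD|exact: spanZ].
move=> a x Sx; split.
  apply: span_mull Sx => _ [b [i [b' [Ii ->]]]].
  by exists (a ** b), i, b'; rewrite !cmulA.
apply: span_mulr Sx => _ [b [i [b' [Ii ->]]]].
by exists b, i, (b' ** a); rewrite !cmulA.
Qed.

End LinearSpan.

Section Quotient.
Context {R : realType} {B Q : cstarAlgType R}.
Variables (J : set B) (pi : {linear B -> Q}).
Hypotheses (iJ : ideal setT J) (hpi : is_quotient J pi).

Lemma quotient_norm_le x y : J y -> quotient_norm J x <= cnorm (x - y).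
Proof.
move=> Jy; apply: ge_inf; last by exists y.
by exists 0 => _ [z _ <-]; exact: cnorm_ge0.
Qed.

Lemma pi_contractive x : cnorm (pi x) <= cnorm x.
Proof.
have [_ [J0 _ _] _ _] := iJ; have [_ _ _ _ ->] := hpi.
by have := quotient_norm_le x J0; rewrite subr0.
Qed.

Lemma quotient_norm_approx x (e : R) : cnorm (pi x) < e -> exists2 y, J y & cnorm (x - y) < e.
Proof.
have [_ [J0 _ _] _ _] := iJ; have [_ _ _ _ ->] := hpi.
move=> /inf_lt[|_ [y Jy <-] xy]; first by exists (cnorm (x - 0)), 0.
by exists y.
Qed.

Lemma pi_positive a : positive a -> positive (pi a).
Proof.
have [piM pis _ _ _] := hpi.
move=> pa; have [k [pk <-]] := positive_sqrt pa.
by rewrite piM; apply: positive_square; rewrite -pis positive_sa.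
Qed.

(** Lift a square root of q to x, and take x^* x. *)
Lemma pi_lift_positive q : positive q -> exists2 b, positive b & pi b = q.
Proof.
have [piM pis piS _ _] := hpi.
move=> pq; have [k [pk <-]] := positive_sqrt pq.
have [x xk] := piS k; exists (cstar x ** x); first exact: positive_starM.
by rewrite piM pis xk (positive_sa pk).
Qed.

Lemma pi_cuntz a b : cuntz_le a b -> cuntz_le (pi a) (pi b).
Proof.
have [piM pis _ _ _] := hpi.
move=> H e /H[x Hx]; exists (pi x); rewrite -pis -!piM -linearB /=.
exact: le_lt_trans (pi_contractive _) Hx.
Qed.

End Quotient.

Section IdealDetection.
Context {R : realType} {B : cstarAlgType R}.
Variables (A : set B) (E : {linear B -> B}).
Hypotheses (hA : cstar_subalgebra A) (hA0 : nonzero A) (hAB : aperiodic A).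
Hypothesis hE : conditional_expectation A E.
Let N := max_kernel_ideal E.

Let iN : ideal setT N. Proof. by have [] := max_kernel_ideal_largest hE. Qed.

Let NA0 a : A a -> N a -> a = 0.
Proof.
have [_ NE _] := max_kernel_ideal_largest hE; have [_ Eid _ _] := hE.
by move=> Aa /NE; rewrite Eid.
Qed.

Lemma supports_quotient (Q : cstarAlgType R) (pi : {linear B -> Q}) :
  is_quotient N pi -> supports (pi @` A).
Proof.
move=> hpi; have [_ _ _ pi0 _] := hpi => q pq q0.
have [b pb bq] := pi_lift_positive hpi pq.
have Nb : ~ N b by move=> /pi0; rewrite bq => q00; rewrite q00 eqxx in q0.
have [a [Aa pa a0 ab]] := support_off_kernel hA hE hAB pb Nb.
exists (pi a); split.
- by exists a.
- exact: pi_positive hpi _ pa.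
- by apply: contra_neq a0 => /pi0; exact: NA0.
- by rewrite -bq; exact: pi_cuntz iN hpi _ _ ab.
Qed.

Lemma detects_quotient (Q : cstarAlgType R) (pi : {linear B -> Q}) :
  is_quotient N pi -> detects_ideals_in_quotient A pi.
Proof.
move=> hpi; have [_ _ _ pi0 _] := hpi; have [[_ AD AZ] _ _ _] := hA; split.
  move=> x y Ax Ay xy; apply: subr0_eq; apply: NA0.
    by apply: (AD) => //; rewrite -scaleN1r; exact: AZ.
  by apply/pi0; rewrite linearB /= xy subrr.
move=> J iJ [x Jx x0]; have [_ _ _ JM] := iJ.
have [a [Aa pa a0 ax]] := supports_quotient hpi (positive_starM x) (starM_neq0 x0).
exists a => //; split => //; apply: ideal_cuntz ax => //.
exact: (JM _ _ I Jx).1.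
Qed.

(** An element of J outside N would dominate a nonzero element of J `&` A; so J
    is contained in N. Then the image of N in the quotient is closed; if it
    were nonzero, it would contain the image of a nonzero a in A, and a would
    lie in N + J = N, which meets A in 0 only. *)
Lemma quotient_unique (J : set B) (Q : cstarAlgType R) (pi : {linear B -> Q}) :
  ideal setT J -> is_quotient J pi -> detects_ideals_in_quotient A pi -> J = N.
Proof.
move=> iJ hpi [inj det]; have [piM pis piS pi0 _] := hpi.
have [_ [N0 ND NZ] /closedP Nc NM] := iN; have [_ [J0 JD JZ] _ JM] := iJ.
have [[A0 _ _] _ _ _] := hA.
have JN x : J x -> N x.
  move=> Jx; apply: ideal_star_mul => //; apply: contrapT => Nxx.
  have [a [Aa pa a0 ax]] := support_off_kernel hA hE hAB (positive_starM x) Nxx.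
  have Ja : J a by apply: ideal_cuntz ax => //; exact: (JM _ _ I Jx).1.
  by move: a0; rewrite (inj a 0) ?eqxx// linear0; exact/pi0.
apply/seteqP; split => // n Nn; apply/pi0; apply: contrapT => /eqP pn.
have iK : ideal setT (pi @` N).
  split => //.
  - split.
    + by exists 0 => //; rewrite linear0.
    + by move=> _ _ [x Nx <-] [y Ny <-]; exists (x + y); [exact: ND|rewrite linearD].
    + by move=> l _ [x Nx <-]; exists (l *: x); [exact: NZ|rewrite linearZ].
  - apply/closedP => y Hy; have [x xy] := piS y; exists x => //.
    apply: Nc => e e0; have [_ [m Nm <-]] := Hy _ e0; rewrite -xy -linearB /=.
    move=> /(quotient_norm_approx iJ hpi)[j Jj xmj].
    exists (m + j); first by apply: ND => //; exact: JN.
    by rewrite opprD addrA.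
  - move=> q _ _ [x Nx <-]; have [y <-] := piS q.
    by split; [exists (y ** x)|exists (x ** y)]; rewrite ?piM//; have [] := NM y x I Nx.
have [|_ [[m Nm <-] [a Aa am]] z0] := det _ iK; first by exists (pi n) => //; exists n.
have Na : N a.
  rewrite -[a](subrK m); apply: (ND) => //; apply: JN; apply/pi0.
  by rewrite linearB /= am subrr.
by move: z0; rewrite -am (NA0 Aa Na) linear0 eqxx.
Qed.

Lemma simple_max_kernel : simple B -> N = [set 0].
Proof.
move=> [_ /(_ _ iN)[//|NT]]; have [a Aa /eqP[]] := hA0.
by apply: NA0 => //; rewrite NT.
Qed.

(** If B is simple and k != 0 lies in K, the ideal generated by K contains k^*
    k k^* k, which is not 0. Conversely, a nonzero ideal J contains a nonzero
    element of A by support_off_kernel, so B (J `&` A) B is dense and contained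
    in J. *)
Lemma simple_iff : simple B <->
  N = [set 0] /\
  (forall I : set B, ideal A I -> nonzero I ->
     closure (linear_span (two_sided I)) = setT).
Proof.
have [[A0 _ _] Ac AM As] := hA.
split=> [sB|[N0 H]].
  split; first exact: simple_max_kernel.
  move=> K iK [k Kk k0]; have [_ /(_ _ (closure_span_ideal K))[]//] := sB.
  move=> K0; have : closure (linear_span (two_sided K)) (cstar k ** k ** (cstar k ** k)).
    apply: subset_closure; apply: span_sub.
    by exists (cstar k), k, (cstar k ** k).
  rewrite K0 => /eqP; have kk0 := starM_neq0 k0.
  have skk : cstar (cstar k ** k) = cstar k ** k by rewrite cstarM cstarK.
  by have /negbTE := starM_neq0 kk0; rewrite skk => ->.
split; first by have [a _ a0] := hA0; exists a.
move=> J iJ; have [_ [J0 JD JZ] Jc JM] := iJ.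
have [J00|/existsNP] := pselect (J `<=` [set 0]); last first.
  move=> [x /not_implyP[Jx /eqP x0]]; right.
  have Nxx : ~ N (cstar x ** x) by rewrite N0 => /eqP; rewrite (negbTE (starM_neq0 x0)).
  have [a [Aa pa a0 ax]] := support_off_kernel hA hE hAB (positive_starM x) Nxx.
  have Ja : J a by apply: ideal_cuntz ax => //; exact: (JM _ _ I Jx).1.
  have iI : ideal A (J `&` A).
    have [[_ AD AZ] _ _ _] := hA; split.
    - by move=> y [].
    - split => //.
      + by move=> y z [Jy Ay] [Jz Az]; split; [exact: JD|exact: AD].
      + by move=> l y [Jy Ay]; split; [exact: JZ|exact: AZ].
    - exact: closedI.
    - move=> c y Ac' [Jy Ay]; have [] := JM c y I Jy.
      by split; split => //; exact: AM.
  rewrite -subTset -(H _ iI); last by exists a.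
  rewrite [X in _ `<=` X](closure_id J).1//; apply: closure_subset.
  move=> y; apply: span_in_subspace; first by split.
  move=> _ [b [i [b' [[Ji _] ->]]]].
  exact: (JM _ _ I (JM _ _ I Ji).1).2.
by left; apply/seteqP; split => // _ ->.
Qed.

End IdealDetection.

(** * Orthogonal pairs below an infinite element *)

Section Pairs.
Context {R : realType} {B : cstarAlgType R}.
Implicit Types (a b c d p x y : B) (m n q u v : unitization B).

(** The elements x = a c and y = a d are almost orthogonal, with x^* x and y^*
    y close to n and m. The definition of infinite elements is the case n = a
    and m = b for some b != 0. *)
Definition approx_pair a n m := forall e : R, 0 < e -> exists c d,
  [/\ nrm (star (inB (a ** c)) * inB (a ** c) - n) < e,
      nrm (star (inB (a ** d)) * inB (a ** d) - m) < e &
      nrm (star (inB (a ** c)) * inB (a ** d)) < e].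

Lemma infiniteP a : infinite a <-> [/\ positive a, a != 0 &
  exists b, [/\ positive b, b != 0 & approx_pair a (inB a) (inB b)]].
Proof.
split=> -[pa a0 [b [pb b0 H]]]; split => //; exists b; split => // e e0.
  have [_ [_ [[c ->] [d ->] h1 h2 h3]]] := H e e0; exists c, d.
  by rewrite !inB_star -!inBM -!inBB !nrm_inB.
have [c [d [h1 h2 h3]]] := H e e0; exists (a ** c), (a ** d); split.
- by exists c.
- by exists d.
- by rewrite -nrm_inB inBB inBM -inB_star.
- by rewrite -nrm_inB inBB inBM -inB_star.
- by rewrite -nrm_inB inBM -inB_star.
Qed.

Lemma nrm_starM3 u v q : nrm (star u * v * q) <= nrm u * nrm v * nrm q.
Proof.
apply: le_trans (nrmM _ _) _; rewrite ler_wpM2r ?nrm_ge0//.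
by have := nrmM (star u) v; rewrite nrm_star.
Qed.

Lemma inB_snd_mulr x u : inB (inB x * u).2 = inB x * u.
Proof. by apply: inBK; rewrite scM mul0r. Qed.

Lemma approx_pair_compress a n m q : approx_pair a n m ->
  approx_pair a n (star q * m * q).
Proof.
move=> H e e0; pose K := 1 + nrm q + nrm q * nrm q.
have q0 := nrm_ge0 q.
have K0 : 0 <= K by rewrite /K; nra.
have [t [t0 t1 tK]] := exists_small_factor e0 K0.
have tqq : t * (nrm q * nrm q) < e by apply: le_lt_trans tK; rewrite ler_wpM2l ?(ltW t0)// /K; nra.
have tq : t * nrm q < e by apply: le_lt_trans tK; rewrite ler_wpM2l ?(ltW t0)// /K; nra.
have te : t < e by apply: le_lt_trans tK; apply: ler_peMr; [exact: ltW|rewrite /K; nra].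
have [c [d [h1 h2 h3]]] := H t t0.
exists c, (inB d * q).2; rewrite [inB (a ** (_).2)]inBM inB_snd_mulr mulrA -inBM; split.
- exact: lt_trans te.
- have -> : star (inB (a ** d) * q) * (inB (a ** d) * q) - star q * m * q =
     star q * (star (inB (a ** d)) * inB (a ** d) - m) * q by rewrite starM; ncring.
  apply: le_lt_trans (nrm_starM3 _ _ _) _; apply: le_lt_trans tqq.
  by rewrite mulrAC [X in X <= _]mulrC ler_wpM2r ?mulr_ge0// ltW.
- rewrite mulrA; apply: le_lt_trans (nrmM _ _) _; apply: le_lt_trans tq.
  by rewrite ler_wpM2r// ltW.
Qed.

Lemma approx_pair_lim a n m : (forall e : R, 0 < e -> exists2 m', approx_pair a n m' &
  nrm (m - m') < e) -> approx_pair a n m.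
Proof.
move=> H e e0; have e2 : 0 < e / 2 by rewrite divr_gt0.
have [m' Hm' mm'] := H _ e2; have [c [d [h1 h2 h3]]] := Hm' _ e2.
exists c, d; split; [by lra| |by lra].
have := nrm_tri (star (inB (a ** d)) * inB (a ** d)) m' m; rewrite (nrmBC m'); lra.
Qed.

(** Let (X, Y) be close to a pair for (a, m1) and (X2, Y2) to one for (n, m2).
    Since X^* X is close to a, multiplication by X on the left transports the
    second pair below the first component: X2 and Y2 become X C and X D, with C
    = sqrt a c2 and D = sqrt a d2. Both are almost orthogonal to Y, so X C and
    Y + X D are a pair for (n, m1 + m2). *)
Lemma approx_pair_sum a n m1 m2 : positive a -> approx_pair a (inB a) m1 ->
  approx_pair a n m2 -> approx_pair a n (m1 + m2).
Proof.
move=> /positiveP pa H1 H2 e e0; have e2 : 0 < e / 2 by rewrite divr_gt0.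
have [k [pk kE _]] := upos_sqrt pa; have sk := upos_sa pk.
have [c2 [d2 [h1 h2 h3]]] := H2 _ e2.
pose C := k * inB c2; pose D := k * inB d2.
have C0 := nrm_ge0 C; have D0 := nrm_ge0 D.
pose K := 1 + nrm C + nrm D; have K1 : 0 <= K * K by rewrite mulr_ge0// /K; lra.
have [t [t0 t1 tK]] := exists_small_factor e2 K1.
have [c1 [d1 [g1 g2 g3]]] := H1 _ t0.
pose X := inB (a ** c1); pose Y := inB (a ** d1).
rewrite -/X -/Y in g1 g2 g3.
pose X2 := inB (a ** c2); pose Y2 := inB (a ** d2).
rewrite -/X2 -/Y2 in h1 h2 h3.
have EC : star C * inB a * C = star X2 * X2.
  rewrite /C /X2 inBM !starM sk (upos_sa pa) -kE !mulrA //.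
have ED : star D * inB a * D = star Y2 * Y2.
  rewrite /D /Y2 inBM !starM sk (upos_sa pa) -kE !mulrA //.
have ECD : star C * inB a * D = star X2 * Y2.
  rewrite /C /D /X2 /Y2 inBM !starM sk (upos_sa pa) [inB (a ** d2)]inBM -kE !mulrA //.
exists (inB c1 * C).2, (d1 + (inB c1 * D).2).
have -> : inB (a ** (inB c1 * C).2) = X * C.
  by rewrite inBM inB_snd_mulr mulrA -inBM.
have -> : inB (a ** (d1 + (inB c1 * D).2)) = Y + X * D.
  by rewrite cmulDr inBD (inBM a (inB c1 * D).2) inB_snd_mulr mulrA -inBM.
clearbody X Y X2 Y2 C D.
have Bnd u v : nrm (star u * (star X * X - inB a) * v) <= nrm u * t * nrm v.
  apply: le_trans (nrm_starM3 _ _ _) _.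
  by rewrite ler_wpM2r ?nrm_ge0// ler_wpM2l ?nrm_ge0// ltW.
split.
- have -> : star (X * C) * (X * C) - n =
     star C * (star X * X - inB a) * C + (star X2 * X2 - n).
    by rewrite -EC starM; ncring.
  apply: le_lt_trans (nrmD _ _) _.
  have : nrm C * t * nrm C <= t * (K * K).
    have -> : nrm C * t * nrm C = t * (nrm C * nrm C) by ring.
    by rewrite ler_wpM2l ?(ltW t0)// /K; nra.
  have := Bnd C C; lra.
- have -> : star (Y + X * D) * (Y + X * D) - (m1 + m2) =
     (star Y * Y - m1) + (star (star X * Y) * D + star D * (star X * Y)) +
     star D * (star X * X - inB a) * D + (star Y2 * Y2 - m2).
    by rewrite -ED !starM starK starD starM; ncring.
  have A1 := nrmM (star (star X * Y)) D; have A2 := nrmM (star D) (star X * Y).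
  rewrite !nrm_star in A1 A2.
  have A3 := nrmD (star (star X * Y) * D) (star D * (star X * Y)).
  have A4 := nrmD (star Y * Y - m1) (star (star X * Y) * D + star D * (star X * Y)).
  have A5 := nrmD ((star Y * Y - m1) + (star (star X * Y) * D + star D * (star X * Y)))
    (star D * (star X * X - inB a) * D).
  have A6 := nrmD ((star Y * Y - m1) + (star (star X * Y) * D + star D * (star X * Y)) +
    (star D * (star X * X - inB a) * D)) (star Y2 * Y2 - m2).
  have B1 : nrm (star X * Y) * nrm D <= t * nrm D by rewrite ler_wpM2r// ltW.
  have B3 : t + (t * nrm D + t * nrm D) + nrm D * t * nrm D <= t * (K * K).
    have -> : t + (t * nrm D + t * nrm D) + nrm D * t * nrm D = t * ((1 + nrm D) * (1 + nrm D)) by ring.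
    by rewrite ler_wpM2l ?(ltW t0)// /K; nra.
  have B4 := Bnd D D; rewrite mulrC in A2; lra.
- have -> : star (X * C) * (Y + X * D) = star C * (star X * Y) +
     star C * (star X * X - inB a) * D + star X2 * Y2.
    by rewrite -ECD starM; ncring.
  have A1 := nrmM (star C) (star X * Y); rewrite nrm_star in A1.
  have A2 := nrmD (star C * (star X * Y)) (star C * (star X * X - inB a) * D).
  have A3 := nrmD (star C * (star X * Y) + star C * (star X * X - inB a) * D) (star X2 * Y2).
  have B1 : nrm C * nrm (star X * Y) <= nrm C * t by rewrite ler_wpM2l// ltW.
  have B3 : nrm C * t + nrm C * t * nrm D <= t * (K * K).
    have -> : nrm C * t + nrm C * t * nrm D = t * (nrm C * (1 + nrm D)) by ring.
    by rewrite ler_wpM2l ?(ltW t0)// /K; nra.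
  have B4 := Bnd C D; lra.
Qed.

Lemma approx_pair_cuntz a n b c : approx_pair a n (inB b) -> cuntz_le c b ->
  approx_pair a n (inB c).
Proof.
move=> H cb; apply: approx_pair_lim => e /cb[x Hx].
exists (inB (cstar x ** b ** x)); last by rewrite -inBB nrm_inB.
by rewrite !inBM -inB_star; exact: approx_pair_compress.
Qed.

(** The elements u such that (a, u^* u) is a pair form a closed ideal: sums
    come from approx_pair_sum, as (u + v)^* (u + v) is at most 4 u^* u + 4 v^*
    v. It contains sqrt b for the element b given by infiniteness, so it is all
    of B. *)
Lemma approx_pair_starM a x : simple B -> infinite a ->
  approx_pair a (inB a) (inB (cstar x ** x)).
Proof.
move=> [_ sB] /infiniteP[pa a0 [b [pb b0 Hb]]].
pose J := [set u : B | approx_pair a (inB a) (inB (cstar u ** u))].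
have JR (u : B) (q : unitization B) : J u -> J (inB u * q).2.
  rewrite /J /= inBM -inB_star => Hu.
  by rewrite inBM -inB_star inB_snd_mulr starM -mulrA (mulrA (star (inB u))) mulrA;
    exact: approx_pair_compress.
have JZ (l : R[i]) (u : B) : J u -> J (l *: u).
  move=> /(JR _ (l *: 1)); rewrite -scalerAr mulr1; exact.
have JD (u v : B) : J u -> J v -> J (u + v).
  move=> Ju Jv.
  have H := approx_pair_sum pa (JZ (rsc (U := unitization B) 2).1 _ Ju) (JZ (rsc (U := unitization B) 2).1 _ Jv).
  rewrite sc_rsc -inBD in H; apply: approx_pair_cuntz H _.
  apply: (@cuntz_le_of_upos _ _ _ _ 1); first exact: positive_starM.
    by apply: positiveD; exact: positive_starM.
  rewrite star1 mul1r mulr1 !(inBD, inBM, inBZ, =^~ inB_star) -!rscE !starM !starD star_rsc.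
  set x1 := inB u; set x2 := inB v.
  have c2 (y : unitization B) : y * rsc 2 = rsc 2 * y by exact: rsc_comm.
  have -> : star x1 * rsc 2 * (rsc 2 * x1) + star x2 * rsc 2 * (rsc 2 * x2) -
     (star x1 + star x2) * (x1 + x2) = star (x1 - x2) * (x1 - x2) + rsc 2 * (star x1 * x1)
       + rsc 2 * (star x2 * x2).
    rewrite !c2 starB (_ : 2 = 1 + 1 :> R)// rscD rsc1; ncring.
  by apply: uposD; [apply: uposD|]; rewrite ?uposZ//; try exact: upos_starM;
    apply: uposZ => //; exact: upos_starM.
have iJ : ideal setT J.
  split => //.
  - split => //.
    rewrite /J /= cmul0 => e e0; have [c [d [h1 h2 h3]]] := Hb _ e0.
    exists c, 0; rewrite cmul0 inB0 !mulr0 subr0 nrm0; split => //.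
  - apply/closedP => u Hu; apply: approx_pair_lim => e e0.
    have K0 : 0 <= 2 * cnorm u + 1 by have := cnorm_ge0 u; lra.
    have [t [t0 t1 tK]] := exists_small_factor e0 K0.
    have [u' Ju' uu'] := Hu _ t0; exists (inB (cstar u' ** u')) => //.
    rewrite !inBM -!inB_star; apply: le_lt_trans (nrm_sqB _ _) _.
    apply: le_lt_trans tK; rewrite -inBB !nrm_inB.
    have := cnormD (u - u') (- u); rewrite addrAC subrr sub0r !cnormN => h.
    by apply: ler_pM; rewrite ?cnorm_ge0 ?addr_ge0 ?cnorm_ge0 ?(ltW uu')//; lra.
  - move=> v u _ Ju; split; last by have := JR u (inB v) Ju; rewrite -inBM.
    have := @approx_pair_compress a _ _ (rsc (cnorm v)) Ju.
    have -> : star (rsc (cnorm v)) * inB (cstar u ** u) * rsc (cnorm v) =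
       inB ((cnorm v ^+ 2)%:C *: (cstar u ** u)).
      by rewrite star_rsc -mulrA rsc_comm mulrA -rscM inBZ -rscE expr2.
    move=> H; apply: approx_pair_cuntz H _.
    have P : upos (inB ((cnorm v ^+ 2)%:C *: (cstar u ** u))).
      by rewrite inBZ -rscE; apply: uposZ; rewrite ?sqr_ge0 // inBM -inB_star; exact: upos_starM.
    apply: (@cuntz_le_of_upos _ _ _ _ 1); [exact: positive_starM|exact/positiveP|].
    rewrite star1 mul1r mulr1 inBZ -rscE !cstarM !inBM -!inB_star.
    have -> : rsc (cnorm v ^+ 2) * (star (inB u) * inB u) - star (inB u) * star (inB v) * (inB v * inB u) =
       star (inB u) * (rsc (cnorm v ^+ 2) - star (inB v) * inB v) * inB u.
      rewrite mulrBr mulrBl rsc_comm; ncring.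
    apply: upos_conj; apply: upos_rscB; first by rewrite starM starK.
    by rewrite nrm_starM nrm_inB.
have [k [pk kE]] := positive_sqrt pb.
have Jk : J k by rewrite /J /= (positive_sa pk) kE.
have k0 : k != 0 by apply: contra_neq b0 => k0; rewrite -kE k0 cmul0.
have [J0|JT] := sB J iJ; first by move: k0; rewrite J0 in Jk; rewrite Jk eqxx.
by have : J x by rewrite JT.
Qed.

(** Combine the pairs for (a, m) and (n, 0) by approx_pair_sum. *)
Lemma approx_pair_all a (n m : B) : simple B -> infinite a -> positive n -> positive m ->
  approx_pair a (inB n) (inB m).
Proof.
move=> sB ia pn pm; have /infiniteP[pa _ _] := ia.
have sq c : positive c -> approx_pair a (inB a) (inB c).
  move=> pc; have [k [pk <-]] := positive_sqrt pc.
  by rewrite -{1}(positive_sa pk); exact: approx_pair_starM.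
have n0 : approx_pair a (inB n) 0.
  move=> e e0; have [c [d [h1 h2 h3]]] := sq _ pn e e0; exists d, 0.
  by rewrite cmul0 inB0 !mulr0 subr0 nrm0.
by have := approx_pair_sum pa (sq _ pm) n0; rewrite addr0.
Qed.

End Pairs.

(** * Infinite projections *)

Section Projections.
Context {R : realType} {B : cstarAlgType R}.
Implicit Types (a b c d p x y : B) (n m q u v : unitization B) (D : set B).

Lemma cuntz_trans a b c : cuntz_le a b -> cuntz_le b c -> cuntz_le a c.
Proof.
move=> ab bc e e0; have e2 : 0 < e / 2 by rewrite divr_gt0.
have [x Hx] := ab _ e2.
have K0 : 0 <= cnorm x * cnorm x by rewrite mulr_ge0// cnorm_ge0.
have [t [t0 t1 tK]] := exists_small_factor e2 K0.
have [y Hy] := bc _ t0; exists (y ** x).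
have -> : a - cstar (y ** x) ** c ** (y ** x) =
   (a - cstar x ** b ** x) + cstar x ** (b - cstar y ** c ** y) ** x.
  by rewrite cstarM cmulBr cmulBl !cmulA addrA subrK.
apply: le_lt_trans (cnormD _ _) _.
have A1 := cnorm_cmul (cstar x ** (b - cstar y ** c ** y)) x.
have A2 := cnorm_cmul (cstar x) (b - cstar y ** c ** y).
rewrite cnorm_star in A2; have x0 := cnorm_ge0 x.
have A3 : cnorm (cstar x ** (b - cstar y ** c ** y)) <= cnorm x * t.
  by apply: le_trans A2 _; rewrite ler_wpM2l// ltW.
have : cnorm (cstar x ** (b - cstar y ** c ** y)) * cnorm x <= cnorm x * t * cnorm x.
  by rewrite ler_wpM2r.
have -> : cnorm x * t * cnorm x = t * (cnorm x * cnorm x) by ring.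
lra.
Qed.

(** If t^* p t is close to a, then p t sqrt a c has nearly the same inner
    products as a c, because (p t)^* (p t) = t^* p t. *)
Lemma approx_pair_transport a p n m : positive a -> projection p ->
  cuntz_le a p -> approx_pair a n m -> approx_pair p n m.
Proof.
move=> /positiveP pa [sp pp] ap H e e0; have e2 : 0 < e / 2 by rewrite divr_gt0.
have [k [pk kE _]] := upos_sqrt pa; have sk := upos_sa pk.
have [c [d [h1 h2 h3]]] := H _ e2.
pose C := k * inB c; pose D := k * inB d.
pose X := inB (a ** c); pose Y := inB (a ** d).
rewrite -/X -/Y in h1 h2 h3.
have EC : star C * inB a * C = star X * X.
  by rewrite /C /X inBM !starM sk (upos_sa pa) -kE !mulrA.
have ED : star D * inB a * D = star Y * Y.
  by rewrite /D /Y inBM !starM sk (upos_sa pa) -kE !mulrA.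
have ECD : star C * inB a * D = star X * Y.
  by rewrite /C /D /X /Y inBM !starM sk (upos_sa pa) [inB (a ** d)]inBM -kE !mulrA.
pose K := nrm C + nrm D.
have C0 := nrm_ge0 C; have D0 := nrm_ge0 D.
have K1 : 0 <= K * K by rewrite mulr_ge0// addr_ge0.
have [s [s0 s1 sK]] := exists_small_factor e2 K1.
have [t Ht] := ap _ s0.
have pt (c' : B) : inB (p ** (inB t * (k * inB c')).2) = inB (p ** t) * (k * inB c').
  rewrite inBM inB_snd_mulr inBM mulrA //.
have st : star (inB (p ** t)) * inB (p ** t) = inB (cstar t ** p ** t).
  by rewrite inB_star -inBM cstarM sp -cmulA (cmulA p) pp cmulA.
exists (inB t * C).2, (inB t * D).2; rewrite !pt -/C -/D.
rewrite -!nrm_inB inBB in Ht.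
clearbody C D X Y.
have Bnd u v : nrm (star u * (inB a - inB (cstar t ** p ** t)) * v) <= nrm u * s * nrm v.
  apply: le_trans (nrm_starM3 _ _ _) _.
  by rewrite ler_wpM2r ?nrm_ge0// ler_wpM2l ?nrm_ge0// ltW.
have bb u v : nrm u <= nrm C + nrm D -> nrm v <= nrm C + nrm D ->
    nrm u * s * nrm v <= s * (K * K).
  move=> uK vK; have -> : nrm u * s * nrm v = s * (nrm u * nrm v) by ring.
  by rewrite ler_wpM2l ?(ltW s0)// ler_pM ?nrm_ge0.
have CK : nrm C <= nrm C + nrm D by lra.
have DK : nrm D <= nrm C + nrm D by lra.
have gen u v w : star u * inB a * v = w ->
   star (inB (p ** t) * u) * (inB (p ** t) * v) = w - star u * (inB a - inB (cstar t ** p ** t)) * v.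
  by move=> <-; rewrite starM -st; ncring.
split.
- rewrite (gen _ _ _ EC) addrAC; apply: le_lt_trans (nrmB _ _) _.
  have := Bnd C C; have := bb C C CK CK; lra.
- rewrite (gen _ _ _ ED) addrAC; apply: le_lt_trans (nrmB _ _) _.
  have := Bnd D D; have := bb D D DK DK; lra.
- rewrite (gen _ _ _ ECD); apply: le_lt_trans (nrmB _ _) _.
  have := Bnd C D; have := bb C D CK DK; lra.
Qed.

Definition right_closure a : set B := closure [set a ** c | c in [set: B]].

Lemma approx_pair_closure a p n m : right_closure a p ->
  approx_pair p n m -> approx_pair a n m.
Proof.
move=> /closureP ap H e e0; have e2 : 0 < e / 2 by rewrite divr_gt0.
have [c [d [h1 h2 h3]]] := H _ e2.
pose X := inB (p ** c); pose Y := inB (p ** d).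
rewrite -/X -/Y in h1 h2 h3.
pose L := nrm (inB c) + nrm (inB d).
pose M := 2 * (nrm X + nrm Y) + L.
have c0 := nrm_ge0 (inB c); have d0 := nrm_ge0 (inB d).
have X0 := nrm_ge0 X; have Y0 := nrm_ge0 Y.
have K1 : 0 <= L * M by rewrite mulr_ge0 /M /L; lra.
have [s [s0 s1 sK]] := exists_small_factor e2 K1.
have [_ [r _ <-] pr] := ap _ s0.
pose X' := inB (a ** (r ** c)); pose Y' := inB (a ** (r ** d)).
exists (r ** c), (r ** d); rewrite -/X' -/Y'.
have diff (c' : B) : nrm (inB (a ** (r ** c')) - inB (p ** c')) <= s * nrm (inB c').
  rewrite -inBB cmulA -cmulBl nrm_inB; apply: le_trans (cnorm_cmul _ _) _.
  by rewrite nrm_inB ler_wpM2r ?cnorm_ge0// -cnormN opprB ltW.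
have XX : nrm (X' - X) <= s * L.
  by apply: le_trans (diff c) _; rewrite ler_wpM2l ?(ltW s0)// /L; lra.
have YY : nrm (Y' - Y) <= s * L.
  by apply: le_trans (diff d) _; rewrite ler_wpM2l ?(ltW s0)// /L; lra.
have L0 : 0 <= L by rewrite /L; lra.
have sL : s * L <= L by nra.
clearbody X' Y' X Y.
have X'n : nrm X' <= nrm X + L by have := nrmD (X' - X) X; rewrite subrK; lra.
have Y'n : nrm Y' <= nrm Y + L by have := nrmD (Y' - Y) Y; rewrite subrK; lra.
have key u v : nrm u <= s * L -> nrm v <= M -> nrm u * nrm v <= s * (L * M).
  by move=> h h'; rewrite mulrA; apply: ler_pM; rewrite ?nrm_ge0.
have key2 u z : nrm u <= s * L -> 0 <= z -> z <= M -> nrm u * z <= s * (L * M).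
  by move=> h h0 h'; rewrite mulrA; apply: ler_pM; rewrite ?nrm_ge0.
split.
- have := nrm_tri (star X' * X') (star X * X) n; have := nrm_sqB X' X.
  have := key2 (X' - X) (nrm X' + nrm X) XX.
  have := nrm_ge0 X'; rewrite /M => q0 q1 q2 q3.
  have := q1 _ _; rewrite addr_ge0// => /(_ isT) q4.
  have {}q4 := q4 _; have : nrm X' + nrm X <= 2 * (nrm X + nrm Y) + L by lra.
  by move=> /q4; rewrite -/M; lra.
- have := nrm_tri (star Y' * Y') (star Y * Y) m; have := nrm_sqB Y' Y.
  have := key2 (Y' - Y) (nrm Y' + nrm Y) YY.
  have := nrm_ge0 Y'; rewrite /M => q0 q1 q2 q3.
  have := q1 _ _; rewrite addr_ge0// => /(_ isT) q4.
  have {}q4 := q4 _; have : nrm Y' + nrm Y <= 2 * (nrm X + nrm Y) + L by lra.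
  by move=> /q4; rewrite -/M; lra.
- have -> : star X' * Y' = star (X' - X) * Y' + star X * (Y' - Y) + star X * Y.
    by rewrite starB; ncring.
  have A1 := nrmD (star (X' - X) * Y' + star X * (Y' - Y)) (star X * Y).
  have A2 := nrmD (star (X' - X) * Y') (star X * (Y' - Y)).
  have A3 := nrmM (star (X' - X)) Y'; have A4 := nrmM (star X) (Y' - Y).
  rewrite !nrm_star in A3 A4.
  have A5 : nrm (X' - X) * nrm Y' <= s * L * (nrm Y + L).
    by apply: ler_pM; rewrite ?nrm_ge0.
  have A6 : nrm X * nrm (Y' - Y) <= nrm X * (s * L) by rewrite ler_wpM2l.
  have A7 : s * L * (nrm Y + L) + nrm X * (s * L) <= s * (L * M).
    have -> : s * L * (nrm Y + L) + nrm X * (s * L) = s * (L * (nrm X + nrm Y + L)) by ring.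
    by rewrite !ler_wpM2l ?(ltW s0)// /M; lra.
  lra.
Qed.

Lemma projection_norm p : projection p -> p != 0 -> cnorm p = 1.
Proof.
move=> [sp pp] p0; have := cnorm_starM p; rewrite sp pp.
have p1 : cnorm p != 0 by apply: contra_neq p0 => /cnorm_eq0.
by move=> H; apply: (mulfI p1); rewrite mulr1 -expr2 -H.
Qed.

(** Cut the first element of a pair for (p, p) to X in p B p, with X^* X close
    to p. Then X^* X + (1 - p) is positive and invertible, and v = X r, with r
    the root of its inverse, satisfies v^* v = p. If v v^* were p, the second
    element Y would be v (v^* Y), but v^* Y = r X^* Y is too small for that. *)
Lemma infinite_projection_of_pair p : projection p -> p != 0 ->
  approx_pair p (inB p) (inB p) -> infinite_projection p.
Proof.
move=> pr p0 H; split => //; have [sp pp] := pr.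
have pn := projection_norm pr p0.
have e0 : 0 < 1 / 4 :> R by rewrite divr_gt0.
have [c [d [h1 h2 h3]]] := H _ e0.
pose P := inB p; have sP : star P = P by rewrite /P inB_star sp.
have PP : P * P = P by rewrite /P -inBM pp.
have nP : nrm P = 1 by rewrite /P nrm_inB pn.
pose X := inB (p ** c ** p); pose Y := inB (p ** d).
have PX : P * X = X by rewrite /P /X -inBM -!cmulA (cmulA p p) pp.
have XP : X * P = X by rewrite /P /X -inBM -!cmulA pp.
have PY : P * Y = Y by rewrite /P /Y -inBM cmulA pp.
have XE : X = inB (p ** c) * P by rewrite /X inBM.
have g1 : nrm (star X * X - P) <= 1 / 4.
  have -> : star X * X - P = P * (star (inB (p ** c)) * inB (p ** c) - P) * P.
    by rewrite XE starM sP mulrBr mulrBl PP PP -!mulrA.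
  apply: le_trans (nrmM _ _) _; rewrite nP mulr1.
  by apply: le_trans (nrmM _ _) _; rewrite nP mul1r ltW.
have g3 : nrm (star X * Y) <= 1 / 4.
  rewrite XE starM sP -mulrA; apply: le_trans (nrmM _ _) _.
  by rewrite nP mul1r ltW.
have g2 : 3 / 4 <= nrm Y ^+ 2.
  rewrite -nrm_starM; rewrite -/Y -/P in h2.
  by have := nrmD (star Y * Y) (- (star Y * Y - P)); rewrite nrmN opprB addrC subrK nP; lra.
pose h := star X * X - P + rsc (1 / 4).
have sXX : star (star X * X - P) = star X * X - P by rewrite starB starM starK sP.
have ph : upos h by rewrite /h addrC; exact: upos_rscD.
(* 3/4 + h is X^* X + (1 - p), and h >= 0 as X^* X is within 1/4 of p. *)
have s0 : 0 < 3 / 4 :> R by rewrite divr_gt0.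
have [r0 [pr0 gr0 r0E r0n _]] := upos_resolvent ph s0.
have r0I : r0 * (rsc (3 / 4) + h) = 1.
  by rewrite mulrDr rsc_comm -r0E subrK.
have hE : rsc (3 / 4) + h = star X * X + (1 - P).
  rewrite /h addrC -addrA -rscD (_ : 1 / 4 + 3 / 4 = 1 :> R) ?rsc1; last by field.
  by ncring.
rewrite hE in r0I.
have [r [pr_ rE gr]] := upos_sqrt pr0; have sr := upos_sa pr_.
have hP : h * P = P * h.
  rewrite /h !mulrDl !mulrDr rsc_comm; congr (_ + _).
  rewrite mulNr mulrN PP -mulrA XP; congr (_ - _).
  by rewrite mulrA -{1}sP -starM XP.
have r0P : r0 * P = P * r0 by exact: gen_comm_of gr0 hP.
have rP : r * P = P * r by exact: gen_comm_of gr r0P.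
have rh : r * h = h * r.
  by apply: (gen_comm_of gr); exact: gen_comm gr0 (@gen_id _ _ h).
have rI : r * (star X * X + (1 - P)) * r = 1.
  have Hr : (rsc (3 / 4) + h) * r = r * (rsc (3 / 4) + h).
    by rewrite mulrDr mulrDl rh (rsc_comm _ r).
  by rewrite -hE -mulrA Hr mulrA rE hE r0I.
have PrP : r * (1 - P) * r = 1 - P.
  have E1 : (star X * X + (1 - P)) * (1 - P) = 1 - P.
    have -> : (star X * X + (1 - P)) * (1 - P) = star X * (X - X * P) + (1 - P - (P - P * P)) by ncring.
    by rewrite XP PP !subrr mulr0 add0r subr0.
  have E2 : r0 * (1 - P) = 1 - P by rewrite -{1}E1 mulrA r0I mul1r.
  rewrite -mulrA mulrBl mulrBr mul1r rE -rP mulrA rE -E2 mulrBr mulr1 //.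
pose v := X * r.
have vv : star v * v = P.
  have -> : star v * v = r * (star X * X + (1 - P)) * r - r * (1 - P) * r.
    by rewrite /v starM sr; ncring.
  by rewrite rI PrP subKr.
have v0 : v.1 = 0 by rewrite /v scM mul0r.
have vE : inB v.2 = v by exact: inBK.
have Pv : P * v = v by rewrite /v mulrA PX.
have vP : v * P = v by rewrite /v -mulrA rP mulrA XP.
have vY : nrm (star v * Y) <= nrm r * (1 / 4).
  rewrite /v starM sr -mulrA; apply: le_trans (nrmM _ _) _.
  by rewrite ler_wpM2l ?nrm_ge0.
clearbody v.
exists v.2; split.
- by apply: inB_inj; rewrite inBM -inB_star vE.
- rewrite /cle; set w := p - _.
  have ww : w ** w = w.
    apply: inB_inj; rewrite !(inBM, inBB, =^~ inB_star) vE -/P.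
    have E : (v * star v) * (v * star v) = v * star v.
      by rewrite mulrA -(mulrA v) vv vP.
    have E1 : P * (v * star v) = v * star v by rewrite mulrA Pv.
    have E2 : (v * star v) * P = v * star v.
      by have := congr1 star E1; rewrite !starM starK sP.
    by rewrite mulrBl !mulrBr PP E E1 E2 subrr subr0.
  rewrite -ww; apply: positive_square.
  by rewrite /w cstarB sp cstarM cstarK.
apply/eqP => /(congr1 inB); rewrite inBM -inB_star vE -/P => vvP.
have Yv : Y = v * (star v * Y) by rewrite mulrA vvP PY.
have nv : nrm v ^+ 2 = 1 by rewrite -nrm_starM vv nP.
have nr : nrm r ^+ 2 * (3 / 4) <= 1.
  by rewrite -nrmsq// rE; move: r0n; rewrite nrm_rscM gtr0_norm// mulrC.
have : nrm Y <= nrm v * nrm (star v * Y) by rewrite {1}Yv nrmM.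
have a1 := nrm_ge0 v; have a2 := nrm_ge0 (star v * Y); have a3 := nrm_ge0 Y; have a4 := nrm_ge0 r.
have nv1 : nrm v <= 1 by nra.
move=> YY; have : nrm Y <= nrm r * (1 / 4) by nra.
nra.
Qed.

End Projections.

(** * Projections in hereditary subalgebras *)

Section Hereditary.
Context {R : realType} {B : cstarAlgType R}.
Variable D : set B.
Hypothesis hD : hereditary setT D.
Implicit Types (a b c d p x y : B) (u v : unitization B).

(** For u >= 0, x^* u x is at most a multiple of x^* x, so it lies in D.
    Polarization in x and the decomposition of u into positive elements give
    the general case. *)
Lemma hereditary_absorb u d1 d2 : D d1 -> D d2 -> D (inB d1 * u * inB d2).2.
Proof.
have [[[D0 DD DZ] _ DM Ds] _ her] := hD.
pose G u x y := (star (inB x) * u * inB y).2.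
have DN x : D x -> D (- x) by move=> Dx; rewrite -scaleN1r; exact: DZ.
have GE u' x y : inB (G u' x y) = star (inB x) * u' * inB y.
  by apply: inBK; rewrite !scM mulr0.
clearbody G.
have GDu u1 u2 x y : G (u1 + u2) x y = G u1 x y + G u2 x y.
  by apply: inB_inj; rewrite inBD !GE; ncring.
have GZu (l : R[i]) u1 x y : G (l *: u1) x y = l *: G u1 x y.
  by apply: inB_inj; rewrite inBZ !GE -scalerAr -scalerAl.
have diag u1 x : upos u1 -> D x -> D (G u1 x x).
  move=> pu Dx; apply: (her ((nrm u1)%:C *: (cstar x ** x))) => //.
  - by apply: DZ; apply: (DM) => //; exact: Ds.
  - by apply/positiveP; rewrite GE; exact: upos_conj.
  - apply/positiveP; rewrite inBB GE inBZ inBM -rscE -inB_star.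
    have -> : rsc (nrm u1) * (star (inB x) * inB x) - star (inB x) * u1 * inB x =
        star (inB x) * (rsc (nrm u1) - u1) * inB x.
      by rewrite mulrBr mulrBl rsc_comm; ncring.
    by apply: upos_conj; apply: upos_rscB => //; exact: upos_sa.
have sym u1 x y : upos u1 -> D x -> D y -> D (G u1 x y + G u1 y x).
  move=> pu Dx Dy.
  have -> : G u1 x y + G u1 y x = G u1 (x + y) (x + y) - G u1 x x - G u1 y y.
    by apply: inB_inj; rewrite !inBB !inBD !GE !inBD starD; ncring.
  by apply: (DD); [apply: (DD)|]; try apply: DN; apply: diag => //; exact: DD.
have ci := conjc_i R.
have ii : 'i * 'i = -1 :> R[i] by rewrite -expr2 sqr_i.
have half x : D (x + x) -> D x.
  move=> H; have -> : x = (2^-1)%:C *: (x + x).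
    rewrite scalerDr -scalerDl -rmorphD (_ : 2^-1 + 2^-1 = 1 :> R) ?rmorph1 ?scale1r//.
    by field.
  exact: DZ.
have posG u1 x y : upos u1 -> D x -> D y -> D (G u1 x y).
  move=> pu Dx Dy; apply: half.
  have H1 := sym u1 x y pu Dx Dy.
  have H2 := DZ (- 'i) _ (sym u1 x ('i *: y) pu Dx (DZ 'i _ Dy)).
  have E : - 'i *: (G u1 x ('i *: y) + G u1 ('i *: y) x) = G u1 x y - G u1 y x.
    apply: inB_inj; rewrite inBZ inBB inBD !GE !inBZ starZ ci -scalerAr -!scalerAl scaleNr.
    by rewrite scaleNr -scalerBr scalerA -scaleNr ii opprK scale1r.
  rewrite E in H2; have := DD _ _ H1 H2.
  by rewrite addrACA subrr addr0.
have saG u1 x y : star u1 = u1 -> D x -> D y -> D (G u1 x y).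
  move=> su Dx Dy; have [p [q [pp pq -> _ _]]] := upos_parts su.
  by rewrite GDu -scaleN1r GZu; apply: (DD); [|apply: DZ]; exact: posG.
have allG u1 x y : D x -> D y -> D (G u1 x y).
  move=> Dx Dy; apply: half; rewrite -GDu.
  pose s := u1 + star u1; pose t := 'i *: (star u1 - u1).
  have ss : star s = s by rewrite starD starK addrC.
  have st : star t = t by rewrite starZ starB starK ci scaleNr -scalerN opprB.
  have -> : u1 + u1 = s + 'i *: t.
    by rewrite /s /t scalerA ii scaleN1r opprB; ncring.
  by rewrite GDu GZu; apply: (DD); [|apply: DZ]; exact: saG.
move=> D1 D2; have := allG u (cstar d1) d2 (Ds _ D1) D2.
by congr D; apply: inB_inj; rewrite GE inB_star cstarK inBK// !scM mulr0.
Qed.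

Lemma upos_quad (U : ucstarType R) (q : U) (t : R) : upos q -> 0 <= t ->
  upos (rsc t * q - q * q) -> nrm q <= t.
Proof.
move=> pq t0; have sq := upos_sa pq; move/(upos_mono (upos_square sq)).
rewrite nrmsq// nrm_rscM ger0_norm//; have := nrm_ge0 q.
have [->//|q0] := eqVneq (nrm q) 0.
by move=> q1; have q2 : 0 < nrm q; [rewrite lt_neqAle eq_sym q0|nra].
Qed.

Lemma upos_annihil (U : ucstarType R) (n k : U) : star n = n -> star k = k ->
  n * (k * k) * n = 0 -> n * k = 0.
Proof.
move=> sn sk H; have : k * n = 0.
  apply: nrm_eq0; apply/eqP; rewrite -sqrf_eq0 -nrm_starM starM sn sk.
  by rewrite -mulrA (mulrA k) mulrA H nrm0.
by move=> /(congr1 star); rewrite starM sn sk star0.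
Qed.

Hypothesis cuntz_full : forall c f, positive c -> positive f -> f != 0 -> cuntz_le c f.

(** Start from d0 >= 0 of norm 1 in D. Let f = (d0 - 1/2)_+, which is not 0,
    and let e be the minimum of 2 d0 and 1, so that e f = f. By comparability,
    y = z^* f z is within 1/2 of e for some z. With T = 2 (e - 1/2)_+ we get T
    f = f and 2 T y T >= T^3 = m, since T e T = T (1/2 + T/2) T. So upos_factor
    yields m = x^* x with x a limit of elements of sqrt f B; as m sqrt f = sqrt
    f, this gives m x = x. *)
Lemma scaling_element : nonzero D -> exists x, [/\ D x, cstar x ** x != 0,
  cstar x ** x ** x = x & upos (1 - inB (cstar x ** x))].
Proof.
move=> [d1 Dd1 d10]; have [[[D0 DD DZ] Dcl DM Ds] _ her] := hD.
have uD := ucs_unitization (And3 D0 DD DZ) Dcl DM.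
pose t := cnorm (cstar d1 ** d1).
have t0 : 0 < t.
  rewrite lt_neqAle cnorm_ge0 andbT eq_sym.
  by apply: contra_neq (starM_neq0 d10) => /cnorm_eq0.
pose d := (t^-1)%:C *: (cstar d1 ** d1).
have Dd : D d by apply: DZ; apply: (DM) => //; exact: Ds.
have tV : 0 <= t^-1 by rewrite invr_ge0 ltW.
pose d0 := inB d.
have pd : upos d0.
  by rewrite /d0 inBZ -rscE; apply: uposZ => //; rewrite inBM -inB_star; exact: upos_starM.
have nd : nrm d0 = 1.
  by rewrite /d0 nrm_inB cnormZ cabs_real ger0_norm// mulVf// gt_eqF.
have memB (u : unitization B) (s : R) : D u.2 -> D (u - rsc s).2.
  by move=> Du; exact: (ucsB uD (Du : [set u : unitization B | D u.2] u) (ucs_rsc s uD)).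
pose h : unitization B := d0 - rsc (1 / 2).
have sh : star h = h by rewrite starB star_rsc (upos_sa pd).
have Dh : D h.2 by exact: memB.
have h1 : h.1 = (- (1 / 2))%:C by rewrite -[LHS]/(0 - (rsc (1 / 2) : unitization B).1) sc_rsc sub0r rmorphN.
have [f [q [pf pq hE [fq0 qf0] [gf gq]]]] := upos_parts sh.
have f0 : f.1 = 0 by apply: (@sc_pos_part _ _ f q (- (1 / 2))) => //; rewrite -hE.
have sf := upos_sa pf; have sq := upos_sa pq.
have d0E : d0 = rsc (1 / 2) + (f - q) by rewrite -hE /h addrC subrK.
have q1 : q.1 = (1 / 2)%:C.
  have := congr1 fst hE; rewrite h1 /= f0 sub0r => /eqP.
  by rewrite rmorphN eqr_opp => /eqP.
have fn : f != 0.
  apply/eqP => f00; have : nrm d0 <= 1 / 2.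
    by apply: upos_le_nrm => //; rewrite d0E f00 sub0r subKr.
  by rewrite nd; lra.
have qd : q * d0 = rsc (1 / 2) * q - q * q.
  by rewrite d0E mulrDr mulrBr qf0 sub0r rsc_comm.
have dq : d0 * q = rsc (1 / 2) * q - q * q.
  by rewrite d0E mulrDl mulrBl fq0 sub0r.
have qn : nrm q <= 1 / 2.
  by apply: upos_quad => //; rewrite -qd; apply: uposM => //; rewrite qd dq.
(* q is the negative part of d0 - 1/2, so e is the minimum of 2 d0 and 1. *)
pose e : unitization B := 1 - rsc 2 * q.
have e0 : e.1 = 0.
  rewrite -[LHS]/(1 - (rsc 2 * q).1) scM sc_rsc q1 -rmorphM (_ : 2 * (1 / 2) = 1) ?subrr//.
  by field.
have [gf' gq'] := (gf _ uD Dh, gq _ uD Dh).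
have De : D e.2.
  have [u1 _ uM _ _] := uD.
  exact: (ucsB uD u1 (uM _ _ (ucs_rsc 2 uD) gq')).
have pe1 : upos (1 - e) by rewrite /e subKr; apply: uposZ.
have pe : upos e.
  have -> : e = rsc 2 * (rsc (1 / 2) - q).
    by rewrite /e mulrBr -rscM (_ : 2 * (1 / 2) = 1) ?rsc1//; field.
  by apply: uposZ => //; exact: upos_rscB.
have ef : e * f = f by rewrite /e mulrBl mul1r -mulrA qf0 mulr0 subr0.
have fE : inB f.2 = f by exact: inBK.
have eE : inB e.2 = e by exact: inBK.
have [z Hz] : exists z : B, cnorm (e.2 - cstar z ** f.2 ** z) < 1 / 2.
  have pfB : positive f.2 by apply/positiveP; rewrite fE.
  have peB : positive e.2 by apply/positiveP; rewrite eE.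
  have fB : f.2 != 0 by apply: contra_neq fn => H; rewrite -fE H.
  by apply: (cuntz_full peB pfB fB); rewrite divr_gt0.
pose y : unitization B := star (inB z) * f * inB z.
have ey : nrm (e - y) < 1 / 2.
  by move: Hz; rewrite -nrm_inB inBB !inBM -inB_star fE eE.
have py : upos y by exact: upos_conj.
clearbody e; pose h2 : unitization B := e - rsc (1 / 2).
have sh2 : star h2 = h2 by rewrite starB star_rsc (upos_sa pe).
have Dh2 : D h2.2 by exact: memB.
have h21 : h2.1 = (- (1 / 2))%:C.
  by rewrite -[LHS]/(e.1 - (rsc (1 / 2) : unitization B).1) e0 sc_rsc sub0r rmorphN.
have [p [r [pp pr h2E [pr0 rp0] [gp gr]]]] := upos_parts sh2.
have p0 : p.1 = 0 by apply: (@sc_pos_part _ _ p r (- (1 / 2))) => //; rewrite -h2E.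
have sp := upos_sa pp; have sr := upos_sa pr.
have eE' : e = rsc (1 / 2) + (p - r) by rewrite -h2E /h2 addrC subrK.
have rf : r * f = 0.
  have E1 : (p - r) * f = rsc (1 / 2) * f.
    rewrite -h2E /h2 mulrBl ef; apply: subr0_eq.
    transitivity (1 * f - (rsc (1 / 2) + rsc (1 / 2)) * f); first by ncring.
    by rewrite -rscD (_ : 1 / 2 + 1 / 2 = 1 :> R) ?rsc1 ?subrr//; field.
  have E2 : f * (r * r) * f + rsc (1 / 2) * (f * r * f) = 0.
    have : f * r * ((p - r) * f - rsc (1 / 2) * f) = 0 by rewrite E1 subrr mulr0.
    move=> /(congr1 -%R); rewrite oppr0 => <-.
    apply: subr0_eq; transitivity (f * (r * p) * f + (rsc (1 / 2) * (f * r) - (f * r) * rsc (1 / 2)) * f).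
      by ncring.
    by rewrite rp0 rsc_comm subrr mulr0 !mul0r addr0.
  have P1 : upos (f * (r * r) * f) by apply: upos_conj_sa => //; exact: upos_square.
  have P2 : upos (rsc (1 / 2) * (f * r * f)) by apply: uposZ => //; exact: upos_conj_sa.
  have E3 : f * (r * r) * f = 0.
    by apply: upos_anti => //; rewrite (addr0_eq E2).
  have := upos_annihil sf sr E3 => /(congr1 star); rewrite starM sf sr star0 //.
have pf2 : rsc 2 * p * f = f.
  have : rsc 2 * (e * f) = rsc 2 * f by rewrite ef.
  rewrite eE' mulrDl mulrBl rf subr0 mulrDr !mulrA -rscM (_ : 2 * (1 / 2) = 1); last by field.
  rewrite rsc1 mul1r => H; apply: (addrI f); rewrite H.
  by rewrite (_ : 2 = 1 + 1 :> R)// rscD rsc1 mulrDl mul1r.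
have pe' : p * e = rsc (1 / 2) * p + p * p.
  by rewrite eE' mulrDr mulrBr pr0 subr0 rsc_comm.
have ep' : e * p = rsc (1 / 2) * p + p * p.
  by rewrite eE' mulrDl mulrBl rp0 subr0.
have pn : nrm p <= 1 / 2.
  apply: upos_quad => //.
  have -> : rsc (1 / 2) * p - p * p = p * (1 - e).
    rewrite mulrBr mulr1 pe'; apply: subr0_eq.
    transitivity ((rsc (1 / 2) + rsc (1 / 2)) * p - 1 * p); first by ncring.
    by rewrite -rscD (_ : 1 / 2 + 1 / 2 = 1 :> R) ?rsc1 ?subrr//; field.
  have C : p * (1 - e) = (1 - e) * p.
    apply: subr0_eq; transitivity (e * p - p * e); first by ncring.
    by rewrite pe' ep' subrr.
  exact: (uposM pp pe1 C).
pose T := rsc 2 * p.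
have pT : upos T by exact: uposZ.
have sT := upos_sa pT.
have Tn : nrm T <= 1 by rewrite /T nrm_rscM ger0_norm//; lra.
have pTT : upos (T * T) by exact: upos_square.
have T3 : upos (T * T * T) by apply: uposM => //; rewrite mulrA.
have TE : T.1 = 0 by rewrite /T scM p0 mulr0.
have DT : D T.2.
  have [_ _ uM _ _] := uD; exact: (uM _ _ (ucs_rsc 2 uD) (gp _ uD Dh2)).
have Tf : T * f = f by exact: pf2.
have T2E : T = rsc 2 * (e - rsc (1 / 2)) + rsc 2 * r.
  by rewrite /T -/h2 h2E mulrBr subrK.
have Tr : T * r = 0 by rewrite /T -mulrA pr0 mulr0.
clearbody T.
pose m := T * T * T.
have mE : inB m.2 = m by apply: inBK; rewrite /m !scM TE mulr0.
have Dm : D m.2 by have [_ _ uM _ _] := uD; exact: (uM _ _ (uM _ _ DT DT) DT).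
have [k [pk kE gk]] := upos_sqrt pf; have sk := upos_sa pk.
have k0 : k.1 = 0 by apply: sc_sqrt; rewrite // kE.
have kE' : inB k.2 = k by exact: inBK.
have Dk : D k.2 by exact: (gk _ uD gf').
have mf : m * f = f by rewrite /m -!mulrA !Tf.
have mk : m * k = k.
  have sm : star (1 - m) = 1 - m by rewrite starB star1 (upos_sa T3).
  have : (1 - m) * k = 0.
    apply: upos_annihil => //; rewrite kE.
    by rewrite [(1 - m) * f]mulrBl mul1r mf subrr mul0r.
  by rewrite mulrBl mul1r => /subr0_eq.
pose g := rsc (Num.sqrt 2) * (k * inB z * T).
have gg : star g * g = rsc 2 * (T * y * T).
  have s2 : rsc (Num.sqrt 2) * rsc (Num.sqrt 2) = rsc 2 :> unitization B.
    by rewrite -rscM -expr2 sqr_sqrtr.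
  have sW : star (k * inB z * T) * (k * inB z * T) = T * y * T.
    by rewrite !starM sT sk /y -kE !mulrA.
  rewrite /g starM star_rsc -[LHS]mulrA [X in _ * X = _]mulrA s2.
  by rewrite mulrA rsc_comm -[LHS]mulrA sW.
have pgm : upos (star g * g - inB m.2).
  rewrite mE gg.
  have -> : rsc 2 * (T * y * T) - m = T * (rsc 2 * (rsc (1 / 2) - (e - y))) * T.
    rewrite /m.
    have TT : T * T = T * (rsc 2 * (e - rsc (1 / 2))).
      rewrite {2}T2E mulrDr; apply: subr0_eq.
      transitivity ((T * rsc 2) * r); first by ncring.
      by rewrite rsc_comm -mulrA Tr mulr0.
    rewrite TT; apply: subr0_eq.
    transitivity (rsc 2 * (T * y * T) - T * rsc 2 * y * T); first by ncring.
    by rewrite [T * rsc 2]rsc_comm; ncring.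
  by apply: upos_conj_sa => //; apply: uposZ => //; apply: upos_rscB; rewrite ?ltW// starB (upos_sa pe) (upos_sa py).
have pm : positive m.2 by apply/positiveP; rewrite mE.
have [x [xE Hx]] := positive_factor pm pgm.
have mg : m * g = g.
  by rewrite /g mulrA rsc_comm -[LHS]mulrA [X in _ * X]mulrA [m * (k * _)]mulrA mk.
have xx : star (inB x) * inB x = m by rewrite inB_star -inBM xE mE.
have nm : nrm m <= 1.
  rewrite /m; have := nrmM (T * T) T; have := nrmM T T; have := nrm_ge0 T.
  have := nrm_ge0 (T * T) => a1 a2 a3 a4; nra.
exists x; split.
- have Dc := (closedP D).1 Dcl.
  apply: Dc => s s0; have s2 : 0 < s / 2 by rewrite divr_gt0.
  have [w [_ _ _ Hw]] : exists w, [/\ upos w, gen m w, nrm (w * m) <= 1 &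
      nrm (inB x - inB x * w * m) < s / 2].
    by apply: upos_approx => //; rewrite xx subrr; exact: upos0.
  have K0 := nrm_ge0 (w * m); have [s' [s'0 _ s'K]] := exists_small_factor s2 K0.
  have [v Hv] := Hx _ s'0.
  pose G := rsc (Num.sqrt 2) * (inB z * T) * inB v * w.
  exists (inB k.2 * G * inB m.2).2; first exact: hereditary_absorb.
  have -> : inB k.2 * G * inB m.2 = inB (k * G * m).2.
    rewrite kE' mE inBK// scM (_ : (k * G).1 = 0) ?mul0r//.
    by rewrite scM k0 mul0r.
  rewrite -[X in cnorm (_ - X)]/((k * G * m).2) -nrm_inB inBB.
  rewrite [inB (k * G * m).2]inBK; last by rewrite scM (scM k) k0 !mul0r.
  have -> : k * G * m = g * inB v * w * m.
    have E : k * rsc (Num.sqrt 2) = rsc (Num.sqrt 2) * k by exact: rsc_comm.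
    by rewrite /G /g !mulrA E.
  have -> : inB x - g * inB v * w * m = (inB x - inB x * w * m) + (inB x - g * inB v) * (w * m) by ncring.
  apply: le_lt_trans (nrmD _ _) _.
  have := nrmM (inB x - g * inB v) (w * m).
  have : nrm (inB x - g * inB v) * nrm (w * m) <= s' * nrm (w * m) by rewrite ler_wpM2r// ltW.
  lra.
- rewrite xE; apply: contra_neq fn => m0.
  by rewrite -mf -mE m0 mul0r.
- apply: subr0_eq; apply: inB_inj; apply: (@nrm_small _ _ _ 2) => s s0.
  have [v Hv] := Hx _ s0.
  rewrite inBB inBM xE mE.
  have -> : m * inB x - inB x = m * (inB x - g * inB v) - (inB x - g * inB v) + (m * g - g) * inB v by ncring.
  rewrite mg subrr mul0r addr0; apply: le_trans (nrmB _ _) _.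
  have := nrmM m (inB x - g * inB v); have := nrm_ge0 (inB x - g * inB v); nra.
- by rewrite xE mE -rsc1; apply: upos_rscB => //; exact: upos_sa.
Qed.

End Hereditary.

(** For x from scaling_element and X = x^* x, let s = sqrt (1 - X). Then s x =
    0, so v = x + s is an isometry in D + C, and 1 - v v^* is a projection in
    D. If it is 0, then s^2 = s v v^* s = s^4, which says that 1 - X is a
    projection, and so X is one. *)
Lemma hereditary_projection {R : realType} {B : cstarAlgType R} (D : set B) :
  hereditary setT D ->
  (forall c f : B, positive c -> positive f -> f != 0 -> cuntz_le c f) ->
  nonzero D -> exists p, [/\ D p, projection p & p != 0].
Proof.
move=> hD cuntz_full nD; have [x [Dx x0 xxx pX]] := scaling_element hD cuntz_full nD.
have [[[D0 DD DZ] Dcl DM Ds] _ her] := hD.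
have uD := ucs_unitization (And3 D0 DD DZ) Dcl DM.
have [u1 uA uM uZ _] := uD.
have DX : D (cstar x ** x) by apply: (DM) => //; exact: Ds.
pose X := inB (cstar x ** x); pose w := inB x.
have XE : X = star w * w by rewrite /X inBM inB_star.
have Xw : X * w = w by rewrite /X /w -inBM xxx.
have [s [ps sE gs]] := upos_sqrt pX; have ss := upos_sa ps.
have Ds' : [set u : unitization B | D u.2] s.
  by apply: (gs _ uD); apply: (ucsB uD u1 (_ : [set u : unitization B | D u.2] X)).
have s1 : s.1 = 1.
  have [t t0 st] := upos_sc ps.
  have := congr1 fst sE; rewrite -[LHS]/((s * s).1) scM -[(1 - X).1]/(1 - 0) subr0 st -rmorphM.
  move=> /(congr1 (@complex.Re R)) /= H; congr (_%:C).
  by have : (t - 1) * (t + 1) = 0; [lra|nra].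
have sw : s * w = 0.
  apply: nrm_eq0; apply/eqP; rewrite -sqrf_eq0 -nrm_starM starM ss.
  have -> : star w * s * (s * w) = star w * (s * s * w) by ncring.
  by rewrite sE mulrBl mul1r [inB _ * w]Xw subrr mulr0 nrm0.
have ws : star w * s = 0 by have := congr1 star sw; rewrite starM ss star0.
pose v := w + s.
have v1 : star v * v = 1.
  rewrite /v starD ss; transitivity (star w * w + star w * s + s * w + s * s); first by ncring.
  by rewrite ws sw sE !addr0 -XE addrC subrK.
have Dv : D v.2 by exact: (uA _ _ (Dx : [set u : unitization B | D u.2] w) Ds').
have Dsv : D (star v).2.
  rewrite /v starD ss; apply: (uA _ _ _ Ds').
  by rewrite /w inB_star; exact: Ds.
pose P := 1 - v * star v.
have P1 : P.1 = 0.
  rewrite -[LHS]/(1 - (v * star v).1) scM.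
  rewrite (_ : v.1 = 1); last by rewrite -[LHS]/(0 + s.1) add0r.
  rewrite (_ : (star v).1 = 1) ?mulr1 ?subrr//.
  by rewrite /v starD ss /w inB_star -[LHS]/(0 + s.1) add0r.
have DP : D P.2 by apply: (ucsB uD u1 (uM _ _ (Dv : [set u : unitization B | D u.2] v) Dsv)).
have PE : inB P.2 = P by exact: inBK.
have sP : star P = P by rewrite /P starB star1 starM starK.
have PP : P * P = P.
  apply: subr0_eq; rewrite /P.
  transitivity (v * (star v * v - 1) * star v); first by ncring.
  by rewrite v1 subrr mulr0 mul0r.
have [P0|P0] := eqVneq P.2 0; last first.
  exists P.2; split => //; split; apply: inB_inj.
    by rewrite -inB_star PE.
  by rewrite inBM PE.
have vv : v * star v = 1.
  by apply/esym/subr0_eq; rewrite -/P -PE P0; exact: inB0.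
exists (cstar x ** x); split => //; split; first by apply: positive_sa; exact: positive_starM.
apply: inB_inj; rewrite inBM -/X.
have E : s * s * (s * s) = s * s.
  apply: subr0_eq; transitivity (s * (v * star v - 1) * s).
    rewrite /v starD ss.
    transitivity (s * (w * star w + w * s + s * star w + s * s - 1) * s - (s * w) * (star w * s)
       - (s * w) * (s * s) - s * s * (star w * s)); first by ncring.
    by rewrite sw ws !mul0r mulr0 !subr0; ncring.
  by rewrite vv subrr mulr0 mul0r.
rewrite sE in E; apply: subr0_eq.
transitivity ((1 - X) * (1 - X) - (1 - X)); first by ncring.
by rewrite E subrr.
Qed.

(** * Pure infiniteness *)

Section PurelyInfinite.
Context {R : realType} {B : cstarAlgType R}.
Implicit Types (a b c d f p x y : B) (D : set B).

(** If x = a z has x^* x close to c, then x^* x is the compression of a by sqrt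
    a z. *)
Lemma cuntz_of_infinite a c : simple B -> infinite a -> positive c -> cuntz_le c a.
Proof.
move=> sB ia pc; have [pa _ _] := ia.
have p0 : positive (0 : B) by apply/positiveP; rewrite inB0; exact: upos0.
have H := approx_pair_all sB ia pc p0.
have [k [pk kE]] := positive_sqrt pa.
have sk := positive_sa pk; have sa := positive_sa pa.
move=> e e0; have [z [_ [Hz _ _]]] := H e e0.
exists (k ** z).
rewrite -cnormN opprB -nrm_inB inBB.
rewrite (_ : inB _ - inB c = star (inB (a ** z)) * inB (a ** z) - inB c) //.
congr (_ - _); rewrite inB_star -inBM; congr inB.
rewrite !cstarM sk sa -[in RHS]kE -kE !cmulA //.
Qed.

(** A nonzero positive element dominates some a in A, and a dominates
    everything by cuntz_of_infinite; so hereditary_projection applies. The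
    projection dominates an infinite a in A, from which it inherits pairs. *)
Lemma purely_infinite_of_infinite (A : set B) : simple B ->
  (forall b, positive b -> b != 0 -> exists a, [/\ A a, positive a, a != 0 & cuntz_le a b]) ->
  (forall a, A a -> positive a -> a != 0 -> infinite a) -> purely_infinite B.
Proof.
move=> sB supp inf D hD nD.
have cuntz_full c f : positive c -> positive f -> f != 0 -> cuntz_le c f.
  move=> pc pf f0; have [a [Aa pa a0 af]] := supp f pf f0.
  by apply: cuntz_trans af; apply: cuntz_of_infinite => //; exact: inf.
have [p [Dp prp p0]] := hereditary_projection hD cuntz_full nD.
exists p => //; apply: infinite_projection_of_pair => //.
have pp : positive p by case: prp => sp pp; rewrite -pp; exact: positive_square.
have [a [Aa pa a0 ap]] := supp p pp p0.
have H := approx_pair_transport pa prp ap; apply: H.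
have ia := inf a Aa pa a0; exact: approx_pair_all.
Qed.

Lemma projection_infinite p : projection p -> p != 0 -> infinite_projection p -> infinite p.
Proof.
move=> [sp pp] p0 [_ [v [vv vvp vvn]]].
have pos_p : positive p by rewrite -pp; exact: positive_square.
have pv : p ** v = v.
  apply/esym/subr0_eq/(@inB_inj _ B); rewrite inB0.
  pose P := inB p; pose w := inB v; pose t := (1 - P) * w.
  have PP : P * P = P by rewrite /P -inBM pp.
  have sP : star P = P by rewrite /P inB_star sp.
  have st : star (star t) * star t = 0.
    apply: upos_anti; first exact: upos_starM.
    have s1P : star (1 - P) = 1 - P by rewrite starB star1 sP.
    have pos : upos (P - w * star w).
      by move/positiveP: vvp; rewrite inBB inBM -inB_star.
    have := upos_conj_sa s1P pos; congr upos.
    rewrite starK /t starM s1P; apply: subr0_eq.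
    transitivity ((1 - P) * (P - P * P)); first by ncring.
    by rewrite PP subrr mulr0.
  have t0 : t = 0.
    apply: nrm_eq0; apply/eqP; rewrite -nrm_star -sqrf_eq0 -nrm_starM st.
    by rewrite nrm0.
  by rewrite inBB inBM -/P -/w; rewrite /t mulrBl mul1r in t0.
pose q := p - v ** cstar v.
have vp : cstar v ** p = cstar v by rewrite -{1}sp -cstarM pv.
have vp' : v ** p = v.
  apply: subr0_eq; apply/eqP/negP => /negP/starM_neq0/eqP; apply.
  rewrite cstarB cstarM sp !cmulBr !cmulBl.
  have -> : p ** cstar v ** (v ** p) = p ** (cstar v ** v) ** p by rewrite !cmulA.
  by rewrite -[p ** cstar v ** v]cmulA [cstar v ** (v ** p)]cmulA vv !pp !subrr.
have pq : p ** q = q by rewrite /q cmulBr pp cmulA pv.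
have vq : cstar v ** q = 0 by rewrite /q cmulBr vp cmulA vv -{1}sp -cstarM vp' subrr.
have sq : cstar q = q by rewrite /q cstarB cstarM cstarK sp.
have qq : q ** q = q by rewrite {1}/q cmulBl pq -cmulA vq cmul0 subr0.
apply/infiniteP; split => //; exists q; split => //.
  by rewrite /q subr_eq0 eq_sym.
move=> e e0; exists v, q; rewrite pv pq !inB_star -!inBM vv sq qq vq !subrr inB0 !nrm0.
by split.
Qed.

Lemma right_closureM a x c : right_closure a x -> right_closure a (x ** c).
Proof.
move=> /closureP H; apply/closureP => e e0.
have [s [s0 _ sK]] := exists_small_factor e0 (cnorm_ge0 c).
have [_ [d _ <-] Hd] := H s s0.
exists (a ** (d ** c)); first by exists (d ** c).
rewrite cmulA -cmulBl; apply: le_lt_trans (cnorm_cmul _ _) (le_lt_trans _ sK).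
by rewrite ler_wpM2r ?cnorm_ge0// ltW.
Qed.

Lemma right_closure_subspace a : Defs.subspace (right_closure a).
Proof.
split.
- by apply: subset_closure; exists 0; rewrite ?cmul0.
- move=> x y /closureP Hx /closureP Hy; apply/closureP => e e0.
  have e2 : 0 < e / 2 by rewrite divr_gt0.
  have [_ [c _ <-] Hc] := Hx _ e2; have [_ [d _ <-] Hd] := Hy _ e2.
  exists (a ** (c + d)); first by exists (c + d).
  rewrite cmulDr opprD addrACA; apply: le_lt_trans (cnormD _ _) _; lra.
- move=> l x /closureP Hx; apply/closureP => e e0.
  have [s [s0 _ sK]] := exists_small_factor e0 (cabs_ge0 l).
  have [_ [c _ <-] Hc] := Hx s s0.
  exists (a ** (l *: c)); first by exists (l *: c).
  rewrite cmulZr -scalerBr cnormZ mulrC.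
  by apply: le_lt_trans sK; rewrite ler_wpM2r ?cabs_ge0// ltW.
Qed.

(** The intersection of the closed right ideal generated by a with its adjoint;
    for a >= 0 it is the closure of a B a. *)
Definition closed_corner a : set B :=
  [set x | right_closure a x /\ right_closure a (cstar x)].

(** If 0 <= y <= d, then by upos_approx sqrt y is a limit of elements d r sqrt
    y. *)
Lemma closed_corner_hereditary a : hereditary setT (closed_corner a).
Proof.
have [L0 LD LZ] := right_closure_subspace a.
have Lc := (closedP _).1 (@closed_closure _ [set a ** c | c in [set: B]]).
split => //.
- split.
  + split.
    * by split; rewrite ?cstar0.
    * by move=> x y [x1 x2] [y1 y2]; split; rewrite ?cstarD; exact: LD.
    * by move=> l x [x1 x2]; split; rewrite ?cstarZ; exact: LZ.
  + apply/closedP => x H; split; apply: Lc => e /H[y [y1 y2] xy].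
      by exists y.
    by exists (cstar y) => //; rewrite -cstarB cnorm_star.
  + by move=> x y [x1 x2] [y1 y2]; split; rewrite ?cstarM; exact: right_closureM.
  + by move=> x [x1 x2]; split; rewrite ?cstarK.
- move=> d y [Ld _] _ py yd.
  suff Ly : right_closure a y by split; rewrite ?(positive_sa py).
  have [k [pk kE]] := positive_sqrt py.
  have sk : star (inB k) = inB k by rewrite inB_star positive_sa.
  apply: Lc => e e0; have [s [s0 _ sK]] := exists_small_factor e0 (cnorm_ge0 k).
  have pd : upos (inB d).
    by apply/positiveP; rewrite -(subrK y d); exact: positiveD.
  have pkk : upos (inB d - star (inB k) * inB k).
    by rewrite sk -inBM kE -inBB; exact/positiveP.
  have [r [pr _ _ Hr]] := upos_approx pd pkk s0.
  have zE : inB (r * inB k).2 = r * inB k by apply: inBK; rewrite scM mulr0.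
  exists (d ** (r * inB k).2 ** k); first by do 2!apply: right_closureM.
  rewrite -kE -cmulBl; apply: le_lt_trans (cnorm_cmul _ _) (le_lt_trans _ sK).
  rewrite ler_wpM2r ?cnorm_ge0// ltW//; move: Hr.
  rewrite -nrm_star starB !starM sk (upos_sa pr) (upos_sa pd).
  by rewrite -nrm_inB inBB inBM zE.
Qed.

(** An infinite projection p in the corner of a admits a pair for (a, a),
    because B is simple. As p lies in the closure of a B, so does a. *)
Lemma infinite_of_purely_infinite a : simple B -> purely_infinite B ->
  positive a -> a != 0 -> infinite a.
Proof.
move=> sB piB pa a0.
have nD : nonzero (closed_corner a).
  have La : right_closure a a.
    apply/closureP => e e0; have [z [pz _ Hz]] := approx_unit a e0.
    exists (a ** z); first by exists z.
    rewrite -cnorm_star cstarB cstarM (positive_sa pa) (positive_sa pz).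
    by rewrite -cnormN opprB.
  by exists a => //; split; rewrite ?(positive_sa pa).
have [p [pc _] ip] := piB _ (closed_corner_hereditary a) nD.
have [prp _] := ip.
have p0 : p != 0.
  case: ip => _ [v [vv _ /eqP vvn]]; apply/eqP => pz; apply: vvn.
  have v0 : v = 0.
    by apply/eqP/negP => /negP/starM_neq0; rewrite vv pz eqxx.
  by rewrite pz v0 c0mul.
have infp := projection_infinite prp p0 ip.
apply/infiniteP; split => //; exists a; split => //.
by apply: approx_pair_closure pc _; exact: approx_pair_all.
Qed.

End PurelyInfinite.

(** * Detection of ideals and pure infiniteness *)

Theorem theorem1 (R : realType) (B : cstarAlgType R) (A : set B)
    (hA : cstar_subalgebra A) (hA0 : nonzero A) (hAB : aperiodic A)
    (E : {linear B -> B}) (hE : conditional_expectation A E) :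
  let N := max_kernel_ideal E in
  [/\ (* (1) *)
      forall b : B, positive b -> ~ N b ->
        exists a : B, [/\ A a, positive a, a != 0 & cuntz_le a b],
      (* (2) *)
      forall (Q : cstarAlgType R) (pi : {linear B -> Q}),
        is_quotient N pi -> supports (pi @` A),
      (* (3) *)
      (forall (Q : cstarAlgType R) (pi : {linear B -> Q}),
         is_quotient N pi -> detects_ideals_in_quotient A pi) /\
      (forall (J : set B) (Q : cstarAlgType R) (pi : {linear B -> Q}),
         ideal setT J -> is_quotient J pi ->
         detects_ideals_in_quotient A pi -> J = N),
      (* (4) *)
      simple B <->
        N = [set 0] /\
        (forall I : set B, ideal A I -> nonzero I ->
           closure (linear_span
             [set z | exists b i b' : B, I i /\ z = b ** i ** b']) = setT)
    & (* (5) *)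
      simple B ->
        (purely_infinite B <->
         forall a : B, A a -> positive a -> a != 0 -> infinite a)].

Proof.
move=> N.
have sup b : positive b -> ~ N b ->
    exists a : B, [/\ A a, positive a, a != 0 & cuntz_le a b].
  exact: support_off_kernel.
split=> //.
- by move=> Q pi; exact: supports_quotient.
- split; first by move=> Q pi; exact: detects_quotient.
  by move=> J Q pi; exact: quotient_unique.
- exact: simple_iff.
move=> sB; split=> [piB a _|inf].
  exact: infinite_of_purely_infinite.
apply: (@purely_infinite_of_infinite _ _ A) => // b pb b0; apply: sup => //.
by rewrite /N (simple_max_kernel hA0 hE sB); exact/eqP.
Qed.
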